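(* One-tape double-head infinite time Turing machines with a one-cell scratch pad compute exactly the same partial functions $\mathbb{R}\to\mathbb{R}$ and have exactly the same clockable ordinals as ordinary (three-tape) infinite time Turing machines.
   Context: $\mathbb{R}=2^\omega$. An infinite time Turing machine (ITTM) has three tapes (input, scratch, output) of cells indexed by $\omega$ with values in $\{0,1\}$, one head scanning a column of all three tapes, and a program with finitely many states including start, halt and a limit state. Successor steps are as for ordinary Turing machines (moving left from the leftmost cell leaves the head in place); at limit stages the head returns to the leftmost cell, the state becomes the limit state, and each cell takes the $\limsup$ of its earlier values. On input $a$, $a$ is on the input tape and other tapes are $0$; upon halting the output is the output tape; $f$ is computable if some program on input $a$ halts iff $a\in\mathrm{dom}(f)$, with output $f(a)$. An ordinal is clockable for a class of machines if some program of that class on input $0=\langle000\cdots\rangle$ first reaches the halt state at exactly that stage. A one-tape double-head ITTM with a one-cell scratch pad has a single tape with cells indexed by $\{-1\}\cup\omega$, cell $-1$ being the scratch pad; its head reads and writes two adjacent cells at once and moves one cell left or right per step; it starts on, and at limit stages returns to, the leftmost position, with cells taking $\limsup$ values at limits; the input is written on cells $0,1,2,\dots$ (pad initially $0$), and upon halting the output is the contents of cells $0,1,2,\dots$. *)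

(* Defs.v *)
From mathcomp Require Import all_boot.
Set Implicit Arguments. Unset Strict Implicit. Unset Printing Implicit Defensive.

(* Reals are R = 2^omega, i.e. infinite bit sequences. *)
Definition real := nat -> bool.

(* Strict well-orders, used as (representatives of) ordinals.           *)
Record WO := {
  wcar :> Type;
  wlt : wcar -> wcar -> Prop;
  wlt_wf : well_founded wlt;
  wlt_trans : forall x y z, wlt x y -> wlt y z -> wlt x z;
  wlt_total : forall x y, wlt x y \/ x = y \/ wlt y x }.
Arguments wlt {w} _ _.

Definition iso_below (A W : WO) (top : W) : Prop :=
  exists f : A -> W,
    (forall a, wlt (f a) top) /\
    (forall a b, wlt a b <-> wlt (f a) (f b)) /\
    (forall v, wlt v top -> exists a, f a = v).

Record config (S C : Type) := Config {
  cstate : S; chead : nat; ctape : C -> bool }.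

Definition limsup_below (W : WO) (w : W) (f : W -> bool) : Prop :=
  forall v, wlt v w -> exists u, (u = v \/ wlt v u) /\ wlt u w /\ f u = true.

Definition is_run (S C : Type) (init : config S C)
    (step : config S C -> config S C) (limst : S)
    (W : WO) (c : W -> config S C) : Prop :=
  forall w : W,
    ((forall v, ~ wlt v w) -> c w = init) /\
    (forall v, wlt v w -> (forall u, ~ (wlt v u /\ wlt u w)) ->
        c w = step (c v)) /\
    ((exists v, wlt v w) -> (forall v, wlt v w -> exists u, wlt v u /\ wlt u w) ->
        cstate (c w) = limst /\ chead (c w) = 0 /\
        forall i, (ctape (c w) i = true <-> limsup_below w (fun u => ctape (c u) i))).

(* the computation first reaches the halt state at stage top
   (W is then a well-order of type top+1) *)
Definition halts_at (S C : Type) (init : config S C)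
    (step : config S C -> config S C) (limst halt : S)
    (W : WO) (top : W) (c : W -> config S C) : Prop :=
  (forall v, v = top \/ wlt v top) /\
  is_run init step limst c /\
  cstate (c top) = halt /\
  (forall v, wlt v top -> cstate (c v) <> halt).

Inductive tape3 := Inp | Scr | Out.

Record ittm := {
  ist : finType;
  istart : ist; ihalt : ist; ilim : ist;
  idistinct : [/\ istart != ihalt, ilim != ihalt & istart != ilim];
  (* (state, bits read on input/scratch/output) ->
     (new state, bits written on input/scratch/output, move right?) *)
  idelta : ist -> bool * bool * bool -> ist * (bool * bool * bool) * bool }.

Definition iconfig (p : ittm) := config (ist p) (tape3 * nat).

Definition iinit (p : ittm) (a : real) : iconfig p :=
  Config (istart p) 0 (fun x => match x with (Inp, n) => a n | _ => false end).

Definition istep (p : ittm) (c : iconfig p) : iconfig p :=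
  let h := chead c in
  let t := ctape c in
  match idelta (cstate c) (t (Inp, h), t (Scr, h), t (Out, h)) with
  | (s', (w0, w1, w2), mv) =>
      Config s' (if mv then h.+1 else h.-1)
        (fun x => match x with
                  | (k, n) => if n == h then
                                match k with Inp => w0 | Scr => w1 | Out => w2 end
                              else t (k, n) end)
  end.

Definition ioutput (p : ittm) (c : iconfig p) : real := fun n => ctape c (Out, n).

Definition ittm_halts_with (p : ittm) (a b : real) : Prop :=
  exists (W : WO) (top : W) (c : W -> iconfig p),
    halts_at (iinit p a) (@istep p) (ilim p) (ihalt p) top c /\ ioutput (c top) = b.

Definition ittm_halts (p : ittm) (a : real) : Prop :=
  exists (W : WO) (top : W) (c : W -> iconfig p),
    halts_at (iinit p a) (@istep p) (ilim p) (ihalt p) top c.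

Definition ittm_computes (p : ittm) (f : real -> option real) : Prop :=
  forall a, match f a with
            | Some b => ittm_halts_with p a b
            | None => ~ ittm_halts p a end.

Definition ittm_clockable (A : WO) : Prop :=
  exists (p : ittm) (W : WO) (top : W) (c : W -> iconfig p),
    halts_at (iinit p (fun _ => false)) (@istep p) (ilim p) (ihalt p) top c /\
    iso_below A top.

(* Cells: None = the scratch pad (cell -1), Some n = cell n.
   Head position k : nat stands for the paper's position k-1: the head
   reads/writes the two adjacent cells k-1 and k (position 0 = leftmost,
   reading the pad and cell 0). *)
Definition cellAt (k : nat) : option nat := if k is k'.+1 then Some k' else None.

Record ottm := {
  ost : finType;
  ostart : ost; ohalt : ost; olim : ost;
  odistinct : [/\ ostart != ohalt, olim != ohalt & ostart != olim];
  (* (state, left bit, right bit) -> (new state, (left, right) written, move right?) *)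
  odelta : ost -> bool * bool -> ost * (bool * bool) * bool }.

Definition oconfig (q : ottm) := config (ost q) (option nat).

Definition oinit (q : ottm) (a : real) : oconfig q :=
  Config (ostart q) 0 (fun x => match x with Some n => a n | None => false end).

Definition ostep (q : ottm) (c : oconfig q) : oconfig q :=
  let h := chead c in
  let t := ctape c in
  match odelta (cstate c) (t (cellAt h), t (cellAt h.+1)) with
  | (s', (wl, wr), mv) =>
      Config s' (if mv then h.+1 else h.-1)
        (fun x => if x == cellAt h then wl
                  else if x == cellAt h.+1 then wr else t x)
  end.

Definition ooutput (q : ottm) (c : oconfig q) : real := fun n => ctape c (Some n).

Definition ottm_halts_with (q : ottm) (a b : real) : Prop :=
  exists (W : WO) (top : W) (c : W -> oconfig q),
    halts_at (oinit q a) (@ostep q) (olim q) (ohalt q) top c /\ ooutput (c top) = b.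

Definition ottm_halts (q : ottm) (a : real) : Prop :=
  exists (W : WO) (top : W) (c : W -> oconfig q),
    halts_at (oinit q a) (@ostep q) (olim q) (ohalt q) top c.

Definition ottm_computes (q : ottm) (f : real -> option real) : Prop :=
  forall a, match f a with
            | Some b => ottm_halts_with q a b
            | None => ~ ottm_halts q a end.

Definition ottm_clockable (A : WO) : Prop :=
  exists (q : ottm) (W : WO) (top : W) (c : W -> oconfig q),
    halts_at (oinit q (fun _ => false)) (@ostep q) (olim q) (ohalt q) top c /\
    iso_below A top.

(* Main.v *)
Require Import Defs.
From HB Require Import structures.
From mathcomp Require Import all_boot zify.
From Stdlib Require Import Classical ClassicalEpsilon FunctionalExtensionality ProofIrrelevance.

Set Implicit Arguments. Unset Strict Implicit. Unset Printing Implicit Defensive.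

(** Write every stage as omega * b + m and describe a computation by its configurations at the
    beginnings of the omega-blocks. If every step of one machine is carried out by another one in
    finitely many steps, intermediate cell values being old or new ones, then the two have the same
    limsups at the end of every block, so they stay synchronized at all limit stages.

    Double head on three tapes: pad and cells are kept on the scratch and output tapes. The input is
    first copied to the output tape. For clocks (input 0, no copying) the machine reads the first n
    columns at each limit; these decide whether the double-head machine halts n steps later.

    Three tapes on one: the input is spread out to one bit per five-cell column by omega passes, each
    shifting the remaining input; a flag that is switched on and off in each pass is on at omega^2 and only
    then. After the simulation the output is written back in omega steps, the pad telling
    at the next limit that all is done. For clocks, n columns are packed into one and the machine halts
    at the first limit at which column 0 shows a fixed pattern. The two visible cells must suffice to see this
    at once: the pad is on when a cell outside the pattern is on, and cell 0 flashes whenever all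
    cells of the pattern have been on since its last flash. *)

(** * Well-orders and limits of blocks *)

(** A slower simulation preserves the stages omega * b but not the stages omega * b + n inside a
    block. For clocks the last n steps are therefore not simulated: their outcome depends on
    finitely many cells at the left end and is settled at the limit itself. A clock may be tailored
    to one halting computation; [n] and the pattern are taken from it. Recoding an input costs extra
    blocks and would shift the clock, which is why computing and clocking use different machines.
    Limsup commutes with copying a cell and with finite disjunctions, but not with conjunctions.
    That all cells of a set are on at a limit cannot be recorded by merely updating a bit, and this
    forces the flashing cell. At a limit of blocks a single 1 in cofinally many blocks counts. Even
    a transient 1 on a wrong cell would do harm, so tapes are controlled at every single step. *)

Section WellOrders.
Variable B : WO.
Implicit Types (u v w : B) (f g : B -> nat -> bool).

Lemma wlt_irr w : ~ wlt w w.
Proof. by elim/(well_founded_ind (@wlt_wf B)): w => w IH h; exact: (IH w h h). Qed.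

Lemma wlt_asym u v : wlt u v -> ~ wlt v u.
Proof. by move=> h1 h2; exact: (wlt_irr (wlt_trans h1 h2)). Qed.

Lemma least (P : B -> Prop) :
  (exists w, P w) -> exists w, P w /\ forall v, wlt v w -> ~ P v.
Proof.
case=> w; elim/(well_founded_ind (@wlt_wf B)): w => w IH Pw.
case: (classic (exists v, wlt v w /\ P v)) => [[v [vw Pv]]|n]; first exact: IH vw Pv.
by exists w; split=> // v vw Pv; apply: n; exists v.
Qed.

Definition imm u v := wlt u v /\ forall x, ~ (wlt u x /\ wlt x v).

Lemma imm_exists u : (exists v, wlt u v) -> exists v, imm u v.
Proof.
case/least=> v [uv min]; exists v; split=> // x [ux xv]; exact: min xv ux.
Qed.

Variant position b : Prop :=
| PosMin of (forall v, ~ wlt v b)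
| PosSucc u of imm u b
| PosLim v of wlt v b & (forall v, wlt v b -> exists u, wlt v u /\ wlt u b).

Lemma positionP b : position b.
Proof.
case: (classic (exists v, wlt v b)) => [[v vb]|n]; last first.
  by apply: PosMin => v vb; apply: n; exists v.
case: (classic (exists u, imm u b)) => [[u iu]|n]; first exact: PosSucc iu.
apply: (PosLim vb) => {vb}v vb; apply: NNPP => nu; apply: n; exists v; split=> // x [vx xb].
by apply: nu; exists x.
Qed.

Definition tle v n u m := (v = u /\ n <= m) \/ wlt v u.

Lemma tle_refl v n : tle v n v n. Proof. by left. Qed.

Lemma tle_trans v n u m w l : tle v n u m -> tle u m w l -> tle v n w l.
Proof.
move=> [[<- nm]|vu] [[<- ml]|uw]; [left|right|right|right] => //.
  by split=> //; apply: leq_trans ml.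
exact: wlt_trans uw.
Qed.

Lemma tle_total v n u m : tle v n u m \/ tle u m v n.
Proof.
case: (wlt_total v u) => [h|[<-|h]]; [by left; right| |by right; right].
by case: (leqP n m) => h; [left|right]; left; split=> //; apply: ltnW.
Qed.

(** [f u m] stands for the value of a cell at stage omega * u + m, and [tle] is the order of stages;
    this is the limsup at stage omega * b. *)
Definition limval f b :=
  forall v n, wlt v b -> exists u m, tle v n u m /\ wlt u b /\ f u m.

Definition infi (f : nat -> bool) := forall N, exists n, N <= n /\ f n.

Lemma limval_imm f u b : imm u b -> limval f b <-> infi (f u).
Proof.
move=> [ub no]; split=> [h N|h v n vb].
  case: (h u N ub) => v [m [[[<- le]|uv] [vb fm]]]; first by exists m.
  by case: (no v).
case: (wlt_total v u) => [vu|[->|uv]]; last by case: (no v).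
  by case: (h 0) => m [_ fm]; exists u, m; split=> //; right.
by case: (h n) => m [le fm]; exists u, m; split=> //; left.
Qed.

(** With no last block below [b], the place of a 1 inside its block is immaterial. Together with
    [limval_imm] this splits limits into two kinds: infinitely many ones in the last block, or some
    1 in cofinally many blocks. *)
Lemma limval_lim f b : (forall v, wlt v b -> exists u, wlt v u /\ wlt u b) ->
  limval f b <-> (forall v, wlt v b -> exists u, [/\ wlt v u, wlt u b & exists m, f u m]).
Proof.
move=> lim; split=> [h v vb|h v n vb].
  case: (lim v vb) => w [vw wb]; case: (h w 0 wb) => u [m [t [ub fm]]].
  exists u; split=> //; last by exists m.
  by case: t => [[<- _]|wu] //; apply: wlt_trans wu.
by case: (h v vb) => u [vu ub [m fm]]; exists u, m; split=> //; right.
Qed.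

Lemma not_limval f b : ~ limval f b ->
  exists v n, wlt v b /\ forall u m, tle v n u m -> wlt u b -> f u m = false.
Proof.
move=> h; apply: NNPP => no; apply: h => v n vb; apply: NNPP => no'; apply: no.
exists v, n; split=> // u m t ub; apply: negbTE; apply/negP => fm.
by apply: no'; exists u, m.
Qed.

Lemma limval_eventually f b v n c : wlt v b ->
  (forall u m, tle v n u m -> wlt u b -> f u m = c) -> limval f b <-> c.
Proof.
move=> vb h; split=> [l|hc v' n' v'b].
  by case: (l v n vb) => u [m [t [ub fm]]]; rewrite -(h u m).
case: (tle_total v n v' n') => t.
  by exists v', n'; split; [exact: tle_refl|split=> //; rewrite h].
by exists v, n; split=> //; split=> //; rewrite h //; apply: tle_refl.
Qed.

Lemma limval_const b c : (exists v, wlt v b) -> limval (fun _ _ => c) b <-> c.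
Proof. by case=> v vb; apply: (limval_eventually (n := 0) vb). Qed.

Lemma limval_mono f g b : (forall u m, wlt u b -> f u m -> g u m) -> limval f b -> limval g b.
Proof.
move=> h l v n vb; case: (l v n vb) => u [m [t [ub fm]]].
by exists u, m; split=> //; split=> //; apply: h.
Qed.

Lemma limval_or f g b : limval (fun u m => f u m || g u m) b -> limval f b \/ limval g b.
Proof.
move=> h; apply: NNPP => /not_or_and [/not_limval [v [n [vb hf]]] /not_limval [v' [n' [v'b hg]]]].
case: (tle_total v n v' n') => t.
  case: (h v' n' v'b) => u [m [t' [ub]]].
  by rewrite (hf _ _ (tle_trans t t')) // (hg _ _ t').
case: (h v n vb) => u [m [t' [ub]]].
by rewrite (hg _ _ (tle_trans t t')) // (hf _ _ t').
Qed.

Lemma limval_has (I : eqType) (s : seq I) (f : I -> B -> nat -> bool) b : (exists v, wlt v b) ->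
  limval (fun u m => has (fun i => f i u m) s) b <-> exists2 i, i \in s & limval (f i) b.
Proof.
move=> nb; split=> [|[i si]]; last first.
  by apply: limval_mono => u m ub fi; apply/hasP; exists i.
elim: s => [/limval_const -/(_ nb) //|i s IH] /limval_or [h|/IH [j js h]].
  by exists i; rewrite ?mem_head.
by exists j => //; rewrite in_cons js orbT.
Qed.

End WellOrders.

(** * Limits along a convex embedding of block indices *)

Section Embedding.
Variables (B B' : WO) (e : B -> B').
Hypothesis emono : forall u v, wlt u v -> wlt (e u) (e v).
Hypothesis econv : forall u v x, wlt (e u) x -> wlt x (e v) -> exists w, x = e w.

Lemma emb_reflect u v : wlt (e u) (e v) -> wlt u v.
Proof.
case: (wlt_total u v) => [//|[->|/emono h1 h2]]; first by move/wlt_irr.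
by case: (wlt_asym h1 h2).
Qed.

(** Convexity makes [e b] the successor of [e u] if [b] is that of [u], and otherwise makes the
    image of [e] cofinal below [e b]. The second hypothesis leaves out the least block, whose
    initial tape need not be in encoded form yet. *)
Lemma limval_transfer (f : B -> nat -> bool) (g : B' -> nat -> bool) b :
  (forall u, wlt u b -> infi (f u) <-> infi (g (e u))) ->
  (forall v u, wlt v u -> wlt u b -> (exists n, f u n) <-> (exists n, g (e u) n)) ->
  (exists v, wlt v b) -> limval f b <-> limval g (e b).
Proof.
move=> hinf hex [v0 v0b]; case: (positionP b) => [no|u iu|_ _ lim]; first by case: (no v0).
  have iu' : imm (e u) (e b).
    case: iu => ub no; split; first exact: emono.
    move=> x [ux xb]; case: (econv ux xb) => w ?; subst x.
    by apply: (no w); split; apply: emb_reflect.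
  by rewrite (limval_imm _ iu) (limval_imm _ iu'); apply: hinf; case: iu.
have below x : wlt x (e b) -> exists v, wlt v b /\ (x = e v \/ wlt x (e v)).
  move=> xb; case: (wlt_total x (e v0)) => [h|[h|h]]; try by exists v0; split; auto.
  by case: (econv h xb) => w ?; subst x; exists w; split; auto; apply: emb_reflect.
have lim' x : wlt x (e b) -> exists y, wlt x y /\ wlt y (e b).
  case/below=> v [vb xv]; case: (lim v vb) => w [vw wb]; exists (e w).
  split; last exact: emono.
  by case: xv => [->|xv]; [exact: emono|apply: wlt_trans xv (emono vw)].
rewrite (limval_lim _ lim) (limval_lim _ lim'); split=> h.
  move=> x /below [v [vb xv]]; case: (h v vb) => u [vu ub fu].
  exists (e u); split; [|exact: emono|by apply/(hex v)].
  by case: xv => [->|xv]; [exact: emono|apply: wlt_trans xv (emono vu)].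
move=> v vb; case: (h (e v) (emono vb)) => x [vx xb [m gm]].
case: (econv vx xb) => u ?; subst x; exists u; split; try exact: emb_reflect.
by apply/(hex v); [exact: emb_reflect|exact: emb_reflect|exists m].
Qed.

End Embedding.

Lemma config_eq (S C : Type) (x y : config S C) : cstate x = cstate y -> chead x = chead y ->
  ctape x =1 ctape y -> x = y.
Proof.
case: x y => [s h t] [s' h' t'] /= -> -> /functional_extensionality -> //.
Qed.

Definition asb (P : Prop) : bool := if excluded_middle_informative P then true else false.

Lemma asbP P : asb P <-> P.
Proof. by rewrite /asb; case: excluded_middle_informative. Qed.

(** * Runs in block form *)

Section BlockRuns.
Variables (S C : Type) (init : config S C) (step : config S C -> config S C) (lim : S).

(* [s b] is the configuration at the beginning of the [b]-th block of length omega;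
   stage [omega * b + m] is then [iter m step (S b)]. *)
Definition brun (B : WO) (s : B -> config S C) := forall b : B,
  ((forall v, ~ wlt v b) -> s b = init) /\
  ((exists v, wlt v b) -> [/\ cstate (s b) = lim, chead (s b) = 0 &
     forall i, ctape (s b) i <-> limval (fun u m => ctape (iter m step (s u)) i) b]).

(** By well-founded recursion on any order of blocks. As [step] is total, a run continues past the
    halt state; halting is read off afterwards, so simulated and simulating runs can be set up
    independently of it. *)
Lemma brun_exists (B : WO) : exists s, @brun B s.
Proof.
pose F (b : B) (r : forall u, wlt u b -> config S C) : config S C :=
  if excluded_middle_informative (exists v, wlt v b) then
    Config lim 0 (fun i => asb (limval (fun u m =>
      if excluded_middle_informative (wlt u b) is left h
      then ctape (iter m step (r u h)) i else false) b))
  else init.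
pose s := Fix (@wlt_wf B) _ F.
have E b : s b = F b (fun u _ => s u).
  rewrite /s Fix_eq // => x f g fg; congr (F x _).
  by do 2!apply: functional_extensionality_dep => ?.
exists s => b; split=> [no|nb]; move: (E b); rewrite /F; case: excluded_middle_informative => h.
- by case: h => v vb; case: (no v).
- by [].
- move=> -> /=; split=> // i; rewrite asbP; split; apply: limval_mono => u m ub;
    by case: excluded_middle_informative.
- by case: h.
Qed.

Definition nohalt (halt : S) (y : config S C) := forall n, cstate (iter n step y) <> halt.

Definition bhalts (halt : S) (B : WO) (s : B -> config S C) (b : B) (n : nat) :=
  [/\ brun s, cstate (iter n step (s b)) = halt,
      forall u, wlt u b -> nohalt halt (s u) &
      forall m, m < n -> cstate (iter m step (s b)) <> halt].

Lemma bhalts_exists halt (B : WO) (s : B -> config S C) b : brun s ->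
  ~ nohalt halt (s b) -> exists b n, bhalts halt s b n.
Proof.
move=> r h; case: (@least B (fun b => ~ nohalt halt (s b))); first by exists b.
move=> {h}b' [h min]; exists b'.
have ex : exists n, asb (cstate (iter n step (s b')) = halt).
  by apply: NNPP => no; apply: h => n hn; apply: no; exists n; apply/asbP.
exists (ex_minn ex); case: ex_minnP => n /asbP hn mn; split=> //.
  by move=> u /min /NNPP.
move=> m lt hm; have /mn : asb (cstate (iter m step (s b')) = halt) by apply/asbP.
by rewrite leqNgt lt.
Qed.

End BlockRuns.

Lemma brun_tape S C (init : config S C) step lim (B : WO) (s : B -> config S C) b (f : C -> bool) :
  brun init step lim s -> (exists v, wlt v b) ->
  (forall i, limval (fun u m => ctape (iter m step (s u)) i) b <-> f i) ->
  s b = Config lim 0 f.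
Proof.
move=> r nb h; case: (r b) => _ /(_ nb) [hs hh ht]; apply: config_eq => //= i.
by apply/idP/idP => [/ht /h|/h /ht].
Qed.

(** * Simulations *)

Section Simulation.
Variables (S C S' C' : Type).
Variables (init : config S C) (step : config S C -> config S C) (lim : S).
Variables (init' : config S' C') (step' : config S' C' -> config S' C') (lim' halt' : S').
Variables (B B' : WO) (e : B -> B').
Hypothesis emono : forall u v, wlt u v -> wlt (e u) (e v).
Hypothesis econv : forall u v x, wlt (e u) x -> wlt x (e v) -> exists w, x = e w.
Variables (s : B -> config S C) (s' : B' -> config S' C').
Hypothesis run : brun init step lim s.
Hypothesis run' : brun init' step' lim' s'.

Lemma sim_cell i j b : (exists v, wlt v b) ->
  (forall u, wlt u b -> infi (fun n => ctape (iter n step (s u)) i)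
                      <-> infi (fun n => ctape (iter n step' (s' (e u))) j)) ->
  (forall v u, wlt v u -> wlt u b -> (exists n, ctape (iter n step (s u)) i)
                      <-> (exists n, ctape (iter n step' (s' (e u))) j)) ->
  ctape (s' (e b)) j = ctape (s b) i.
Proof.
move=> nb h1 h2; have nb' : exists v, wlt v (e b) by case: nb => v /emono; exists (e v).
case: (run b) => _ /(_ nb) [_ _ /(_ i) hi]; case: (run' (e b)) => _ /(_ nb') [_ _ /(_ j) hj].
have t := @limval_transfer _ _ e emono econv (fun u m => ctape (iter m step (s u)) i)
  (fun u m => ctape (iter m step' (s' u)) j) b h1 h2 nb.
by apply/idP/idP => [/hj /t /hi|/hi /t /hj].
Qed.

(** [V] is the encoded tape. By [HV] each of its cells copies one cell or is constant, and limsups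
    commute with such a map. *)
Variable V : config S C -> C' -> bool.
Hypothesis HV : forall j, (exists i, forall y, V y j = ctape y i) \/ (exists c, forall y, V y j = c).

(** [tracks] determines the limit directly after a block, [tracks_ex] the limits of blocks; these
    are the two kinds of limits. *)
Definition tracks y y' := nohalt step' halt' y' /\ forall j,
  infi (fun n => V (iter n step y) j) <-> infi (fun n => ctape (iter n step' y') j).
Definition tracks_ex y y' := forall j,
  (exists n, V (iter n step y) j) <-> (exists n, ctape (iter n step' y') j).

Variable G : B -> Prop.
Hypothesis sim_min : forall b, (forall v, ~ wlt v b) -> G b ->
  tracks (s b) (s' (e b)).
Hypothesis sim_lim : forall b, (exists v, wlt v b) -> G b ->
  s' (e b) = Config lim' 0 (V (s b)) -> tracks (s b) (s' (e b)) /\ tracks_ex (s b) (s' (e b)).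

(** Both machines reset state and head at every limit, so only cells have to be compared, whatever
    time is spent inside a block. [G] is the condition for a block to be simulated properly, such as
    not halting in it. *)
Theorem simulation b : (forall u, wlt u b -> G u) ->
  ((exists v, wlt v b) -> s' (e b) = Config lim' 0 (V (s b))) /\
  (forall u, wlt u b -> nohalt step' halt' (s' (e u))).
Proof.
elim/(well_founded_ind (@wlt_wf B)): b => b IH nh.
have tr u : wlt u b -> tracks (s u) (s' (e u)) /\
    ((exists v, wlt v u) -> tracks_ex (s u) (s' (e u))).
  move=> ub; case: (IH u ub) => [w wu|h _]; first by apply: nh; apply: wlt_trans ub.
  case: (classic (exists v, wlt v u)) => nu.
    by case: (sim_lim nu (nh u ub) (h nu)).
  by split=> //; apply: sim_min (nh u ub) => v vu; apply: nu; exists v.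
split; last by move=> u /tr [[]].
move=> nb; have nb' : exists v, wlt v (e b) by case: nb => v /emono; exists (e v).
apply: (brun_tape run') => // j; case: (HV j) => [[i Vi]|[c Vc]].
  have <- : ctape (s' (e b)) j = V (s b) j.
    rewrite Vi; apply: (sim_cell nb) => [u /tr [[_ /(_ j)] h _]|v u vu /tr [_ h]].
      by rewrite -h; split=> h' N; case: (h' N) => n; exists n; rewrite ?Vi // -Vi.
    rewrite -(h _ j); last by exists v.
    by split=> -[n hn]; exists n; rewrite ?Vi // -Vi.
  by case: (run' (e b)) => _ /(_ nb') [_ _ /(_ j)] ->.
rewrite Vc -(limval_transfer emono econv (f := fun _ _ => c)) //; first exact: limval_const.
  move=> u /tr [[_ /(_ j) <-] _].
  by split=> h N; case: (h N) => n; exists n; rewrite ?Vc // -(Vc (iter n step (s u))).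
move=> v u vu /tr [_ /(_ (ex_intro _ v vu) j) <-].
by split=> -[n h]; exists n; rewrite ?Vc // -(Vc (iter n step (s u))).
Qed.

End Simulation.

(** * Macro steps: several steps of one machine for one step of another *)

Section Macro.
Variables (S C : Type) (step : config S C -> config S C).
Implicit Types x y z : config S C.

(** The path has at least one step, so that infinitely many paths in a row exhaust a block. [U] is
    required before [y] only, since [y] belongs to the next path. *)
Definition spath (U : config S C -> Prop) x y :=
  exists k, [/\ 0 < k, iter k step x = y & forall t, t < k -> U (iter t step x)].

Lemma spath1 U x : U x -> spath U x (step x).
Proof. by move=> Ux; exists 1; split=> // -[]. Qed.

Lemma spath_trans U x y z : spath U x y -> spath U y z -> spath U x z.
Proof.
move=> [k [k0 <- hk]] [l [l0 <- hl]]; exists (l + k); split; first by rewrite addn_gt0 l0.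
  by rewrite iterD.
move=> t tl; case: (ltnP t k) => [/hk //|kt].
by rewrite -(subnK kt) iterD; apply: hl; rewrite ltn_subLR // addnC.
Qed.

Lemma spath_cons U x y : U x -> spath U (step x) y -> spath U x y.
Proof. by move=> Ux; apply: spath_trans; apply: spath1. Qed.

Variables (x : config S C) (R : nat -> config S C -> Prop) (U : nat -> config S C -> Prop) (t0 : nat).
Hypothesis R0 : R 0 (iter t0 step x).

Lemma macro_at K : (forall n z, n < K -> R n z -> exists z', spath (U n) z z' /\ R n.+1 z') ->
  forall n, n <= K -> exists t, [/\ t0 + n <= t, R n (iter t step x) &
    forall t', t0 <= t' < t -> exists2 n', n' < n & U n' (iter t' step x)].
Proof.
move=> h; elim=> [_|n IH nK].
  by exists t0; rewrite addn0; split=> // t'; case: leqP.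
case: (IH (ltnW nK)) => t [tn Rt ht]; case: (h n _ nK Rt) => z' [[k [k0 <- hk]] Rz'].
exists (k + t); rewrite iterD; split=> //; first by rewrite addnS -add1n leq_add.
move=> t' /andP [t0t' lt]; case: (ltnP t' t) => [t't|tt'].
  by case: (ht t'); rewrite ?t0t' // => n' n'n; exists n' => //; apply: ltnW.
exists n => //; rewrite -(subnK tt') iterD; apply: hk; lia.
Qed.

Hypothesis RS : forall n z, R n z -> exists z', spath (U n) z z' /\ R n.+1 z'.

Lemma macro_cover n t t1 : R n (iter t step x) -> t <= t1 ->
  exists2 n1, n <= n1 & U n1 (iter t1 step x).
Proof.
move: {2}(t1 - t).+1 (ltnSn (t1 - t)) => d; elim: d n t => // d IH n t lt Rn le.
case: (RS Rn) => z' [[k [k0 e hk]] Rz']; case: (ltnP t1 (t + k)) => h.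
  by exists n => //; rewrite -(subnK le) iterD; apply: hk; lia.
case: (IH n.+1 (k + t)); [lia|by rewrite iterD e|lia|].
by move=> n1 h1 h2; exists n1 => //; apply: ltnW.
Qed.

(** A 1 seen during macro step [n] is the value at [n] or at [n.+1], so intermediate steps create no
    ones of their own; and the [n]-th macro configuration does occur, at a time not before [n]. *)
Lemma macro_infi j (f : nat -> bool) :
  (forall n z, R n z -> ctape z j = f n) ->
  (forall n z, U n z -> ctape z j = f n \/ ctape z j = f n.+1) ->
  infi f <-> infi (fun t => ctape (iter t step x) j).
Proof.
move=> hR hU; split=> h N.
  case: (h N) => n [Nn fn]; case: (@macro_at n (fun n z _ => @RS n z) n (leqnn n)) => t [tn Rt _].
  by exists t; split; [lia|rewrite (hR n)].
case: (@macro_at N (fun n z _ => @RS n z) N (leqnn N)) => t [tn Rt _].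
case: (h t) => t1 [tt1 ft]; case: (macro_cover Rt tt1) => n1 Nn1 /hU [] e.
  by exists n1; rewrite -e.
by exists n1.+1; rewrite -e; split=> //; apply: leqW.
Qed.

Lemma macro_ex j (f : nat -> bool) :
  (forall n z, R n z -> ctape z j = f n) ->
  (forall n z, U n z -> ctape z j = f n \/ ctape z j = f n.+1) ->
  (forall t, t < t0 -> ctape (iter t step x) j = f 0 \/ ctape (iter t step x) j = f 1) ->
  (exists n, f n) <-> (exists t, ctape (iter t step x) j).
Proof.
move=> hR hU h0; split=> [[n fn]|[t]].
  case: (@macro_at n (fun n z _ => @RS n z) n (leqnn n)) => t [tn Rt _].
  by exists t; rewrite (hR n).
case: (ltnP t t0) => [/h0 [] ->|lt]; [by exists 0|by exists 1|].
by case: (macro_cover R0 lt) => n1 _ /hU [] ->; [exists n1|exists n1.+1].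
Qed.

Lemma macro_nohalt halt : (forall n z, U n z -> cstate z <> halt) ->
  (forall t, t < t0 -> cstate (iter t step x) <> halt) -> nohalt step halt x.
Proof.
move=> hU h0 t; case: (ltnP t t0) => [/h0 //|lt].
by case: (macro_cover R0 lt) => n1 _ /hU.
Qed.

End Macro.

(** * Constructions of well-orders *)

Lemma proj1_sig_inj T (P : T -> Prop) (x y : sig P) : proj1_sig x = proj1_sig y -> x = y.
Proof.
by case: x y => [x px] [y py] /= e; subst y; rewrite (proof_irrelevance _ px py).
Qed.

Definition WOsub (B : WO) (P : B -> Prop) : WO.
Proof.
refine (@Build_WO (sig P) (fun x y => wlt (proj1_sig x) (proj1_sig y)) _ _ _).
- move=> [x px]; elim/(well_founded_ind (@wlt_wf B)): x px => x IH px.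
  by constructor=> -[y py] /= yx; apply: IH.
- by move=> x y z; apply: wlt_trans.
- move=> x y; case: (wlt_total (proj1_sig x) (proj1_sig y)) => [h|[h|h]]; auto.
  by right; left; apply: proj1_sig_inj.
Defined.

Definition WOlex (B : WO) : WO.
Proof.
refine (@Build_WO (B * nat)%type (fun x y => wlt x.1 y.1 \/ x.1 = y.1 /\ x.2 < y.2) _ _ _).
- move=> [b n]; elim/(well_founded_ind (@wlt_wf B)): b n => b IH.
  elim/ltn_ind => n IHn; constructor=> -[u m] /= [ub|[-> mn]]; [exact: IH|exact: IHn].
- move=> [b n] [u m] [v l] /= [h1|[-> h1]] [h2|[<- h2]]; [left|left|left|right] => //.
    exact: wlt_trans h2.
  by split=> //; apply: ltn_trans h2.
- move=> [b n] [u m] /=; case: (wlt_total b u) => [h|[->|h]]; try by left; left.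
    by case: (ltngtP n m) => h; [left; right|right; right; right|right; left; rewrite h].
  by right; right; left.
Defined.

Definition sum_lt (A B : WO) (x y : A + B) : Prop :=
  match x, y with
  | inl a, inl b => wlt a b | inl _, inr _ => True
  | inr _, inl _ => False | inr a, inr b => wlt a b end.

Lemma sum_lt_wf (A B : WO) : well_founded (@sum_lt A B).
Proof.
have wl a : Acc (@sum_lt A B) (inl a).
  elim/(well_founded_ind (@wlt_wf A)): a => a IH.
  by constructor; case=> [b ba|b []]; exact: IH.
case=> [a|b]; first exact: wl.
elim/(well_founded_ind (@wlt_wf B)): b => b IH.
by constructor; case=> [a _|a ab]; [exact: wl|exact: IH].
Qed.

Definition WOsum (A B : WO) : WO.
Proof.
refine (@Build_WO (A + B)%type (@sum_lt A B) (@sum_lt_wf A B) _ _).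
- move=> [x|x] [y|y] [z|z] //=; exact: wlt_trans.
- move=> [x|x] [y|y] /=; [|by left|by right; right|];
    by case: (wlt_total x y) => [h|[->|h]]; [left|right; left|right; right].
Defined.

Definition WOunit : WO.
Proof.
by refine (@Build_WO unit (fun _ _ => False) _ _ _) => // -[] //; right; left; case: y.
Defined.

Definition WOnat : WO.
Proof.
refine (@Build_WO nat (fun m n => m < n) _ _ _).
- by elim/ltn_ind => n IH; constructor=> m; apply: IH.
- by move=> x y z; apply: ltn_trans.
- by move=> x y; case: (ltngtP x y) => h; auto.
Defined.

(* All stages up to [omega * b + n]. *)
Definition WOtime (B : WO) (b : B) (n : nat) : WO :=
  @WOsub (WOlex B) (fun x => tle x.1 x.2 b n).

Definition time_top (B : WO) (b : B) (n : nat) : WOtime b n :=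
  exist _ ((b, n) : WOlex B) (tle_refl b n).

(** * Block form and stage form of halting computations *)

Section BlocksStages.
Variables (S C : Type) (init : config S C) (step : config S C -> config S C) (lim halt : S).

(** In [WOtime] the limit stages are the pairs [(u, 0)] with [u] not least, and there [limval] and
    [limsup_below] range over the same stages. *)
Lemma blocks_halts (B : WO) (s : B -> config S C) b n : bhalts init step lim halt s b n ->
  halts_at init step lim halt (time_top b n)
    (fun x : WOtime b n => iter (proj1_sig x).2 step (s (proj1_sig x).1)).
Proof.
case=> r hn hu hm; split; last split; last split=> //.
- move=> [[u m] t]; have [[/= e le]|ub] : tle u m b n by []; last by right; left.
  subst u; move: le; rewrite leq_eqVlt => /orP [/eqP e|lt]; last by right; right.
  by left; apply: proj1_sig_inj => /=; rewrite e.
- move=> [[u m] t]; split; [|split].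
  + move=> no; case: m t no => [|m] /= t no; last first.
      have t' : tle u m b n by apply: (tle_trans _ t); left.
      by case: (no (exist _ (u, m) t')) => /=; right.
    case: (r u) => -> // v vu; have t' : tle v 0 b n by apply: (tle_trans _ t); right.
    by case: (no (exist _ (v, 0) t')) => /=; left.
  + move=> [[v l] t'] /= lt no; case: m t lt no => [|m] t lt no.
      case: lt => [vu|[] //].
      have t2 : tle v l.+1 b n by apply: (tle_trans _ t); right.
      by case: (no (exist _ (v, l.+1) t2)) => /=; split; [right|left].
    suff [-> ->] : v = u /\ l = m by [].
    have t2 : tle u m b n by apply: (tle_trans _ t); left.
    have := no (exist _ (u, m) t2); case: lt => [vu|[-> lm]] /= h; first by case: h; split; [left|right].
    split=> //; apply: NNPP => ne; apply: h; split; right; split=> //; lia.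
  + move=> [[[v l] t'] /= lt] h; case: m t lt h => [|m] t lt h; last first.
      have t2 : tle u m b n by apply: (tle_trans _ t); left.
      case: (h (exist _ (u, m) t2)) => [/=|[[w k] t3] /=]; first by right.
      move=> [[uw|[e1 mk]] [wu|[e2 km]]].
      * by case: (wlt_asym uw wu).
      * by subst w; case: (wlt_irr uw).
      * by subst w; case: (wlt_irr wu).
      * by move: (leq_trans mk km); rewrite ltnn.
    have nu : exists v, wlt v u by case: lt => [vu|[] //]; exists v.
    case: (r u) => _ /(_ nu) [hs hh ht]; split=> //; split=> // i.
    apply: (iff_trans (ht i)); split.
      move=> lv [[w k] t2] /= [wu|[] //]; case: (lv w k wu) => x [j [t3 [xu fx]]].
      have t4 : tle x j b n by apply: (tle_trans _ t); right.
      exists (exist _ (x, j) t4) => /=; split; last by split=> //; left.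
      case: t3 => [[e le]|wx]; last by right; left.
      subst x; move: le; rewrite leq_eqVlt => /orP [/eqP e|lt']; last by right; right.
      by left; apply: proj1_sig_inj; rewrite /= e.
    move=> ls w k wu; have t2 : tle w k b n by apply: (tle_trans _ t); right.
    case: (ls (exist _ (w, k) t2)) => [/=|[[x j] t3] /= [h1 [h2 h3]]]; first by left.
    exists x, j; split; last by split=> //; case: h2 => [|[]].
    case: h1 => [[-> ->]|[wx|[-> kj]]]; [exact: tle_refl|by right|].
    by left; split=> //; apply: ltnW.
- move=> [[u m] t] /= [/hu|[-> /hm]]; last by [].
  exact.
Qed.

Fixpoint nth_succ (W : WO) (w : W) (n : nat) (x : W) : Prop :=
  if n is n'.+1 then exists2 v, nth_succ w n' v & imm v x else x = w.

Lemma nth_succ_uniq (W : WO) (w : W) n x y : nth_succ w n x -> nth_succ w n y -> x = y.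
Proof.
elim: n x y => [|n IH] x y /=; first by move=> -> ->.
move=> [x' hx ix] [y' hy iy]; rewrite -(IH _ _ hx hy) in iy.
case: (wlt_total x y) => [l|[//|l]]; first by case: (proj2 iy x); split=> //; case: ix.
by case: (proj2 ix y); split=> //; case: iy.
Qed.

(** Block indices are the stages without immediate predecessor; each stage is a finite successor of
    exactly one of them (division of ordinals by omega). The last conjunct carries the order type
    below [top] over to the pairs, for use with clocks. *)
Lemma halts_blocks (W : WO) (top : W) c : halts_at init step lim halt top c ->
  exists (B : WO) (s : B -> config S C) b n,
    [/\ bhalts init step lim halt s b n, iter n step (s b) = c top &
        forall A, iso_below A top -> iso_below A (time_top b n)].
Proof.
move=> [htop [r [ht hn]]].
pose B := @WOsub W (fun w => forall v, ~ imm v w).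
pose s (b : B) := c (proj1_sig b).
pose Sc (b : B) := nth_succ (proj1_sig b).
have Sc0 b w : Sc b 0 w <-> w = proj1_sig b by [].
have ScS b m w : Sc b m.+1 w <-> exists2 v, Sc b m v & imm v w by [].
have cS v w : imm v w -> c w = step (c v).
  by move=> [vw no]; case: (r w) => _ [h _]; apply: h.
have cE b m w : Sc b m w -> c w = iter m step (s b).
  elim: m w => [|m IH] w; first by rewrite Sc0 => ->.
  by rewrite ScS => -[v /IH e /cS ->]; rewrite e.
have uniq_w b' m' w w' : Sc b' m' w -> Sc b' m' w' -> w = w' by apply: nth_succ_uniq.
have dec w : exists b m, Sc b m w.
  elim/(well_founded_ind (@wlt_wf W)): w => w IH.
  case: (classic (exists v, imm v w)) => [[v vw]|no].
    case: (IH v (proj1 vw)) => b [m h]; exists b, m.+1; apply/ScS; by exists v.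
  have p v : ~ imm v w by move=> h; apply: no; exists v.
  by exists (exist _ w p), 0; apply/Sc0.
have ge b m w : Sc b m w -> proj1_sig b = w \/ wlt (proj1_sig b) w.
  elim: m w => [|m IH] w; first by rewrite Sc0 => ->; left.
  rewrite ScS => -[v /IH [->|h] [vw _]]; right=> //.
  exact: wlt_trans vw.
have below b m w b' : wlt b b' -> Sc b m w -> wlt w (proj1_sig b').
  elim: m w => [|m IH] w bb'; first by rewrite Sc0 => ->.
  rewrite ScS => -[v /(IH _ bb') vb' [vw no]].
  case: (wlt_total w (proj1_sig b')) => [//|[e|b'w]].
    by case: (proj2_sig b' v); rewrite -e.
  by case: (no (proj1_sig b')).
have nxt b m w m' w' : m < m' -> Sc b m w -> Sc b m' w' -> wlt w w'.
  elim: m' w' => // m' IH w' mm' h; rewrite ScS => -[v hv [vw' no]].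
  move: mm'; rewrite ltnS leq_eqVlt => /orP [/eqP e|lt]; last exact: wlt_trans (IH v lt h hv) vw'.
  suff -> : w = v by [].
  by subst m'; apply: uniq_w h hv.
have exS b m b' : wlt b b' -> exists w, Sc b m w.
  move=> bb'; elim: m => [|m [w h]]; first by exists (proj1_sig b); apply/Sc0.
  have wb' := below _ _ _ _ bb' h.
  case: (@imm_exists W w); first by exists (proj1_sig b').
  by move=> v wv; exists v; apply/ScS; exists w.
have runs : brun init step lim s.
  move=> b; split=> [no|nb].
    case: (r (proj1_sig b)) => h _; apply: h => v vb.
    case: (dec v) => u [m hu]; apply: (no u) => /=.
    by case: (ge _ _ _ hu) => [->|h] //; apply: wlt_trans vb.
  have nb' : exists v, wlt v (proj1_sig b) by case: nb => v; exists (proj1_sig v).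
  have lb v : wlt v (proj1_sig b) -> exists u, wlt v u /\ wlt u (proj1_sig b).
    move=> vb; apply: NNPP => no; apply: (proj2_sig b v); split=> // x h; apply: no; by exists x.
  case: (r (proj1_sig b)) => _ [_ /(_ nb' lb) [h1 [h2 h3]]]; split=> // i.
  apply: (iff_trans (h3 i)); split=> h.
    move=> v m vb; case: (exS v m b vb) => w hw.
    case: (h w (below _ _ _ _ vb hw)) => u [wu [ub fu]].
    case: (dec u) => u' [l hu]; exists u', l; split; last first.
      by rewrite -(cE _ _ _ hu); split=> //; case: (ge _ _ _ hu) => [|h'] /=; [move=> ->|apply: wlt_trans h' ub].
    case: (tle_total v m u' l) => // -[[e le]|lt].
      subst u'; left; split=> //; rewrite leqNgt; apply/negP => lt.
      have := nxt _ _ _ _ _ lt hu hw; case: wu => [->|wu]; first exact: wlt_irr.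
      exact: wlt_asym wu.
    have := below _ _ _ _ lt hu; case: (ge _ _ _ hw) => [->|vw] uv.
      case: wu => [e|wu]; [by subst u; case: (wlt_irr uv)|by case: (wlt_asym wu uv)].
    have uw := wlt_trans uv vw.
    case: wu => [e|wu]; [by subst u; case: (wlt_irr uw)|by case: (wlt_asym wu uw)].
  move=> v vb; case: (dec v) => v' [m hv].
  have v'b : wlt v' b by case: (ge _ _ _ hv) => [|h'] /=; [move=> ->|apply: wlt_trans h' vb].
  case: (h v' m v'b) => u [l [t [ub fu]]]; case: (exS u l b ub) => w hw.
  exists w; split; last by split; [exact: below hw|rewrite (cE _ _ _ hw)].
  case: t => [[e le]|v'u].
    subst u; move: le; rewrite leq_eqVlt => /orP [/eqP e|lt]; last by right; apply: nxt lt hv hw.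
    by left; subst l; apply: uniq_w hw hv.
  right; have := below _ _ _ _ v'u hv; case: (ge _ _ _ hw) => [<- //|uw] vu.
  exact: wlt_trans uw.
have pre b m m' w : m <= m' -> Sc b m' w -> exists w', Sc b m w'.
  elim: m' w => [|k IH] w; first by rewrite leqn0 => /eqP ->; exists w.
  by rewrite leq_eqVlt => /orP [/eqP ->|lt]; [exists w|rewrite ScS => -[v hv _]; exact: IH hv].
case: (dec top) => b [n hb]; exists B, s, b, n.
have lt_top b' m' w : Sc b' m' w -> wlt b' b \/ b' = b /\ m' < n -> wlt w top.
  move=> hw [l|[e l]]; last by subst b'; apply: nxt l hw hb.
  by have := below _ _ _ _ l hw; case: (ge _ _ _ hb) => [-> //|bt] wb; apply: wlt_trans bt.
split; [split=> //|by rewrite -(cE _ _ _ hb)|].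
- by rewrite -(cE _ _ _ hb).
- move=> u ub m; case: (exS u m b ub) => w hw; rewrite -(cE _ _ _ hw).
  by apply: hn; apply: lt_top hw _; left.
- move=> m mn; suff [w hw] : exists w, Sc b m w.
    by rewrite -(cE _ _ _ hw); apply: hn; apply: lt_top hw _; right.
  exact: pre (ltnW mn) hb.
- move=> A [f [f1 [f2 f3]]].
  (* The isomorphism must be a function, so a decomposition is chosen for every stage. *)
  have [d hd] : exists d : W -> B * nat, forall w, Sc (d w).1 (d w).2 w.
    pose h w := constructive_indefinite_description _ (dec w).
    pose h' w := constructive_indefinite_description _ (proj2_sig (h w)).
    by exists (fun w => (proj1_sig (h w), proj1_sig (h' w))) => w; exact: (proj2_sig (h' w)).
  have mono (x y : WOlex B) w w' : Sc x.1 x.2 w -> Sc y.1 y.2 w' -> wlt x y -> wlt w w'.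
    move: x y => [x1 x2] [y1 y2] /= hw hw' [l|[e l]]; last by subst y1; apply: nxt l hw hw'.
    by have := below _ _ _ _ l hw; case: (ge _ _ _ hw') => [-> //|bt] wb; apply: wlt_trans bt.
  have refl (x y : WOlex B) w w' : Sc x.1 x.2 w -> Sc y.1 y.2 w' -> wlt w w' -> wlt x y.
    move=> hw hw' l; case: (wlt_total x y) => [//|[e|l']].
      by subst y; rewrite (uniq_w _ _ _ _ hw hw') in l; case: (wlt_irr l).
    by case: (wlt_asym l (mono _ _ _ _ hw' hw l')).
  have td (w : W) : wlt w top -> tle (d w).1 (d w).2 b n.
    move=> wt; case: (@refl (d w) (b, n) w top (hd w) hb wt) => [/= l|[/= e l]]; first by right.
    by left; split=> //; apply: ltnW.
  exists (fun a => exist _ (d (f a) : WOlex B) (td _ (f1 a))); split; [|split].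
  + by move=> a; apply: (refl (d (f a)) (b, n) _ _ (hd (f a)) hb (f1 a)).
  + move=> a a'; rewrite f2; split; first exact: (refl (d (f a)) (d (f a')) _ _ (hd _) (hd _)).
    exact: (mono (d (f a)) (d (f a')) _ _ (hd _) (hd _)).
  + move=> [[u m] t] lt; have [w hw] : exists w, Sc u m w.
      case: lt => [/= ub|[/= e l]]; first exact: exS ub.
      by subst u; apply: pre (ltnW l) hb.
    case: (f3 w); first exact: lt_top hw lt.
    move=> a fa; exists a; apply: proj1_sig_inj => /=; subst w.
    case: (wlt_total (d (f a) : WOlex B) (u, m)) => [l|[//|l]].
      by case: (wlt_irr (mono (d (f a)) (u, m) _ _ (hd (f a)) hw l)).
    by case: (wlt_irr (mono (u, m) (d (f a)) _ _ hw (hd (f a)) l)).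
Qed.

End BlocksStages.

Lemma not_halts_nohalt S C (init : config S C) step lim halt :
  ~ (exists (W : WO) (top : W) c, halts_at init step lim halt top c) ->
  forall (B : WO) (s : B -> config S C), brun init step lim s -> forall b, nohalt step halt (s b).
Proof.
move=> no B s r b; apply: NNPP => /(bhalts_exists r) [b' [n bh]].
by apply: no; do 3!eexists; exact: (blocks_halts bh).
Qed.

(** * Simulation through a sequence of encoded configurations *)

Section Encoded.
Variables (S C S' C' : Type) (step : config S C -> config S C) (step' : config S' C' -> config S' C').
Variables (halt' : S') (V : config S C -> C' -> bool) (E : nat -> config S' C').
Variables (y : config S C) (x' : config S' C') (t0 : nat).

Definition between (f g : C' -> bool) (z : config S' C') :=
  cstate z <> halt' /\ forall j, ctape z j = f j \/ ctape z j = g j.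

Hypothesis E0 : iter t0 step' x' = E 0.
Hypothesis nohalt0 : forall t, t < t0 -> cstate (iter t step' x') <> halt'.

Lemma enc_reach N : (forall n, n < N ->
    spath step' (between (ctape (E n)) (ctape (E n.+1))) (E n) (E n.+1)) ->
  exists t, iter t step' x' = E N /\ forall t', t' < t -> cstate (iter t' step' x') <> halt'.
Proof.
move=> h; have := @macro_at _ _ step' x' (fun n z => z = E n)
  (fun n => between (ctape (E n)) (ctape (E n.+1))) t0 E0 N _ N (leqnn N).
case=> [n z nN ->|t [_ e ht]]; first by exists (E n.+1); split=> //; apply: h.
exists t; split=> // t' t't; case: (ltnP t' t0) => [/nohalt0 //|le].
by case: (ht t'); [rewrite le|move=> n' _ []].
Qed.

Hypothesis EV : forall n, ctape (E n) = V (iter n step y).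
Hypothesis ES : forall n, spath step' (between (ctape (E n)) (ctape (E n.+1))) (E n) (E n.+1).

Lemma enc_tracks : tracks step step' halt' V y x'.
Proof.
pose R n (z : config S' C') := z = E n.
have RS n z : R n z -> exists z', spath step' (between (ctape (E n)) (ctape (E n.+1))) z z' /\ R n.+1 z'.
  by move=> ->; exists (E n.+1).
split; first by apply: (macro_nohalt (R := R) E0 RS) => // n z [].
move=> j; apply: (macro_infi (R := R) E0 RS) => [n z ->|n z [_ /(_ j)]]; first by rewrite EV.
by rewrite !EV.
Qed.

(** The [t0] preparatory steps must show the encoded tape already: an additional 1 there, repeated
    in cofinally many blocks, would survive at their limit. *)
Lemma enc_tracks_ex : (forall t j, t < t0 -> ctape (iter t step' x') j = V y j) ->
  tracks_ex step step' V y x'.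
Proof.
move=> h0 j; pose R n (z : config S' C') := z = E n.
have RS n z : R n z -> exists z', spath step' (between (ctape (E n)) (ctape (E n.+1))) z z' /\ R n.+1 z'.
  by move=> ->; exists (E n.+1).
apply: (macro_ex (R := R) E0 RS) => [n z ->|n z [_ /(_ j)]|t lt]; [by rewrite EV|by rewrite !EV|].
by left; apply: h0.
Qed.

End Encoded.

(** * Double-head machines on three tapes *)

(** The head stands in the column of the right cell. It remembers that bit ([SimL]), performs the
    transition at the left cell, and comes back to write the right bit and move ([SimR]). In column
    0 the pad and cell 0 are under the head together and one step is enough. *)
Inductive simst (T : Type) := Sim of T | SimL of T & bool | SimR of T & bool & bool.
Arguments Sim {T}. Arguments SimL {T}. Arguments SimR {T}.

Definition simst_enc T (x : simst T) : T + T * bool + T * bool * bool :=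
  match x with Sim s => inl (inl s) | SimL s r => inl (inr (s, r)) | SimR s w m => inr (s, w, m) end.
Definition simst_dec T (x : T + T * bool + T * bool * bool) : simst T :=
  match x with inl (inl s) => Sim s | inl (inr (s, r)) => SimL s r | inr (s, w, m) => SimR s w m end.
Lemma simst_encK T : cancel (@simst_enc T) (@simst_dec T). Proof. by case. Qed.
HB.instance Definition _ (T : finType) := Finite.copy (simst T) (can_type (@simst_encK T)).

Inductive mode := MStart | MLim | MHalt.
Definition mode_enc x : 'I_3 := match x with MStart => inord 0 | MLim => inord 1 | MHalt => inord 2 end.
Definition mode_dec (x : 'I_3) := match val x with 0 => MStart | 1 => MLim | _ => MHalt end.
Lemma mode_encK : cancel mode_enc mode_dec.
Proof. by case; rewrite /mode_dec /= inordK. Qed.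
HB.instance Definition _ := Finite.copy mode (can_type mode_encK).

(* The pad is cell 0 of the scratch tape, cell n is cell n of the output tape, and
   the input tape marks the leftmost column. *)
Definition otape (t : option nat -> bool) (x : tape3 * nat) : bool :=
  match x with
  | (Inp, n) => n == 0
  | (Scr, n) => (n == 0) && t None
  | (Out, n) => t (Some n)
  end.

Section OttmOnIttm.
(** The machine [p] is left open because two machines contain these transitions. They differ in
    [tgt (ohalt q)]: one of them halts there, the other goes on. *)
Variables (q : ottm) (p : ittm) (inj : simst (ost q) -> ist p) (tgt : ost q -> ist p).
Hypothesis hSim0 : forall s l r, idelta (inj (Sim s)) (true, l, r) =
  let: (s', (wl, wr), mv) := odelta s (l, r) in (tgt s', (true, wl, wr), mv).
Hypothesis hSim1 : forall s z r, idelta (inj (Sim s)) (false, z, r) =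
  (inj (SimL s r), (false, z, r), false).
Hypothesis hL : forall s r m z l, idelta (inj (SimL s r)) (m, z, l) =
  let: (s', (wl, wr), mv) := odelta s (l, r) in (inj (SimR s' wr mv), (m, z, wl), true).
Hypothesis hR : forall s wr mv m z x, idelta (inj (SimR s wr mv)) (m, z, x) = (tgt s, (m, z, wr), mv).
Hypothesis hnh : forall c, inj c <> ihalt p.

Definition oenc (y : oconfig q) : iconfig p := Config (tgt (cstate y)) (chead y) (otape (ctape y)).

Lemma oenc_step y : tgt (cstate y) = inj (Sim (cstate y)) ->
  spath (@istep p) (between (ihalt p) (otape (ctape y)) (otape (ctape (ostep y))))
    (oenc y) (oenc (ostep y)).
Proof.
case: y => s [|h] t ts; rewrite {1}/oenc /= ts.
  set U := between _ _ _; suff <- : istep (Config (inj (Sim s)) 0 (otape t)) = oenc (ostep (Config s 0 t)).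
    by apply: spath1; split=> /=; [exact: hnh|left].
  rewrite /istep /ostep /= hSim0; case: odelta => -[s' [wl wr]] mv; by apply: config_eq => //= -[[] [|n]].
case e : (odelta s (t (Some h), t (Some h.+1))) => [[s' [wl wr]] mv].
set U := between _ _ _.
have e1 : istep (Config (inj (Sim s)) h.+1 (otape t)) = Config (inj (SimL s (t (Some h.+1)))) h (otape t).
  rewrite /istep /= hSim1; apply: config_eq => //= -[k n].
  by case: eqP => [->|] //; case: k.
pose t2 x := if x == Some h then wl else t x.
have e2 : istep (Config (inj (SimL s (t (Some h.+1)))) h (otape t))
          = Config (inj (SimR s' wr mv)) h.+1 (otape t2).
  rewrite /istep /= hL e; apply: config_eq => //= -[k n].
  rewrite /t2; case: eqP => [->|ne]; case: k => //=; first by rewrite eqxx.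
  by case: eqP => // -[].
have e3 : istep (Config (inj (SimR s' wr mv)) h.+1 (otape t2)) = oenc (ostep (Config s h.+1 t)).
  rewrite /istep /ostep /= hR e; apply: config_eq => //= -[k n].
  rewrite /t2; case: k => //=; case: eqP => [->|ne] //=.
    by case: eqP => [[]|_]; [lia|rewrite eqxx].
  by case: eqP => // ne'; case: eqP => // -[].
apply: spath_cons; first by split; [exact: hnh|left].
rewrite e1; apply: spath_cons; first by split; [exact: hnh|left].
rewrite e2 -e3; apply: spath1; split; first exact: hnh.
move=> [k n]; rewrite /ostep /= e /t2 /=; case: k => /=; [by left|by left|].
by case: eqP => // _; [right|left].
Qed.

End OttmOnIttm.

(** * Computing functions: the copying machine *)

Section OttmToIttm.
Variable q : ottm.

(** [MStart] moves the input to the output tape and leaves the input tape blank. At the first limit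
    the mark of column 0 is thus missing, and from then on it is present: it tells the beginning of
    the simulation from a simulated limit. *)
Definition cdelta (x : simst (ost q) + mode) (b : bool * bool * bool) :
    (simst (ost q) + mode) * (bool * bool * bool) * bool :=
  let: (i, z, o) := b in
  let tgt s := if s == ohalt q then inr MHalt else inl (Sim s) in
  match x with
  | inl (Sim s) => if i then let: (s', (wl, wr), mv) := odelta s (z, o) in (tgt s', (true, wl, wr), mv)
                   else (inl (SimL s o), (false, z, o), false)
  | inl (SimL s r) => let: (s', (wl, wr), mv) := odelta s (o, r) in (inl (SimR s' wr mv), (i, z, wl), true)
  | inl (SimR s wr mv) => (tgt s, (i, z, wr), mv)
  | inr MStart => (inr MStart, (false, z, i), true)
  | inr MLim => if i then (inl (Sim (olim q)), (i, z, o), false)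
                else (inl (Sim (ostart q)), (true, z, o), false)
  | inr MHalt => (inr MHalt, b, false)
  end.

Definition copier : ittm.
Proof.
refine (@Build_ittm (simst (ost q) + mode)%type (inr MStart) (inr MHalt) (inr MLim) _ cdelta).
by split; apply/eqP.
Defined.

Definition ctgt (s : ost q) : ist copier := if s == ohalt q then inr MHalt else inl (Sim s).

Lemma copier_step y : cstate y <> ohalt q ->
  spath (@istep copier) (between (ihalt copier) (otape (ctape y)) (otape (ctape (ostep y))))
    (oenc ctgt y) (oenc ctgt (ostep y)).
Proof.
move=> /eqP/negbTE h; apply: (@oenc_step q copier inl ctgt) => //.
by rewrite /ctgt h.
Qed.

Variable a : real.

Lemma copy_iter n : iter n (@istep copier) (iinit copier a) =
  Config (inr MStart : ist copier) n (fun x => match x with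
    | (Inp, m) => if m < n then false else a m
    | (Scr, _) => false
    | (Out, m) => if m < n then a m else false end).
Proof.
elim: n => [|n IH]; first by apply: config_eq => //= -[[] m].
rewrite iterS IH /istep /=; apply: config_eq => //= -[k m].
have -> : (m < n.+1) = (m == n) || (m < n) by rewrite ltnS leq_eqVlt.
by case: eqP => [->|ne]; case: k; rewrite ?ltnn.
Qed.

Lemma copy_nohalt : nohalt (@istep copier) (ihalt copier) (iinit copier a).
Proof. by move=> n; rewrite copy_iter. Qed.

Variables (B B' : WO) (e : B -> B').
Hypothesis emono : forall u v, wlt u v -> wlt (e u) (e v).
Hypothesis econv : forall u v x, wlt (e u) x -> wlt x (e v) -> exists w, x = e w.
Hypothesis emin : forall b, (forall v, ~ wlt v b) -> exists2 u, imm u (e b) & forall v, ~ wlt v u.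
Variables (s : B -> oconfig q) (s' : B' -> iconfig copier).
Hypothesis run : brun (oinit q a) (@ostep q) (olim q) s.
Hypothesis run' : brun (iinit copier a) (@istep copier) (ilim copier) s'.

Lemma copier_init b : (forall v, ~ wlt v b) -> iter 1 (@istep copier) (s' (e b)) = oenc ctgt (s b).
Proof.
move=> mb; case: (emin mb) => u iu mu.
have -> : s' (e b) = Config (inr MLim : ist copier) 0
    (fun x => match x with (Out, m) => a m | _ => false end).
  apply: (brun_tape run'); first by exists u; case: iu.
  move=> i; apply: (iff_trans (limval_imm _ iu)); case: (run' u) => /(_ mu) -> _.
  have late n : i.2 < n -> ctape (iter n (@istep copier) (iinit copier a)) i =
      match i with (Out, m) => a m | _ => false end.
    by case: i => -[] m /= h; rewrite copy_iter /= ?h.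
  split=> [/(_ i.2.+1) [n [h]]|h N]; first by rewrite late.
  by exists (maxn N i.2.+1); rewrite leq_maxl late // leq_maxr.
case: (run b) => /(_ mb) -> _; rewrite /istep /=; apply: config_eq => /=.
- by rewrite /ctgt; case: (odistinct q) => /negbTE ->.
- by [].
- by move=> [[] n] /=; case: eqP => //= ->.
Qed.

Lemma copier_lim b : s' (e b) = Config (ilim copier) 0 (otape (ctape (s b))) ->
  cstate (s b) = olim q -> chead (s b) = 0 -> iter 1 (@istep copier) (s' (e b)) = oenc ctgt (s b).
Proof.
move=> -> hs hh; rewrite /istep /=; apply: config_eq => /=; rewrite ?hs ?hh //.
  by rewrite /ctgt; case: (odistinct q) => _ /negbTE ->.
by move=> [[] n] /=; case: eqP => //= ->.
Qed.

Lemma copier_start b : ((exists v, wlt v b) -> s' (e b) = Config (ilim copier) 0 (otape (ctape (s b)))) ->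
  iter 1 (@istep copier) (s' (e b)) = oenc ctgt (s b) /\ cstate (s' (e b)) <> ihalt copier.
Proof.
move=> h; case: (classic (exists v, wlt v b)) => nb.
  split; last by rewrite (h nb).
  by case: (run b) => _ /(_ nb) [h1 h2 _]; apply: copier_lim => //; apply: h.
have mb v : ~ wlt v b by move=> vb; apply: nb; exists v.
split; first exact: copier_init.
case: (emin mb) => u [ub _] _.
by case: (run' (e b)) => _ [|-> //]; exists u.
Qed.

Lemma otape_dich j : (exists i, forall y : oconfig q, otape (ctape y) j = ctape y i) \/
  (exists c, forall y : oconfig q, otape (ctape y) j = c).
Proof.
case: j => -[] n; [by right; exists (n == 0)| |by left; exists (Some n)].
by case: n => [|n]; [left; exists None|right; exists false].
Qed.

Lemma copier_sim b : (forall u, wlt u b -> nohalt (@ostep q) (ohalt q) (s u)) ->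
  ((exists v, wlt v b) -> s' (e b) = Config (ilim copier) 0 (otape (ctape (s b)))) /\
  (forall u, wlt u b -> nohalt (@istep copier) (ihalt copier) (s' (e u))).
Proof.
apply: (@simulation _ _ _ _ _ _ _ _ _ _ (ihalt copier) _ _ e emono econv _ _ run run'
  (fun y => otape (ctape y)) otape_dich (fun u => nohalt (@ostep q) (ohalt q) (s u))).
- move=> {}b mb nh; have [h1 h2] := @copier_start b (fun h => False_ind _ (let: ex_intro v vb := h in mb v vb)).
  apply: (enc_tracks (E := fun n => oenc ctgt (iter n (@ostep q) (s b))) (t0 := 1)) => //; first by case.
  by move=> n; apply: copier_step.
- move=> {}b nb nh hb; have [h1 h2] := @copier_start b (fun _ => hb); split.
    apply: (enc_tracks (E := fun n => oenc ctgt (iter n (@ostep q) (s b))) (t0 := 1)) => //; first by case.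
    by move=> n; apply: copier_step.
  apply: (enc_tracks_ex (halt' := ihalt copier)
    (E := fun n => oenc ctgt (iter n (@ostep q) (s b))) (t0 := 1)) => //.
    by move=> n; apply: copier_step.
  by case=> // j _; rewrite /= hb.
Qed.

Lemma copier_nohalt b : (forall u, wlt u b -> nohalt (@ostep q) (ohalt q) (s u)) ->
  nohalt (@ostep q) (ohalt q) (s b) -> nohalt (@istep copier) (ihalt copier) (s' (e b)).
Proof.
move=> nh nb; have [h _] := copier_sim nh; have [h1 h2] := copier_start h.
have [] // := @enc_tracks _ _ _ _ (@ostep q) (@istep copier) (ihalt copier)
  (fun y => otape (ctape y)) (fun n => oenc ctgt (iter n (@ostep q) (s b))) (s b) _ 1 h1.
  by case.
by move=> n; apply: copier_step.
Qed.

Lemma copier_reach b N : (forall u, wlt u b -> nohalt (@ostep q) (ohalt q) (s u)) ->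
  (forall n, n < N -> cstate (iter n (@ostep q) (s b)) <> ohalt q) ->
  exists t, iter t (@istep copier) (s' (e b)) = oenc ctgt (iter N (@ostep q) (s b)) /\
    forall t', t' < t -> cstate (iter t' (@istep copier) (s' (e b))) <> ihalt copier.
Proof.
move=> nh hN; have [h _] := copier_sim nh; have [h1 h2] := copier_start h.
apply: (enc_reach (E := fun n => oenc ctgt (iter n (@ostep q) (s b))) (t0 := 1)) => //; first by case.
by move=> n /hN nN; apply: copier_step.
Qed.

End OttmToIttm.

(** For a defined value the blocks of [q] are preceded by one copying block. For an undefined one, a
    halting run of the copier is given instead, and removing its least block leaves an order on
    which [q] runs without halting. *)
Theorem ottm_to_ittm_computes (q : ottm) (f : real -> option real) :
  ottm_computes q f -> ittm_computes (copier q) f.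
Proof.
move=> comp a; move: (comp a); case: (f a) => [b|no].
  move=> [W [top [c [h out]]]]; have [B [s [b0 [n [[r hs nh hm] en _]]]]] := halts_blocks h.
  pose B' := WOsum WOunit B; pose e (x : B) : B' := inr x.
  have [s' r'] := brun_exists (iinit (copier q) a) (@istep (copier q)) (ilim (copier q)) B'.
  have emono (u v : B) : wlt u v -> wlt (e u) (e v) by [].
  have econv (u v : B) (x : B') : wlt (e u) x -> wlt x (e v) -> exists w, x = e w.
    by case: x => // w _ _; exists w.
  have emin (x : B) : (forall v, ~ wlt v x) -> exists2 u, imm u (e x) & forall v : B', ~ wlt v u.
    move=> mx; exists (inl tt); last by case=> [[]|v] [].
    by split=> // -[[] [[]]|v [_ /mx]].
  have [t [et ht]] := copier_reach emono econv emin r r' nh hm.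
  have bh : bhalts (iinit (copier q) a) (@istep (copier q)) (ilim (copier q)) (ihalt (copier q)) s' (e b0) t.
    split=> //; first by rewrite et /= /ctgt hs eqxx.
    case=> [u _|u ub]; last by case: (copier_sim emono econv emin r r' nh) => _; apply.
    have mu : forall v : B', ~ wlt v (inl u : B') by case: u => -[[]|v] [].
    by case: (r' (inl u)) => /(_ mu) -> _; exact: copy_nohalt.
  exists (WOtime (e b0) t), (time_top (e b0) t); eexists; split; first exact: (blocks_halts bh).
  by rewrite /= et /ioutput /= en.
move=> [W [top [c hc]]]; have [B' [s' [b' [n [[r' hs _ _] _ _]]]]] := halts_blocks hc.
have nohalt_q := not_halts_nohalt no.
pose B := @WOsub B' (fun x => exists v, wlt v x); pose e (x : B) := proj1_sig x.
have [s r] := brun_exists (oinit q a) (@ostep q) (olim q) B.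
have emono (u v : B) : wlt u v -> wlt (e u) (e v) by [].
have econv (u v : B) (x : B') : wlt (e u) x -> wlt x (e v) -> exists w, x = e w.
  by move=> ux _; have h : exists v, wlt v x; [exists (e u)|exists (exist _ x h)].
have emin (x : B) : (forall v, ~ wlt v x) -> exists2 u, imm u (e x) & forall v : B', ~ wlt v u.
  move=> mx; case: (proj2_sig x) => v vx.
  have mv w : ~ wlt w v.
    by move=> wv; have h : exists v', wlt v' v; [exists w|case: (mx (exist _ v h))].
  exists v => //; split=> // w [vw wx].
  by have h : exists v', wlt v' w; [exists v|case: (mx (exist _ w h))].
case: (classic (exists v, wlt v b')) => h.
  pose b1 : B := exist _ b' h.
  have hb1 : nohalt (@ostep q) (ohalt q) (s b1) by exact: (nohalt_q _ _ r).
  have hu u : wlt u b1 -> nohalt (@ostep q) (ohalt q) (s u) by move=> _; exact: (nohalt_q _ _ r).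
  exact: (copier_nohalt emono econv emin r r' hu hb1 hs).
have mb v : ~ wlt v b' by move=> vb; apply: h; exists v.
by case: (r' b') hs => /(_ mb) -> _; apply: copy_nohalt.
Qed.

(** * Finite clocks *)

Lemma finite_bhalts S C (init : config S C) step lim halt (B : WO) (b : B) n :
  (forall v, ~ wlt v b) -> cstate (iter n step init) = halt ->
  (forall m, m < n -> cstate (iter m step init) <> halt) ->
  exists s : B -> config S C, bhalts init step lim halt s b n.
Proof.
move=> mb hn hm; have [s r] := brun_exists init step lim B; exists s.
by case: (r b) => /(_ mb) e _; split; rewrite ?e // => u /mb.
Qed.

Definition counter_next n (x : option 'I_n) : option 'I_n :=
  if x is Some i then insub i.+1 else None.

Lemma counter_next_iter n m : m <= n.+1 ->
  iter m (@counter_next n.+2) (Some ord0) = Some (inord m).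
Proof.
elim: m => [|m IH] h /=; first by congr Some; apply: val_inj; rewrite /= inordK.
rewrite IH /=; last exact: ltnW.
by rewrite inordK; [rewrite insubT; congr Some; apply: val_inj; rewrite /= inordK|lia].
Qed.

Lemma counter_distinct n : [/\ Some ord0 != Some (@ord_max n.+1),
  None != Some (@ord_max n.+1) & Some (@ord0 n.+1) != None].
Proof. by []. Qed.

(** The halt state is [n.+1], the largest element of ['I_n.+2], reached at that stage; [None], which
    follows it, doubles as the limit state. *)
Definition icounter n : ittm :=
  @Build_ittm (option 'I_n.+2) _ _ _ (counter_distinct n) (fun x b => (counter_next x, b, true)).

Definition ocounter n : ottm :=
  @Build_ottm (option 'I_n.+2) _ _ _ (counter_distinct n) (fun x b => (counter_next x, b, true)).

Lemma inord_neq_max n m : m < n.+1 -> Some (inord m) <> Some (@ord_max n.+1).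
Proof. by move=> h [] /(congr1 val); rewrite /= inordK; lia. Qed.

Lemma icounter_state n a m : m <= n.+1 ->
  cstate (iter m (@istep (icounter n)) (iinit (icounter n) a)) = Some (inord m).
Proof.
move=> h; rewrite -counter_next_iter //; elim: m {h} => //= m <-.
by rewrite /istep; case: (iter m _ _).
Qed.

Lemma ocounter_state n a m : m <= n.+1 ->
  cstate (iter m (@ostep (ocounter n)) (oinit (ocounter n) a)) = Some (inord m).
Proof.
move=> h; rewrite -counter_next_iter //; elim: m {h} => //= m <-.
by rewrite /ostep; case: (iter m _ _).
Qed.

(** * Double-head clocks on three tapes *)

Lemma ostep_local (q : ottm) N k (y z : oconfig q) : chead y + k <= N ->
  cstate y = cstate z -> chead y = chead z ->
  (forall c, c <= N -> ctape y (cellAt c) = ctape z (cellAt c)) ->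
  cstate (iter k (@ostep q) y) = cstate (iter k (@ostep q) z).
Proof.
elim: k y z => // k IH y z hk es eh et; rewrite !iterSr.
case: y z es eh et hk => [s h t] [s' h' t'] /= <- <- et hk.
have e1 : t (cellAt h) = t' (cellAt h) by apply: et; lia.
have e2 : t (cellAt h.+1) = t' (cellAt h.+1) by apply: et; lia.
rewrite /ostep /= -!/(cellAt h.+1) -e1 -e2; case: odelta => -[s2 [wl wr]] mv.
apply: IH => //=; first by case: mv; lia.
by move=> c cN; rewrite et.
Qed.

Section Peek.
Variables (q : ottm) (n : nat).

Definition peekst := (mode + 'I_n.+1 * {ffun 'I_n.+2 -> bool} + unit)%type.
Definition PMode m : simst (ost q) + peekst := inr (inl (inl m)).
Definition PPeek i f : simst (ost q) + peekst := inr (inl (inr (i, f))).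
Definition PRet : simst (ost q) + peekst := inr (inr tt).

Definition peek_tape (f : {ffun 'I_n.+2 -> bool}) (x : option nat) : bool :=
  if x is Some m then if m < n.+1 then f (inord m.+1) else false else f ord0.

(** In [n.+1] steps from position 0 only the cells [cellAt 0] to [cellAt n.+1] can be read, hence
    [n.+2] remembered bits. In blocks where [q] does not halt the verdict is negative. *)
Definition peek_dec (f : {ffun 'I_n.+2 -> bool}) :=
  cstate (iter n.+1 (@ostep q) (Config (olim q) 0 (peek_tape f))) == ohalt q.

(** Reading takes one step per column, so a positive verdict halts the machine exactly [n.+1] steps
    after the limit. Peeking writes nothing and leaves no trace in limsups. With input 0 [MStart]
    only has to mark column 0, so blocks keep their numbers. [Sim (ohalt q)] is simulated like other
    states, as only [peek_dec] leads to halting. *)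
Definition kdelta (x : simst (ost q) + peekst) (b : bool * bool * bool) :
    (simst (ost q) + peekst) * (bool * bool * bool) * bool :=
  let: (i, z, o) := b in
  match x with
  | inl (Sim s) => if i then let: (s', (wl, wr), mv) := odelta s (z, o) in (inl (Sim s'), (true, wl, wr), mv)
                   else (inl (SimL s o), (false, z, o), false)
  | inl (SimL s r) => let: (s', (wl, wr), mv) := odelta s (o, r) in (inl (SimR s' wr mv), (i, z, wl), true)
  | inl (SimR s wr mv) => (inl (Sim s), (i, z, wr), mv)
  | inr (inl (inl MStart)) => (inl (Sim (ostart q)), (true, z, o), false)
  | inr (inl (inl _)) => (PMode MHalt, b, false)
  | inr (inl (inr (j, f))) =>
      let f' := [ffun c : 'I_n.+2 => if c == 0 :> nat then if j == 0 :> nat then z else f c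
                                     else if c == j.+1 :> nat then o else f c] in
      if j.+1 == n.+1 then (if peek_dec f' then PMode MHalt else PRet, b, true)
      else (PPeek (inord j.+1) f', b, true)
  | inr (inr _) => if i then (inl (Sim (olim q)), b, false) else (PRet, b, false)
  end.

Definition peeker : ittm.
Proof.
refine (@Build_ittm (simst (ost q) + peekst)%type (PMode MStart) (PMode MHalt)
  (PPeek ord0 [ffun=> false]) _ kdelta).
by split; apply/eqP.
Defined.

Definition ktgt (s : ost q) : ist peeker := inl (Sim s).

Lemma peeker_step y :
  spath (@istep peeker) (between (ihalt peeker) (otape (ctape y)) (otape (ctape (ostep y))))
    (oenc ktgt y) (oenc ktgt (ostep y)).
Proof. exact: (@oenc_step q peeker inl ktgt). Qed.

Lemma istep_id (p : ittm) s h t s' mv : idelta s (t (Inp, h), t (Scr, h), t (Out, h)) =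
    (s', (t (Inp, h), t (Scr, h), t (Out, h)), mv) ->
  istep (Config s h t) = Config s' (if mv then h.+1 else h.-1) t :> iconfig p.
Proof.
move=> e; rewrite /istep /= e; apply: config_eq => //= -[k m].
by case: eqP => [->|] //; case: k.
Qed.

Variable t : option nat -> bool.

Definition peek_buf (i : nat) : {ffun 'I_n.+2 -> bool} :=
  [ffun c : 'I_n.+2 => [&& 0 < i, c <= i & t (cellAt c)]].

Let x0 : iconfig peeker := Config (ilim peeker) 0 (otape t).

Lemma peek_buf_next (j : 'I_n.+1) :
  [ffun c : 'I_n.+2 => if c == 0 :> nat then if j == 0 :> nat then (j == 0 :> nat) && t None else peek_buf j c
                       else if c == j.+1 :> nat then t (Some (j : nat)) else peek_buf j c] = peek_buf j.+1.
Proof.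
apply/ffunP => c; rewrite !ffunE /=.
case: (c : nat) (ltn_ord c) => [|m] _ /=; first by case: (j : nat).
rewrite eqSS ltnS; case: (ltngtP m j) => [h|h|->] //=; last by rewrite andbF.
by rewrite (leq_ltn_trans _ h).
Qed.

Lemma peek_iter i : i <= n -> iter i (@istep peeker) x0 = Config (PPeek (inord i) (peek_buf i) : ist peeker) i (otape t).
Proof.
elim: i => [_|i IH h].
  have -> : inord 0 = ord0 :> 'I_n.+1 by apply: val_inj; rewrite /= inordK.
  by have -> : peek_buf 0 = [ffun=> false] by apply/ffunP => c; rewrite !ffunE.
rewrite iterS IH ?(ltnW h) // (@istep_id peeker _ _ _ (PPeek (inord i.+1) (peek_buf i.+1)) true) //=.
rewrite inordK ?ltnS 1?ltnW //.
have := peek_buf_next (Ordinal (ltnW h : i < n.+1)) => /= ->.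
by rewrite eqSS; case: eqP => // e; move: h; rewrite e ltnn.
Qed.

Lemma peek_decE : peek_dec (peek_buf n.+1) =
  (cstate (iter n.+1 (@ostep q) (Config (olim q) 0 t)) == ohalt q).
Proof.
congr (_ == _); apply: (@ostep_local q n.+1) => //= -[|c] h; rewrite /peek_tape /= ?h ffunE //.
by rewrite (inordK (h : c.+1 < n.+2)) h.
Qed.

Lemma peek_last : iter n.+1 (@istep peeker) x0 =
  Config (if peek_dec (peek_buf n.+1) then PMode MHalt else PRet : ist peeker) n.+1 (otape t).
Proof.
rewrite iterS peek_iter // (@istep_id peeker _ _ _
  (if peek_dec (peek_buf n.+1) then PMode MHalt else PRet) true) //= inordK //.
by have := peek_buf_next ord_max => /= ->; rewrite eqxx.
Qed.

Lemma peek_return j : ~~ peek_dec (peek_buf n.+1) -> j <= n.+1 ->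
  iter (j + n.+1) (@istep peeker) x0 = Config (PRet : ist peeker) (n.+1 - j) (otape t).
Proof.
move=> /negbTE h; elim: j => [_|j IH lt]; first by rewrite add0n peek_last h.
rewrite addSn iterS IH 1?ltnW // (@istep_id peeker _ _ _ PRet false).
  by congr Config; lia.
by rewrite /=; case: (n.+1 - j) (subn_gt0 j n.+1) => //; rewrite lt.
Qed.

Lemma peek_sim : ~~ peek_dec (peek_buf n.+1) ->
  iter (n.+1 + n.+1).+1 (@istep peeker) x0 = Config (ktgt (olim q)) 0 (otape t).
Proof.
move=> h; rewrite iterS peek_return // subnn.
exact: (@istep_id peeker _ _ _ (ktgt (olim q)) false).
Qed.

Lemma peek_same m : ~~ peek_dec (peek_buf n.+1) -> m < (n.+1 + n.+1).+1 ->
  cstate (iter m (@istep peeker) x0) <> ihalt peeker /\ ctape (iter m (@istep peeker) x0) = otape t.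
Proof.
move=> h lt; case: (leqP m n) => [le|gt]; first by rewrite peek_iter.
by rewrite -(subnK gt) peek_return //; lia.
Qed.

End Peek.

Theorem ottm_to_ittm_clockable (A : WO) : ottm_clockable A -> ittm_clockable A.
Proof.
move=> [q [W [top [c [hc isoA]]]]]; have [B [s [b [n [[r hs nh hm] _ /(_ A isoA) iso]]]]] := halts_blocks hc.
suff [p [s' h]] : exists (p : ittm) (s' : B -> iconfig p),
    bhalts (iinit p (fun=> false)) (@istep p) (ilim p) (ihalt p) s' b n.
  by exists p, (WOtime b n), (time_top b n); eexists; split; first exact: (blocks_halts h).
(* [n = 0] is impossible: at stage omega * b the state is the start or the limit state. *)
case: n hs hm {iso} => [|n] hs hm.
  case: (classic (exists v, wlt v b)) => nb.
    by case: (r b) => _ /(_ nb) [e _ _]; case: (odistinct q) => _; rewrite -hs -e eqxx.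
  case: (r b) => h _; move: hs; rewrite /= h; last by move=> v vb; apply: nb; exists v.
  by move=> /= e; case: (odistinct q); rewrite e eqxx.
case: (classic (exists v, wlt v b)) => nb; last first.
  exists (icounter n); apply: finite_bhalts => [v vb||m lt]; first by apply: nb; exists v.
    by rewrite icounter_state //; congr Some; apply: val_inj; rewrite /= inordK.
  by rewrite icounter_state 1?ltnW //; apply: inord_neq_max.
exists (peeker q n); have [s' r'] := brun_exists (iinit (peeker q n) (fun=> false))
  (@istep (peeker q n)) (ilim (peeker q n)) B; exists s'.
have nd u : (exists v, wlt v u) -> nohalt (@ostep q) (ohalt q) (s u) ->
    ~~ peek_dec q (peek_buf n (ctape (s u)) n.+1).
  move=> nu h; rewrite peek_decE; apply/eqP.
  case: (r u) => _ /(_ nu) [e1 e2 _]; move: (h n.+1).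
  by case: (s u) e1 e2 => /= ? ? ? -> ->.
have lim_enc u : (exists v, wlt v u) -> oenc (@ktgt q n) (s u) = Config (@ktgt q n (olim q)) 0 (otape (ctape (s u))).
  by move=> nu; case: (r u) => _ /(_ nu) [e1 e2 _]; rewrite /oenc e1 e2.
refine (let: conj h1 h2 := @simulation _ _ _ _ _ _ _ _ _ _ (ihalt (peeker q n)) _ _ (fun b : B => b)
  (fun u v uv => uv) (fun _ _ x _ _ => ex_intro _ x erefl) _ _ r r' (fun y => otape (ctape y))
  (@otape_dich q) (fun u => nohalt (@ostep q) (ohalt q) (s u)) _ _ b nh in _).
- move=> u mu nu; apply: (enc_tracks (E := fun k => oenc (@ktgt q n) (iter k (@ostep q) (s u))) (t0 := 1)) => //.
  + case: (r u) => /(_ mu) -> _; case: (r' u) => /(_ mu) -> _.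
    by rewrite /istep /=; apply: config_eq => //= -[[] [|m]].
  + by case=> // _; case: (r' u) => /(_ mu) -> _.
  + by move=> k; apply: peeker_step.
- move=> u nu hu eu; have d := nd u nu hu; split.
    apply: (enc_tracks (E := fun k => oenc (@ktgt q n) (iter k (@ostep q) (s u))) (t0 := (n.+1 + n.+1).+1)) => //.
    + by rewrite eu peek_sim //= lim_enc.
    + by move=> t /(peek_same d) []; rewrite eu.
    + by move=> k; apply: peeker_step.
  apply: (enc_tracks_ex (halt' := ihalt (peeker q n))
    (E := fun k => oenc (@ktgt q n) (iter k (@ostep q) (s u))) (t0 := (n.+1 + n.+1).+1)) => //.
  + by rewrite eu peek_sim //= lim_enc.
  + by move=> k; apply: peeker_step.
  + by move=> t j /(peek_same d) [_]; rewrite eu => ->.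
- split=> //.
  + rewrite (h1 nb) peek_last /= peek_decE.
    case: (r b) => _ /(_ nb) [e1 e2 _]; move: hs.
    by case: (s b) e1 e2 => /= ? ? ? -> -> ->; rewrite eqxx.
  + by move=> m lt; rewrite (h1 nb) peek_iter.
Qed.

(** * Multi-track machines on the double-head tape *)

Definition cellIdx (x : option nat) : nat := if x is Some n then n.+1 else 0.

Lemma cellAtK : cancel cellAt cellIdx. Proof. by case. Qed.
Lemma cellIdxK : cancel cellIdx cellAt. Proof. by case. Qed.

Lemma ostep_left (q : ottm) s h t s' w mv :
  odelta s (t (cellAt h), t (cellAt h.+1)) = (s', (w, t (cellAt h.+1)), mv) ->
  ostep (Config s h t) = Config s' (if mv then h.+1 else h.-1)
    (fun x => if x == cellAt h then w else t x) :> oconfig q.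
Proof.
move=> e; rewrite /ostep /= -/(cellAt h.+1) e; apply: config_eq => //= x.
by case: eqP => // _; case: eqP => // ->.
Qed.

Lemma ostep_id (q : ottm) s h t s' mv :
  odelta s (t (cellAt h), t (cellAt h.+1)) = (s', (t (cellAt h), t (cellAt h.+1)), mv) ->
  ostep (Config s h t) = Config s' (if mv then h.+1 else h.-1) t :> oconfig q.
Proof. by move=> /ostep_left ->; apply: config_eq => //= x; case: eqP => // ->. Qed.

Section RPath.
Variables (S C : Type) (step : config S C -> config S C).

Definition rpath U (x y : config S C) := x = y \/ spath step U x y.

Lemma rpath_refl U x : rpath U x x. Proof. by left. Qed.
Lemma rpath1 (U : config S C -> Prop) x : U x -> rpath U x (step x).
Proof. by right; apply: spath1. Qed.
Lemma rpath_trans U x y z : rpath U x y -> rpath U y z -> rpath U x z.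
Proof. by move=> [->|p] // [<-|p']; right=> //; apply: spath_trans p'. Qed.
Lemma spath_rpath U x y z : spath step U x y -> rpath U y z -> spath step U x z.
Proof. by move=> p [<-|p'] //; apply: spath_trans p'. Qed.
End RPath.

Section Tracks.
Variables (K : nat) (S : Type).
Let k := K.+2.
Let bits := {ffun 'I_k -> bool}.

(* A column holds [k] bits; the head moves right, left, or (with [None]) stays. *)
Variable d : S -> bits -> S * bits * option bool.

Definition tmove (mv : option bool) h :=
  match mv with Some true => h.+1 | Some false => h.-1 | None => h end.

Definition tstep (y : config S ('I_k * nat)) : config S ('I_k * nat) :=
  let: (s', w, mv) := d (cstate y) [ffun i => ctape y (i, chead y)] in
  Config s' (tmove mv (chead y)) (fun x => if x.2 == chead y then w x.1 else ctape y x).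

(** A column is read from left to right and written back from right to left; of the two cells under
    the head only the left one is changed. A change of column takes [k] moves: the one made by the
    last write and [K.+1] in [Go]. As every step moves the head, staying means one step right and
    one step left. *)
Inductive trst :=
  | Rd of S & 'I_k & bits
  | Wr of S & bits & option bool & 'I_k
  | Go of bool & S & 'I_k.

Definition trst_enc (x : trst) : S * 'I_k * bits + S * bits * option bool * 'I_k + bool * S * 'I_k :=
  match x with
  | Rd s i f => inl (inl (s, i, f)) | Wr s w m i => inl (inr (s, w, m, i)) | Go b s i => inr (b, s, i)
  end.
Definition trst_dec x : trst :=
  match x with
  | inl (inl (s, i, f)) => Rd s i f | inl (inr (s, w, m, i)) => Wr s w m i | inr (b, s, i) => Go b s i
  end.
Lemma trst_encK : cancel trst_enc trst_dec. Proof. by case. Qed.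

Definition bits0 : bits := [ffun=> false].
Definition Rd0 s := Rd s ord0 bits0.

Definition trdelta (c : trst) (b : bool * bool) : trst * (bool * bool) * bool :=
  let: (l, r) := b in
  match c with
  | Rd s i f =>
      let f' : bits := [ffun j => if j == i then l else f j] in
      if i == k.-1 :> nat then
        let: (s', w, mv) := d s f' in (Wr s' w mv (inord K), (w i, r), false)
      else (Rd s (inord i.+1) f', (l, r), true)
  | Wr s w mv i =>
      if i == 0 :> nat then
        match mv with
        | Some m => (Go m s (inord K.+1), (w i, r), m)
        | None => (Go false s (inord 1), (w i, r), true)
        end
      else (Wr s w mv (inord i.-1), (w i, r), false)
  | Go dir s j => (if j == 1 :> nat then Rd0 s else Go dir s (inord j.-1), (l, r), dir)
  end.

(* Track [i] of column [h] is cell [h * k + i], counting the pad as cell 0. *)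
Definition venc (t : 'I_k * nat -> bool) (x : option nat) : bool :=
  t (inord (cellIdx x %% k), cellIdx x %/ k).

Lemma venc_at t h i (ik : i < k) : venc t (cellAt (h * k + i)) = t (inord i, h).
Proof. by rewrite /venc cellAtK modnMDl modn_small // divnMDl // divn_small // addn0. Qed.

Lemma venc_upd t h (i : 'I_k) w :
  (fun x => if x == cellAt (h * k + i) then w else venc t x) =
  venc (fun y => if y == (i, h) then w else t y).
Proof.
apply: functional_extensionality => x; have [c ->] : exists c, x = cellAt c by exists (cellIdx x); rewrite cellIdxK.
have lt : c %% k < k by rewrite ltn_mod.
rewrite (divn_eq c k); move: (c %/ k) (c %% k) lt => a b lt {c}; rewrite !venc_at //.
case: eqP => [/(can_inj cellAtK) e|ne]; case: eqP => // e'.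
  case: e'; have ea : a = h.
    by have := congr1 (divn^~ k) e; rewrite /= !divnMDl // !divn_small // !addn0.
  by subst a; move/addnI: e => ->; rewrite inord_val.
by case: ne; case: e' => <- ->; rewrite inordK.
Qed.

(** [hs] singles out the states in which [q] may deviate from the simulation, such as the halt
    state, where writing back begins. *)
Variables (q : ottm) (inj : trst -> ost q) (hs : pred S).
Hypothesis hq : forall c b, (forall s, hs s -> c <> Rd0 s) ->
  odelta (inj c) b = let: (c', w, mv) := trdelta c b in (inj c', w, mv).
Hypothesis inj_halt : forall c, inj c <> ohalt q.

Definition tenc (y : config S ('I_k * nat)) : oconfig q :=
  Config (inj (Rd0 (cstate y))) (chead y * k) (venc (ctape y)).

Lemma tenc_step y : ~~ hs (cstate y) ->
  (forall s' w, d (cstate y) [ffun i => ctape y (i, chead y)] = (s', w, Some false) -> 0 < chead y) ->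
  spath (@ostep q) (between (ohalt q) (venc (ctape y)) (venc (ctape (tstep y)))) (tenc y) (tenc (tstep y)).
Proof.
case: y => [s h t] /= nhs; rewrite /tstep /=.
case ed : (d _ _) => [[s' w] mv] left_ok /=.
(* The tape on which the tracks from [j] on have been rewritten; every intermediate tape has this
   form, so each cell is old or new. *)
pose tm j (x : 'I_k * nat) := if (x.2 == h) && (j <= x.1) then w x.1 else t x.
have tm0 : (fun x : 'I_k * nat => if x.2 == h then w x.1 else t x) = tm 0.
  by apply: functional_extensionality => x; rewrite /tm andbT.
have tmk : t = tm k.
  apply: functional_extensionality => x; rewrite /tm.
  by rewrite [k <= _]leqNgt ltn_ord andbF.
have tmS (j : 'I_k) : (fun x => if x == (j, h) then w j else tm j.+1 x) = tm j.
  apply: functional_extensionality => -[i h']; rewrite /tm /= xpair_eqE.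
  case: (h' =P h) => [->|]; rewrite ?andbF // andbT; case: eqP => [->|ne] /=; first by rewrite leqnn.
  by rewrite [j <= i]leq_eqVlt eq_sym; case: eqP => [/val_inj|].
rewrite tm0; set U := between _ _ _.
have Uok c hd j : U (Config (inj c) hd (venc (tm j))).
  split=> //= x; rewrite /venc [in X in _ = X \/ _]tmk /tm andbT.
  by case: ifP => [/andP [-> _]|_]; [right|left; rewrite leqNgt ltn_ord andbF].
pose buf i : bits := [ffun j : 'I_k => (j < i) && t (j, h)].
have bufS (i : 'I_k) : [ffun j => if j == i then t (i, h) else buf i j] = buf i.+1.
  apply/ffunP => j; rewrite !ffunE ltnS [j <= i]leq_eqVlt -val_eqE /=.
  by case: eqP => //= /val_inj ->.
have notR0 c l r : (forall s0, c <> Rd0 s0) -> odelta (inj c) (l, r) =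
    let: (c', w, mv) := trdelta c (l, r) in (inj c', w, mv).
  by move=> ne; apply: hq => s0 _; apply: ne.
have rd i : i <= K.+1 -> rpath (@ostep q) U (tenc (Config s h t))
    (Config (inj (Rd s (inord i) (buf i))) (h * k + i) (venc t)).
  elim: i => [_|i IH lt].
    have -> : inord 0 = ord0 :> 'I_k by apply: val_inj; rewrite /= inordK.
    have -> : buf 0 = bits0 by apply/ffunP => j; rewrite !ffunE.
    by rewrite addn0; left.
  apply: rpath_trans (IH (ltnW lt)) _.
  suff <- : ostep (Config (inj (Rd s (inord i) (buf i))) (h * k + i) (venc t)) =
       Config (inj (Rd s (inord i.+1) (buf i.+1))) (h * k + i.+1) (venc t).
    by apply: rpath1; rewrite tmk; apply: Uok.
  rewrite (@ostep_id q _ _ _ (inj (Rd s (inord i.+1) (buf i.+1))) true) ?addnS //.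
  rewrite hq; last first.
    by move=> s0 h0 [e _ _]; move: nhs; rewrite e h0.
  have ik : i < k by apply: ltnW.
  rewrite /trdelta inordK // venc_at //.
  have -> : (i == k.-1) = false by apply/eqP => e; move: lt; rewrite e /= ltnn.
  by have := bufS (inord i); rewrite inordK // => ->.
have st1 : ostep (Config (inj (Rd s (inord K.+1) (buf K.+1))) (h * k + K.+1) (venc t)) =
    Config (inj (Wr s' w mv (inord K))) (h * k + K) (venc (tm K.+1)).
  rewrite (@ostep_left q _ _ _ (inj (Wr s' w mv (inord K))) (w (inord K.+1)) false); last first.
    rewrite notR0; last by move=> s0 [_ /(congr1 val)]; rewrite /= inordK.
    rewrite /trdelta inordK // eqxx venc_at //.
    have := bufS (inord K.+1); rewrite inordK // => ->.
    have -> : buf K.+2 = [ffun i => t (i, h)] by apply/ffunP => j; rewrite !ffunE ltn_ord.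
    by rewrite ed.
  rewrite addnS /=; congr Config.
  have := venc_upd t h (inord K.+1) (w (inord K.+1)); rewrite inordK // addnS => ->.
  by congr venc; have := tmS (inord K.+1); rewrite inordK // -tmk.
have wr j : j <= K -> rpath (@ostep q) U (Config (inj (Wr s' w mv (inord K))) (h * k + K) (venc (tm K.+1)))
    (Config (inj (Wr s' w mv (inord (K - j)))) (h * k + (K - j)) (venc (tm (K - j).+1))).
  elim: j => [_|j IH lt]; first by rewrite subn0; apply: rpath_refl.
  apply: rpath_trans (IH (ltnW lt)) _.
  have e : K - j = (K - j.+1).+1 by lia.
  move: (K - j.+1) e => i e; rewrite e.
  have ik : i.+1 < k by lia.
  suff <- : ostep (Config (inj (Wr s' w mv (inord i.+1))) (h * k + i.+1) (venc (tm i.+2))) =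
       Config (inj (Wr s' w mv (inord i))) (h * k + i) (venc (tm i.+1)).
    by apply: rpath1; apply: Uok.
  rewrite (@ostep_left q _ _ _ (inj (Wr s' w mv (inord i))) (w (inord i.+1)) false); last first.
    by rewrite notR0 // /trdelta inordK.
  have := venc_upd (tm i.+2) h (inord i.+1) (w (inord i.+1)); rewrite inordK // => ->.
  rewrite addnS /=; congr Config; congr venc.
  by have := tmS (inord i.+1); rewrite inordK.
have go dir p j : 0 < j -> j < k -> (dir = false -> j <= p) ->
    rpath (@ostep q) U (Config (inj (Go dir s' (inord j))) p (venc (tm 0)))
      (Config (inj (Rd0 s')) (if dir then p + j else p - j) (venc (tm 0))).
  elim: j p => // j IH p _ jk hp.
  have st : ostep (Config (inj (Go dir s' (inord j.+1))) p (venc (tm 0))) =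
      Config (inj (if j == 0 then Rd0 s' else Go dir s' (inord j))) (if dir then p.+1 else p.-1) (venc (tm 0)).
    rewrite (@ostep_id q _ _ _ (inj (if j == 0 then Rd0 s' else Go dir s' (inord j))) dir) //.
    by rewrite notR0 // /trdelta inordK //= eqSS.
  apply: rpath_trans (rpath1 _ (Uok _ _ _)) _; rewrite st.
  case: j IH jk hp {st} => [|j] IH jk hp; first by left; case: (dir); rewrite ?addn1 ?subn1.
  rewrite /=; case: (dir) IH hp => IH hp.
    by rewrite -addSnnS; apply: IH => //; lia.
  have p0 : 0 < p by have := hp erefl; lia.
  have -> : p - j.+2 = p.-1 - j.+1 by lia.
  by apply: IH => [||_]; [by []|lia|have := hp erefl; lia].
have w0 : ostep (Config (inj (Wr s' w mv (inord 0))) (h * k) (venc (tm 1))) =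
    Config (inj (Go (if mv is Some true then true else false) s' (inord (if mv is Some _ then K.+1 else 1))))
       (if mv is Some false then (h * k).-1 else (h * k).+1) (venc (tm 0)).
  rewrite (@ostep_left q _ _ _ (inj (Go (if mv is Some true then true else false) s'
     (inord (if mv is Some _ then K.+1 else 1)))) (w (inord 0)) (if mv is Some false then false else true)); last first.
    by rewrite notR0 // /trdelta inordK //; case: (mv) => [[]|].
  have := venc_upd (tm 1) h (inord 0) (w (inord 0)); rewrite inordK // addn0 => ->.
  have := tmS (inord 0); rewrite inordK // => ->.
  by case: (mv) => [[]|].
apply: (@spath_rpath _ _ _ _ _ (Config (inj (Wr s' w mv (inord K))) (h * k + K) (venc (tm K.+1)))).
  have r := rd K.+1 (leqnn _); case: r => [->|r].
    by rewrite -st1; apply: spath1; rewrite tmk; apply: Uok.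
  apply: spath_trans r _; rewrite -st1; apply: spath1; rewrite [in X in U X]tmk; exact: Uok.
apply: rpath_trans (wr K (leqnn _)) _; rewrite subnn addn0.
apply: rpath_trans (rpath1 _ (Uok _ _ _)) _; rewrite w0 /tenc /=.
case: (mv) left_ok => [[]|] left_ok.
- by have := go true (h * k).+1 K.+1; rewrite addSnnS /k mulSn addnC; apply.
- have h0 := left_ok _ _ erefl.
  have := go false (h * k).-1 K.+1; rewrite (_ : (h * k).-1 - K.+1 = tmove (Some false) h * k).
    by apply=> //; rewrite /k => _; nia.
  by rewrite /= -{1}(prednK h0) mulSn /k; move: (h.-1 * K.+2) => x; lia.
- by have := go false (h * k).+1 1; rewrite subn1; apply.
Qed.

End Tracks.
HB.instance Definition _ K (S : finType) := Finite.copy (trst K S) (can_type (@trst_encK K S)).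

(** * A flag whose limsup is a conjunction of limsups *)

(** Induction over the stages from omega * u0 + m0 up to omega * b, where at the beginning of a
    later block the property may be assumed for all stages in between. *)
Lemma persist (B : WO) (b u0 : B) m0 (P : B -> nat -> Prop) : P u0 m0 ->
  (forall u m, tle u0 m0 u m -> wlt u b -> P u m -> P u m.+1) ->
  (forall u, wlt u0 u -> wlt u b -> (forall u' m', tle u0 m0 u' m' -> wlt u' u -> P u' m') -> P u 0) ->
  forall u m, tle u0 m0 u m -> wlt u b -> P u m.
Proof.
move=> P0 PS PL u; elim/(well_founded_ind (@wlt_wf B)): u => u IH.
elim=> [|m IHm] t ub.
  case: t => [[e]|lt]; first by rewrite leqn0 => /eqP e0; rewrite -e -e0.
  by apply: PL => // u' m' t' u'u; apply: IH => //; apply: wlt_trans ub.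
case: (classic (tle u0 m0 u m)) => [t'|nt]; first by apply: PS => //; apply: IHm.
case: t => [[e le]|lt]; last by case: nt; right.
subst u; suff <- : m0 = m.+1 by [].
by case: (ltngtP m0 m.+1) le => // lt _; case: nt; left.
Qed.

Section Flags.
Variables (B : WO) (ones : seq nat) (X W : nat -> B -> nat -> bool) (E T1 T2 : B -> nat -> bool).

Definition flag_ok b m := all (fun i => W i b m || X i b m) ones.

(* [T1]: test the memory [W] of cells seen since the last reset, flashing [E] and
   resetting [W] if all of [ones] have been seen; [T2]: the next step, which may change [X]. *)
Hypothesis T1_start : forall b, T1 b 0.
Hypothesis T2_start : forall b, ~~ T2 b 0.
Hypothesis T1_next : forall b m, T1 b m -> [/\ forall i, X i b m.+1 = X i b m, E b m.+1 = flag_ok b m,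
  forall i, W i b m.+1 = if flag_ok b m then false else W i b m || X i b m & T2 b m.+1].
Hypothesis T2_next : forall b m, T2 b m -> [/\ E b m.+1 = all (fun i => X i b m.+1) ones,
  forall i, W i b m.+1 = W i b m & ~~ T2 b m.+1].
Hypothesis T0_next : forall b m, ~~ T1 b m -> ~~ T2 b m -> [/\ forall i, X i b m.+1 = X i b m,
  E b m.+1 = E b m, forall i, W i b m.+1 = W i b m & ~~ T2 b m.+1].
Hypothesis X_lim : forall i b, (exists v, wlt v b) -> X i b 0 <-> limval (X i) b.
Hypothesis W_lim : forall i b, (exists v, wlt v b) -> W i b 0 <-> limval (W i) b.
Hypothesis E_lim : forall b, (exists v, wlt v b) -> E b 0 <-> limval E b.

Lemma T2_prev b m : T2 b m.+1 -> T1 b m.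
Proof.
move=> h; case h1 : (T1 b m) => //; case h2 : (T2 b m).
  by case: (T2_next h2) => _ _; rewrite h.
by case: (T0_next (negbT h1) (negbT h2)) => _ _ _; rewrite h.
Qed.

(** After the beginning of a block, [E] can differ from the conjunction of the current [X] only at
    [T2] stages, that is, directly after a test. *)
Lemma E_away b m : ~~ T2 b m.+1 -> E b m.+1 = all (fun i => X i b m.+1) ones.
Proof.
elim: m => [|m IH] nh; first by case: (T1_next (T1_start b)) => _ _ _; rewrite (negbTE nh).
case h1 : (T1 b m.+1); first by case: (T1_next h1) => _ _ _; rewrite (negbTE nh).
case h2 : (T2 b m.+1); first by case: (T2_next h2).
case: (T0_next (negbT h1) (negbT h2)) => eX -> _ _; rewrite IH ?h2 //.
by apply: eq_all => i; rewrite eX.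
Qed.

(** Once [X i] is off for good, [E] can come on only through a flash for which [W i] remembers an
    older 1. That flash resets [W i], which never recovers, so no other flash follows. *)
Lemma flag_sound b i : i \in ones -> ~ limval (X i) b -> ~ limval E b.
Proof.
move=> io /not_limval [v [N [vb hX]]] hE.
have noall u m : tle v N u m -> wlt u b -> all (fun j => X j u m) ones = false.
  by move=> t ub; apply/negbTE/allPn; exists i => //; rewrite hX.
have notok u m : tle v N u m -> wlt u b -> W i u m = false -> flag_ok u m = false.
  by move=> t ub hW; apply/negbTE/allPn; exists i => //; rewrite hX ?hW.
(* The first stage after [(v, N)] at which [E] is on. It does not begin a block, for there [E] is a
   limsup of earlier values. *)
have [[u1 m1] [[t1 [u1b E1]] min]] : exists x : WOlex B, (tle v N.+1 x.1 x.2 /\ wlt x.1 b /\ E x.1 x.2) /\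
    forall y, wlt y x -> ~ (tle v N.+1 y.1 y.2 /\ wlt y.1 b /\ E y.1 y.2).
  by apply: least; case: (hE v N.+1 vb) => u [m h]; exists (u, m).
rewrite /= in t1 u1b E1.
case: m1 t1 E1 min => [|m] t1 E1 min.
  case: t1 => [[//]|vu1].
  have nb : exists v, wlt v u1 by exists v.
  move/(E_lim nb): E1 => /(_ v N.+1 vu1) [u [m [t [uu1 Eu]]]].
  by case: (min (u, m)) => /=; [left|split=> //; split=> //; apply: wlt_trans u1b].
have t1' : tle v N u1 m.+1 by apply: tle_trans t1; left.
have h2 : T2 u1 m.+1.
  by apply: contraT => /E_away; rewrite E1 noall.
have h1 := T2_prev h2; case: (T1_next h1) => _ e hW _; rewrite e in E1.
have W1 : W i u1 m.+1 = false by rewrite hW E1.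
have later u n : tle u1 m.+2 u n -> wlt u b -> E u n = false /\ W i u n = false.
  have big u' n' : tle u1 m.+2 u' n' -> tle v N u' n'.
    by move=> t; apply: tle_trans t1' _; apply: tle_trans t; left.
  apply: (@persist B b u1 m.+2 (fun u n => E u n = false /\ W i u n = false)) => {u n}.
  - case: (T2_next h2) => -> -> _; split=> //; apply: noall => //.
    by apply: big; left.
  - move=> u n t ub [Ef Wf]; have t' : tle v N u n.+1 by apply: tle_trans (big _ _ t) _; left.
    case k1 : (T1 u n); first by case: (T1_next k1) => _ -> -> _; rewrite (notok _ _ (big _ _ t)) // Wf hX //; apply: big.
    case k2 : (T2 u n); first by case: (T2_next k2) => -> -> _; rewrite noall.
    by case: (T0_next (negbT k1) (negbT k2)) => _ -> -> _.
  - move=> u u1u ub IH; have nb : exists v, wlt v u by exists u1.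
    split; apply/negP => h.
      have := (limval_eventually (f := E) (n := m.+2) (c := false) u1u).
      by case=> [u' n' t u'u|/(_ (proj1 (E_lim nb) h))]; [case: (IH u' n' t u'u)|].
    have := (limval_eventually (f := W i) (n := m.+2) (c := false) u1u).
    by case=> [u' n' t u'u|/(_ (proj1 (W_lim i nb) h))]; [case: (IH u' n' t u'u)|].
by case: (hE u1 m.+2 u1b) => u [n [t [ub]]]; case: (later u n t ub) => ->.
Qed.

Lemma X_const b m n i : m <= n -> (forall l, m <= l < n -> ~~ T1 b l /\ ~~ T2 b l) -> X i b n = X i b m.
Proof.
elim: n => [|n IH]; first by rewrite leqn0 => /eqP ->.
rewrite leq_eqVlt => /orP [/eqP -> //|lt h].
have [h1 h2] : ~~ T1 b n /\ ~~ T2 b n by apply: h; rewrite -ltnS lt ltnSn.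
by case: (T0_next h1 h2) => -> _ _ _; apply: IH => // l hl; apply: h; lia.
Qed.

(** If [E] stayed off from some stage on, no test would reset [W], so [W] could only grow; with
    cofinally many tests it collects all of [ones], and the next test flashes. *)
Lemma flag_complete b : (forall i, i \in ones -> limval (X i) b) -> limval E b.
Proof.
move=> hX; apply: NNPP => /not_limval [v [N [vb hE]]].
(* If tests are not cofinal, [b] succeeds some block, because every block opens with a test. In the
   tail of that block the [X] no longer change, so they are all on, and [E] is their conjunction. *)
case: (classic (limval T1 b)) => [cof|/not_limval [v1 [N1 [v1b hT1]]]]; last first.
  have iv : imm v1 b.
    split=> // u [v1u ub]; have := hT1 u 0 (or_intror v1u) ub.
    by rewrite T1_start.
  have away m : N1.+1 <= m -> ~~ T1 v1 m /\ ~~ T2 v1 m.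
    case: m => // m le; split; first by rewrite hT1 //; left; split=> //; apply: leqW.
    by apply/negP => /T2_prev; rewrite hT1 //; left.
  have [M [M1 MT]] : exists M, N1 < M /\ tle v N v1 M.+1.
    case: (wlt_total v v1) => [h|[->|h]]; first by exists N1.+1; split=> //; right.
      by exists (maxn N N1.+1); split; [rewrite leq_maxr|left; split=> //; rewrite leqW // leq_maxl].
    by case: (proj2 iv v).
  have := hE v1 M.+1 MT v1b; rewrite E_away; last by case: (away M.+1 (leqW M1)).
  move/negP; apply; apply/allP => i io.
  have [n [Mn Xn]] := proj1 (limval_imm (X i) iv) (hX i io) M.+1.
  by rewrite (X_const (b := v1) (m := M.+1)) // in Xn => l /andP [l1 _]; apply: away; lia.
have Wmono i u m : tle v N u m -> wlt u b -> W i u m ->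
    forall u' m', tle u m u' m' -> wlt u' b -> W i u' m'.
  move=> t ub Wi; apply: (@persist B b u m (fun u m => W i u m)) => //.
    move=> u' m' t' u'b Wi'; have tt : tle v N u' m'.+1 by apply: tle_trans t (tle_trans t' _); left.
    case k1 : (T1 u' m').
      case: (T1_next k1) => _ e -> _; rewrite -e hE //.
      by rewrite Wi'.
    case k2 : (T2 u' m'); first by case: (T2_next k2) => _ -> _.
    by case: (T0_next (negbT k1) (negbT k2)) => _ _ -> _.
  move=> u' uu' u'b IH; apply/W_lim; first by exists u.
  by apply/(limval_eventually (n := m) (c := true) uu').
(* [X] changes only in the step from a [T2] stage. So a 1 seen at such a stage was present at the
   test before it; any other 1 lasts until the next test of the block or, if there is none, into the
   next block, which opens with one. *)
have seen i : i \in ones -> exists u m, [/\ tle v N u m, wlt u b & W i u m].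
  move=> io; suff [u [m [t ub k1 Xi]]] : exists u m, [/\ tle v N u m, wlt u b, T1 u m & X i u m].
    have tt : tle v N u m.+1 by apply: tle_trans t _; left.
    exists u, m.+1; split=> //; case: (T1_next k1) => _ e -> _.
    by rewrite -e hE // Xi orbT.
  case: (hX i io v N.+1 vb) => u [m [t [ub Xi]]].
  have t' : tle v N u m by apply: tle_trans t; left.
  case k1 : (T1 u m); first by exists u, m.
  case k2 : (T2 u m).
    case: m t t' Xi k1 k2 => [|m] t t' Xi k1 k2; first by have := T2_start u; rewrite k2.
    have t2 : tle v N u m by case: t => [[e le]|]; [left|right].
    have k3 := T2_prev k2.
    by exists u, m; split=> //; case: (T1_next k3) => <-.
  case: (classic (exists n, (m <= n) && T1 u n)) => ex.
    have := ex_minnP ex; case=> n /andP [mn k3] min; exists u, n; split=> //.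
      by apply: tle_trans t' _; left.
    rewrite (X_const (m := m)) // => l /andP [ml ln]; split.
      by apply/negP => h; have := min l; rewrite ml h leqNgt ln => /(_ isT).
    case: l ml ln => [|l] ml ln; first by apply: T2_start.
    apply/negP => h; have k4 := T2_prev h.
    move: ml; rewrite leq_eqVlt => /orP [/eqP e|lt]; first by rewrite -e k2 in h.
    by have := min l; rewrite k4 -ltnS lt leqNgt (ltnW ln) => /(_ isT).
  have noT n : m <= n -> ~~ T1 u n /\ ~~ T2 u n.
    move=> mn; split; first by apply/negP => h; apply: ex; exists n; rewrite mn.
    move: mn; rewrite leq_eqVlt => /orP [/eqP <-|]; first by rewrite k2.
    case: n => // n lt; apply/negP => /T2_prev h; apply: ex; exists n.
    by rewrite h -ltnS lt.
  case: (cof u m ub) => u' [m' [[[e le]|uu'] [u'b k3]]].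
    by subst u'; case: ex; exists m'; rewrite le.
  have [u2 iu] := @imm_exists B u (ex_intro _ u' uu').
  have u2b : wlt u2 b.
    case: (wlt_total u2 u') => [h|[->|h]] //; first exact: wlt_trans u'b.
    by case: (proj2 iu u').
  exists u2, 0; split=> //.
    by apply: tle_trans t' _; right; case: iu.
  apply/X_lim; first by exists u; case: iu.
  apply/(limval_imm _ iu) => M; exists (maxn M m); rewrite leq_maxl; split=> //.
  by rewrite (X_const (m := m)) ?leq_maxr // => l /andP [ml _]; apply: noT.
have [u [m [t ub hW]]] : exists u m, [/\ tle v N u m, wlt u b & forall i, i \in ones -> W i u m].
  elim: ones seen => [_|i s IH seen]; first by exists v, N; split=> //; apply: tle_refl.
  have [u [m [t ub hW]]] := IH (fun j js => seen j (mem_behead (s := i :: s) js)).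
  have [u' [m' [t' u'b hi]]] := seen i (mem_head i s).
  case: (tle_total u m u' m') => t2.
    exists u', m'; split=> // j; rewrite in_cons => /orP [/eqP -> //|js].
    exact: Wmono t ub (hW j js) _ _ t2 u'b.
  exists u, m; split=> // j; rewrite in_cons => /orP [/eqP ->|js]; last exact: hW.
  exact: Wmono t' u'b hi _ _ t2 ub.
case: (cof u m ub) => u' [m' [t' [u'b k1]]]; case: (T1_next k1) => _ e _ _.
have tt : tle v N u' m'.+1 by apply: tle_trans t (tle_trans t' _); left.
move: e; rewrite hE // => /esym/negP; apply; apply/allP => i io.
by rewrite (Wmono i u m t ub (hW i io) u' m' t' u'b).
Qed.

Theorem flag_limit b : (exists v, wlt v b) -> E b 0 <-> (forall i, i \in ones -> X i b 0).
Proof.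
move=> nb; rewrite (E_lim nb); split=> h.
  by move=> i io; apply/(X_lim _ nb); apply: NNPP => /(flag_sound io).
by apply: flag_complete => i io; apply/(X_lim _ nb); apply: h.
Qed.

End Flags.

(** * Packing columns and detecting a pattern at limits *)

Section Packed.
Variables (p : ittm) (m0 : nat) (pat : nat -> bool).

(* Column [h] of the packed machine holds the columns [h * N, ..., h * N + N - 1] of [p].
   Its tracks are: 0 (some cell outside the pattern is on), 1 (the flag of the previous section),
   2 (marks column 0), then [packD] data tracks and [packD] memory tracks. *)
Local Notation N := m0.+1.
Definition packD := 3 * N.
(** Chosen so that the number [packK.+2] of tracks is 3 + 2 * packD. *)
Definition packK := packD + packD + 1.
Local Notation bits := {ffun 'I_packK.+2 -> bool}.
Local Notation pst := (ist p * 'I_N * bool)%type.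
Local Notation pconf := (config pst ('I_packK.+2 * nat)).

Definition pX (f : bits) j := f (inord j.+3).
Definition pW (f : bits) j := f (inord (packD + j).+3).

Definition mkbits z e l (X W : nat -> bool) : bits :=
  [ffun i : 'I_packK.+2 => match nat_of_ord i with
    0 => z | 1 => e | 2 => l | j.+3 => if j < packD then X j else W (j - packD) end].

Lemma mkbits0 z e l X W : mkbits z e l X W (inord 0) = z.
Proof. by rewrite ffunE inordK. Qed.
Lemma mkbits1 z e l X W : mkbits z e l X W (inord 1) = e.
Proof. by rewrite ffunE inordK. Qed.
Lemma mkbits2 z e l X W : mkbits z e l X W (inord 2) = l.
Proof. by rewrite ffunE inordK //; rewrite /packK /packD; lia. Qed.
Lemma mkbitsX z e l X W j : j < packD -> mkbits z e l X W (inord j.+3) = X j.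
Proof. by move=> h; rewrite ffunE inordK ?h //; rewrite /packK; lia. Qed.
Lemma mkbitsW z e l X W j : j < packD -> mkbits z e l X W (inord (packD + j).+3) = W j.
Proof.
move=> h; rewrite ffunE inordK; last by rewrite /packK; lia.
by rewrite ltnNge leq_addr /= addKn.
Qed.

Definition pones := [seq j <- iota 0 packD | pat j].
Definition pzeros := [seq j <- iota 0 packD | ~~ pat j].

Definition upd3 (X : nat -> bool) r w0 w1 w2 j :=
  if j == 3 * r then w0 else if j == (3 * r).+1 then w1 else if j == (3 * r).+2 then w2 else X j.

Definition pmove (l mv : bool) (r : 'I_N) : 'I_N * option bool :=
  if mv then if r == m0 :> nat then (ord0, Some true) else (inord r.+1, None)
  else if r == 0 :> nat then if l then (ord0, None) else (ord_max, Some false) else (inord r.-1, None).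

(** In column 0, recognised by [l], each step of [p] takes two steps: with [ph] off the test, which
    does not move, and with [ph] on the actual step, which recomputes tracks 0 and 1 from the new
    data. A flash thus lasts until the next step only. *)
Definition pdelta (x : pst) (f : bits) : pst * bits * option bool :=
  let: (s, r, ph) := x in
  let l := f (inord 2) in
  if l && ~~ ph then
    let ok := all (fun j => pW f j || pX f j) pones in
    ((s, r, true), mkbits (f (inord 0)) ok l (pX f) (fun j => if ok then false else pW f j || pX f j), None)
  else
    let: (s', (w0, w1, w2), mv) := idelta s (pX f (3 * r), pX f (3 * r).+1, pX f (3 * r).+2) in
    let X := upd3 (pX f) r w0 w1 w2 in
    let: (r', m) := pmove l mv r in
    ((s', r', false), mkbits (if l then has X pzeros else f (inord 0))
                        (if l then all X pones else f (inord 1)) l X (pW f), m).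

Local Notation pstep := (tstep pdelta).

Definition marker (z : pconf) := forall h, ctape z (inord 2, h) = (h == 0).

Lemma marker_step z : marker z -> marker (pstep z).
Proof.
case: z => [[[s r] ph] h t] hm h'; rewrite /tstep /=.
case: ifP => _ /=; first by case: eqP => [->|_]; rewrite ?mkbits2 ?ffunE; apply: hm.
case: idelta => -[s' [[w0 w1] w2]] mv; case: pmove => r' m /=.
by case: eqP => [->|_]; rewrite ?mkbits2 ?ffunE; apply: hm.
Qed.

Lemma marker_iter z n : marker z -> marker (iter n pstep z).
Proof. by move=> h; elim: n => //= n; apply: marker_step. Qed.

Definition colX j (z : pconf) := (j < packD) && ctape z (inord j.+3, 0).
Definition colW j (z : pconf) := (j < packD) && ctape z (inord (packD + j).+3, 0).
Definition colE (z : pconf) := ctape z (inord 1, 0).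
Definition colZ (z : pconf) := ctape z (inord 0, 0).
Definition inT2 (z : pconf) := (cstate z).2.
Definition inT1 (z : pconf) := (chead z == 0) && ~~ inT2 z.

Lemma pones_lt j : j \in pones -> j < packD.
Proof. by rewrite mem_filter mem_iota => /andP [_]. Qed.
Lemma pzeros_lt j : j \in pzeros -> j < packD.
Proof. by rewrite mem_filter mem_iota => /andP [_]. Qed.

Lemma pstep_T1 z : marker z -> inT1 z ->
  [/\ inT2 (pstep z), chead (pstep z) = 0, forall j, colX j (pstep z) = colX j z,
      colE (pstep z) = all (fun j => colW j z || colX j z) pones /\ colZ (pstep z) = colZ z &
      forall j, colW j (pstep z) = if all (fun j => colW j z || colX j z) pones then false
                                   else colW j z || colX j z].
Proof.
case: z => [[[s r] ph] h t] hm; rewrite /inT1 /inT2 /= => /andP [/eqP h0 nph]; subst h.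
have l1 : t (inord 2, 0) = true by exact: (hm 0).
set f := [ffun i => t (i, 0)].
have eok : all (fun j => colW j (Config (s, r, ph) 0 t) || colX j (Config (s, r, ph) 0 t)) pones
    = all (fun j => pW f j || pX f j) pones.
  by apply: eq_in_all => j /pones_lt jD; rewrite /colW /colX /pW /pX jD !ffunE.
rewrite /tstep /= -/f ffunE l1 nph /= /colX /colW /colE /colZ /= eok; split=> //.
- by move=> j; case: ltnP => // jD; rewrite mkbitsX // /pX ffunE.
- by rewrite mkbits1 mkbits0 ffunE.
- by move=> j; case: ltnP => jD /=; [rewrite mkbitsW // /pW /pX !ffunE|case: ifP].
Qed.

Lemma pstep_T2 z : marker z -> inT2 z -> chead z = 0 ->
  [/\ ~~ inT2 (pstep z), colE (pstep z) = all (fun j => colX j (pstep z)) pones,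
      colZ (pstep z) = has (fun j => colX j (pstep z)) pzeros &
      forall j, colW j (pstep z) = colW j z].
Proof.
case: z => [[[s r] ph] h t] hm; rewrite /inT2 /= => hph h0; subst h.
have l1 : t (inord 2, 0) = true by exact: (hm 0).
rewrite /tstep /= ffunE l1 hph /=; set f := [ffun i => t (i, 0)].
case: idelta => -[s' [[w0 w1] w2]] mv; case: pmove => r' m /=.
rewrite /colX /colW /colE /colZ /= mkbits1 mkbits0; split=> //.
- by apply: eq_in_all => j /pones_lt jD; rewrite jD mkbitsX.
- by apply: eq_in_has => j /pzeros_lt jD; rewrite jD mkbitsX.
- by move=> j; case: ltnP => // jD; rewrite mkbitsW // /pW ffunE.
Qed.

Lemma pstep_T0 z : marker z -> chead z != 0 ->
  [/\ ~~ inT2 (pstep z), forall j, colX j (pstep z) = colX j z,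
      colE (pstep z) = colE z /\ colZ (pstep z) = colZ z &
      forall j, colW j (pstep z) = colW j z].
Proof.
case: z => [[[s r] ph] h t] hm /= h0.
have l1 : t (inord 2, h) = false by rewrite -(negbTE h0); exact: (hm h).
rewrite /tstep /= ffunE l1 /=; set f := [ffun i => t (i, h)].
case: idelta => -[s' [[w0 w1] w2]] mv; case: pmove => r' m /=.
by rewrite /colX /colW /colE /colZ /= eq_sym (negbTE h0).
Qed.

Definition tcode (x : tape3) := match x with Inp => 0 | Scr => 1 | Out => 2 end.
Definition xcell (x : tape3 * nat) : 'I_packK.+2 * nat :=
  (inord (3 * (x.2 %% N) + tcode x.1).+3, x.2 %/ N).

Definition pdata (y : iconfig p) (z : pconf) :=
  [/\ marker z, (cstate z).1.1 = cstate y, chead y = chead z * N + (cstate z).1.2 &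
      forall x, ctape z (xcell x) = ctape y x].

Lemma xcell_at h r c : r < N -> xcell (c, h * N + r) = (inord (3 * r + tcode c).+3, h).
Proof. by move=> rN; rewrite /xcell /= modnMDl divnMDl // modn_small // divn_small // addn0. Qed.

Lemma code_lt r c : r < N -> 3 * r + tcode c < packD.
Proof. by rewrite /packD; case: c => /=; lia. Qed.

Lemma upd3_code X r w0 w1 w2 r' c : upd3 X r w0 w1 w2 (3 * r' + tcode c) =
  if r' == r then match c with Inp => w0 | Scr => w1 | Out => w2 end else X (3 * r' + tcode c).
Proof.
rewrite /upd3; case: (r' =P r) => [->|ne].
  by case: c => /=; do 3?[case: eqP => ? //]; lia.
by case: c => /=; do 3![case: eqP => [|_]; first lia].
Qed.

Lemma pdata_step y z : pdata y z -> ~~ inT1 z -> pdata (istep y) (pstep z) /\ ~~ inT2 (pstep z).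
Proof.
move=> [hm es eh et] nT1; have hm' := marker_step hm; rewrite /pdata.
case: z hm es eh et nT1 hm' => [[[s r] ph] h t] hm /= es eh et nT1.
have rN := ltn_ord r.
have l1 : t (inord 2, h) = (h == 0) := hm h.
have rd c : pX [ffun i => t (i, h)] (3 * r + tcode c) = ctape y (c, chead y).
  by rewrite /pX ffunE -et eh xcell_at.
rewrite /tstep /= ffunE l1; move: nT1; rewrite /inT1 /inT2 /= => /negbTE ->.
have := rd Inp; have := rd Scr; have := rd Out; rewrite /= addn0 addn1 addn2 es => -> -> ->.
rewrite /istep; case: idelta => -[s' [[w0 w1] w2]] mv.
case ep : (pmove _ _ _) => [r' m] /= hm'; split=> //; split=> //=.
  rewrite eh; move: ep; rewrite /pmove; case: (mv).
    case: eqP => [-> [<- <-]|ne [<- <-]] /=; first by lia.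
    by rewrite inordK; lia.
  case: eqP => [-> |ne [<- <-]] /=; last by rewrite inordK; lia.
  by case: eqP => [-> [<- <-]|h0 [<- <-]] /=; [|case: (h) h0 => //= h'; lia].
move=> [c j]; rewrite (divn_eq j N); move: (j %/ N) (j %% N) (ltn_pmod j (ltn0Sn m0)) => a b bN {j}.
have ea : (a * N + b) %/ N = a by rewrite divnMDl // divn_small // addn0.
have eb : (a * N + b) %% N = b by rewrite modnMDl modn_small.
rewrite /= ea eb eh; case: (a =P h) => [e|ne].
  subst a; rewrite mkbitsX ?code_lt // upd3_code eqn_add2l; case: eqP => // ne.
  by rewrite /pX ffunE -et xcell_at.
rewrite -et xcell_at //; case: eqP => // e; case: ne.
by rewrite -ea e divnMDl // divn_small // addn0.
Qed.

Lemma pdata_T1 y z : pdata y z -> inT1 z -> pdata y (pstep z).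
Proof.
move=> [hm es eh et] h1; have hm' := marker_step hm; rewrite /pdata.
case: z hm es eh et h1 hm' => [[[s r] ph] h t] hm /= es eh et h1.
have l1 : t (inord 2, h) = (h == 0) := hm h.
rewrite /tstep /= ffunE l1; move: h1; rewrite /inT1 /inT2 /= => -> /= hm'; split=> //= -[c j].
rewrite -et; rewrite (divn_eq j N); move: (j %/ N) (j %% N) (ltn_pmod j (ltn0Sn m0)) => a b bN {j}.
have ea : (a * N + b) %/ N = a by rewrite divnMDl // divn_small // addn0.
have eb : (a * N + b) %% N = b by rewrite modnMDl modn_small.
rewrite /xcell /= ea eb; case: eqP => // ->.
by rewrite mkbitsX ?code_lt // /pX ffunE.
Qed.

Definition pbetween y (z : pconf) := forall x, ctape z (xcell x) = ctape y x \/ ctape z (xcell x) = ctape (@istep p y) x.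

Lemma pdata_macro y z : pdata y z /\ ~~ inT2 z ->
  exists z', spath pstep (pbetween y) z z' /\ (pdata (istep y) z' /\ ~~ inT2 z').
Proof.
move=> [dz n2]; case h1 : (inT1 z); last first.
  exists (pstep z); split; last by apply: pdata_step; rewrite ?h1.
  by apply: spath1 => x; left; case: dz.
have d1 := pdata_T1 dz h1.
have h2 : inT2 (pstep z) by case: dz => hm _ _ _; case: (pstep_T1 hm h1).
exists (pstep (pstep z)); split; last by apply: pdata_step; rewrite // /inT1 h2 andbF.
apply: spath_cons; first by move=> x; left; case: dz.
by apply: spath1 => x; left; case: d1.
Qed.

Definition pstart : pst := (istart p, ord0, false).
Definition plim : pst := (ilim p, ord0, false).
Definition pinit : pconf := Config pstart 0 (fun x => (x.1 == inord 2) && (x.2 == 0)).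

Section Run.
Variables (B : WO) (s : B -> iconfig p) (sp : B -> pconf).
Hypothesis run : brun (iinit p (fun=> false)) (@istep p) (ilim p) s.
Hypothesis runp : brun pinit pstep plim sp.

Lemma pinit_data j : j < packD -> ctape pinit (inord j.+3, 0) = false.
Proof.
move=> h; rewrite /= andbT; apply/eqP => /(congr1 val) /=.
by rewrite !inordK // /packK; lia.
Qed.

Lemma marker_run b : marker (sp b).
Proof.
elim/(well_founded_ind (@wlt_wf B)): b => b IH.
case: (classic (exists v, wlt v b)) => nb; last first.
  have mb v : ~ wlt v b by move=> vb; apply: nb; exists v.
  by case: (runp b) => /(_ mb) -> _ h; rewrite /= eqxx.
case: (runp b) => _ /(_ nb) [_ _ ht] h; case: (nb) => v vb.
have e : limval (fun u m => ctape (iter m pstep (sp u)) (inord 2, h)) b <-> (h == 0).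
  by apply: (limval_eventually (n := 0) vb) => u m _ ub; apply: marker_iter; apply: IH.
by apply/idP/idP => [/ht /e|/e /ht].
Qed.

Lemma block_start b : chead (sp b) = 0 /\ ~~ inT2 (sp b).
Proof.
case: (classic (exists v, wlt v b)) => nb.
  by case: (runp b) => _ /(_ nb) [e1 e2 _]; rewrite /inT2 e1 e2.
by case: (runp b) => -> // v vb; case: nb; exists v.
Qed.

Lemma T2_head b m : inT2 (iter m pstep (sp b)) -> chead (iter m pstep (sp b)) = 0.
Proof.
case: m => [|m]; first by case: (block_start b).
have hm := marker_iter m (marker_run b); rewrite iterS.
move: (iter m pstep (sp b)) hm => z hm h2.
case h0 : (chead z == 0); last by case: (pstep_T0 hm (negbT h0)); rewrite h2.
case h1 : (inT1 z); first by case: (pstep_T1 hm h1).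
move: h1; rewrite /inT1 h0 /= => /negbFE h1.
by case: (pstep_T2 hm h1 (eqP h0)); rewrite h2.
Qed.

(** Flags and memory are not functions of the simulated configuration, so [simulation] does not
    apply. Only the data cells are compared; the extra step of a test does not change them. *)
Lemma pdata_run b : pdata (s b) (sp b).
Proof.
elim/(well_founded_ind (@wlt_wf B)): b => b IH.
case: (classic (exists v, wlt v b)) => nb; last first.
  have mb v : ~ wlt v b by move=> vb; apply: nb; exists v.
  split; first exact: marker_run.
  - by case: (run b) => /(_ mb) -> _; case: (runp b) => /(_ mb) -> _.
  - by case: (run b) => /(_ mb) -> _; case: (runp b) => /(_ mb) -> _.
  - move=> [c j]; case: (run b) => /(_ mb) -> _; case: (runp b) => /(_ mb) -> _.
    rewrite /= (_ : _ == _ = false); first by case: c.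
    apply/eqP => /(congr1 val) /=; rewrite !inordK // /packK.
    by have := code_lt c (ltn_pmod j (ltn0Sn m0)); lia.
split; first exact: marker_run.
- by case: (run b) => _ /(_ nb) [-> _ _]; case: (runp b) => _ /(_ nb) [-> _ _].
- by case: (run b) => _ /(_ nb) [_ -> _]; case: (runp b) => _ /(_ nb) [-> -> _].
move=> x; apply: (@sim_cell _ _ _ _ _ _ _ _ _ _ _ _ (fun b : B => b) (fun u v uv => uv)
  (fun _ _ x _ _ => ex_intro _ x erefl) _ _ run runp) => // [u ub|v u vu ub].
  apply: (@macro_infi _ _ _ _ (fun n z => pdata (iter n (@istep p) (s u)) z /\ ~~ inT2 z)
    (fun n => pbetween (iter n (@istep p) (s u))) 0) => /= [|n z|n z [[]]//|n z]; last exact.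
  - by split; [exact: IH|case: (block_start u)].
  - exact: pdata_macro.
apply: (@macro_ex _ _ _ _ (fun n z => pdata (iter n (@istep p) (s u)) z /\ ~~ inT2 z)
    (fun n => pbetween (iter n (@istep p) (s u))) 0) => //= [|n z|n z [[]]//].
- by split; [exact: IH|case: (block_start u)].
- exact: pdata_macro.
Qed.

Lemma col_lim c i b : (exists v, wlt v b) ->
  (c && ctape (sp b) (i, 0)) <-> limval (fun u m => c && ctape (iter m pstep (sp u)) (i, 0)) b.
Proof.
move=> nb; case: c => /=; first by case: (runp b) => _ /(_ nb) [_ _].
by rewrite limval_const.
Qed.

Lemma flag_run b : (exists v, wlt v b) ->
  colE (sp b) <-> (forall i, i \in pones -> colX i (sp b)).
Proof.
apply: (@flag_limit B pones (fun j u m => colX j (iter m pstep (sp u)))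
  (fun j u m => colW j (iter m pstep (sp u))) (fun u m => colE (iter m pstep (sp u)))
  (fun u m => inT1 (iter m pstep (sp u))) (fun u m => inT2 (iter m pstep (sp u)))).
- by move=> u; rewrite /inT1 /=; case: (block_start u) => ->.
- by move=> u; case: (block_start u).
- move=> u m h1; case: (pstep_T1 (marker_iter m (marker_run u)) h1) => h2 _ hX [hE _] hW.
  by split.
- move=> u m h2; case: (pstep_T2 (marker_iter m (marker_run u)) h2 (T2_head h2)) => ? ? ? ?.
  by split.
- move=> u m h1 h2; have h0 : chead (iter m pstep (sp u)) != 0.
    by move: h1; rewrite /inT1 h2 andbT.
  by case: (pstep_T0 (marker_iter m (marker_run u)) h0) => ? ? [? ?] ?; split.
- by move=> i u nu; apply: col_lim.
- by move=> i u nu; apply: col_lim.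
- by move=> u nu; apply: (@col_lim true).
Qed.

(** Limsup commutes with finite disjunctions, so for the zeros of the pattern it is enough to update
    track 0 along with the data. *)
Lemma zero_run b m : colZ (iter m pstep (sp b)) = has (fun j => colX j (iter m pstep (sp b))) pzeros.
Proof.
elim/(well_founded_ind (@wlt_wf B)): b m => b IH; elim=> [|m IHm] /=.
  case: (classic (exists v, wlt v b)) => nb; last first.
    have mb v : ~ wlt v b by move=> vb; apply: nb; exists v.
    case: (runp b) => /(_ mb) -> _; rewrite /colZ /= (_ : _ == _ = false) /=; last first.
      by apply/eqP => /(congr1 val) /=; rewrite !inordK // /packK /packD; lia.
    by apply/esym/negbTE/hasPn => j /pzeros_lt h; rewrite /colX h pinit_data.
  have e : limval (fun u m => colZ (iter m pstep (sp u))) b <->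
      limval (fun u m => has (fun j => colX j (iter m pstep (sp u))) pzeros) b.
    by split; apply: limval_mono => u m ub; rewrite IH.
  have eZ : colZ (sp b) <-> limval (fun u m => colZ (iter m pstep (sp u))) b by apply: (@col_lim true).
  have eX := limval_has pzeros (fun j u m => colX j (iter m pstep (sp u))) nb.
  apply/idP/idP => [/eZ /e /eX [j js /(col_lim _ _ nb) h]|/hasP [j js h]].
    by apply/hasP; exists j.
  by apply/eZ/e/eX; exists j => //; apply/(col_lim _ _ nb).
have hm := marker_iter m (marker_run b).
case h0 : (chead (iter m pstep (sp b)) == 0); last first.
  case: (pstep_T0 hm (negbT h0)) => _ hX [_ ->] _; rewrite IHm.
  by apply: eq_has => j; rewrite hX.
case h1 : (inT1 (iter m pstep (sp b))).
  case: (pstep_T1 hm h1) => _ _ hX [_ ->] _; rewrite IHm.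
  by apply: eq_has => j; rewrite hX.
move: h1; rewrite /inT1 h0 /= => /negbFE h1.
by case: (pstep_T2 hm h1 (eqP h0)).
Qed.

Lemma pattern_run b : (exists v, wlt v b) ->
  (~~ colZ (sp b) && colE (sp b)) <->
  (forall c r, r < N -> ctape (s b) (c, r) = pat (3 * r + tcode c)).
Proof.
move=> nb; have := zero_run b 0 => /= ->.
have dat c r : r < N -> ctape (s b) (c, r) = colX (3 * r + tcode c) (sp b).
  move=> rN; case: (pdata_run b) => _ _ _ <-; rewrite /colX code_lt //.
  by have := xcell_at 0 c rN; rewrite mul0n add0n => ->.
have cod j : j < packD -> exists c r, r < N /\ j = 3 * r + tcode c.
  rewrite /packD => h; have := ltn_pmod j (isT : 0 < 3); have := divn_eq j 3.
  case: (j %% 3) => [|[|[|]]] // e _; [exists Inp|exists Scr|exists Out]; exists (j %/ 3) => /=; lia.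
split=> [/andP [hZ /(flag_run nb) hE] c r rN|h].
  rewrite dat //; case e : (pat _).
    by apply: hE; rewrite mem_filter e mem_iota code_lt.
  apply: contraNF hZ => hX; apply/hasP; exists (3 * r + tcode c) => //.
  by rewrite mem_filter e mem_iota code_lt.
have eX j : j < packD -> colX j (sp b) = pat j.
  by case/cod => c [r [rN ->]]; rewrite -dat // h.
apply/andP; split.
  apply/hasPn => j; rewrite mem_filter mem_iota => /andP [hp /andP [_ jD]].
  by rewrite eX.
apply/(flag_run nb) => j; rewrite mem_filter mem_iota => /andP [hp /andP [_ jD]].
by rewrite eX.
Qed.

End Run.
End Packed.

Lemma istep_local (p : ittm) N k (y z : iconfig p) : chead y + k <= N ->
  cstate y = cstate z -> chead y = chead z ->
  (forall c j, j < N -> ctape y (c, j) = ctape z (c, j)) ->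
  cstate (iter k (@istep p) y) = cstate (iter k (@istep p) z).
Proof.
elim: k y z => // k IH y z hk es eh et; rewrite !iterSr.
case: y z es eh et hk => [s h t] [s' h' t'] /= <- <- et hk.
have e c : t (c, h) = t' (c, h) by apply: et; lia.
rewrite /istep /= -!e; case: idelta => -[s2 [[w0 w1] w2]] mv.
apply: IH => //=; first by case: mv; lia.
by move=> c j jN; rewrite et.
Qed.

(** * The double-head clock *)

Section Clocker.
Variables (p : ittm) (m0 : nat) (pat : nat -> bool).
Local Notation pst := (ist p * 'I_m0.+1 * bool)%type.
Local Notation pstep := (tstep (@pdelta p m0 pat)).
Local Notation cst := (trst (packK m0) pst + (unit + mode + 'I_m0.+2))%type.

Definition cboot : cst := inr (inl (inl tt)).
Definition cmode m : cst := inr (inl (inr m)).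
Definition ccount i : cst := inr (inr i).

(** The cells visible at a limit are tracks 0 and 1 of column 0, so the first step already decides
    and counts as step 1 of the countdown. Booting goes to position 1, where the right cell is track
    2 of column 0, to write the mark. *)
Definition ckdelta (x : cst) (b : bool * bool) : cst * (bool * bool) * bool :=
  match x with
  | inl c => let: (c', w, mv) := trdelta (@pdelta p m0 pat) c b in (inl c', w, mv)
  | inr (inl (inl _)) => (inl (Rd0 _ (pstart p m0)), (b.1, true), false)
  | inr (inl (inr MStart)) => (cboot, b, true)
  | inr (inl (inr MLim)) => if ~~ b.1 && b.2 then (ccount (inord 1), b, false)
                            else (inl (Rd0 _ (plim p m0)), b, false)
  | inr (inl (inr MHalt)) => (x, b, false)
  | inr (inr i) => (ccount (inord i.+1), b, false)
  end.

Definition clocker : ottm.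
Proof.
refine (@Build_ottm cst (cmode MStart) (ccount ord_max) (cmode MLim) _ ckdelta).
by split; apply/eqP.
Defined.

Local Notation tenc := (@tenc (packK m0) pst clocker inl).

Lemma pdelta_left x f s w : @pdelta p m0 pat x f = (s, w, Some false) -> f (inord 2) = false.
Proof.
case: x => [[s1 r] ph]; rewrite /pdelta; case: ifP => // _.
case: idelta => -[s' [[w0 w1] w2]] mv; rewrite /pmove.
by case: mv; case: ifP => //= _; case: ifP.
Qed.

Lemma clocker_step z : marker z ->
  spath (@ostep clocker) (between (ohalt clocker) (venc (ctape z)) (venc (ctape (pstep z))))
    (tenc z) (tenc (pstep z)).
Proof.
move=> hm; apply: (@tenc_step _ _ _ clocker inl pred0) => // s w /pdelta_left.
by rewrite ffunE hm; case: (chead z).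
Qed.

Lemma clocker_boot : iter 2 (@ostep clocker) (oinit clocker (fun=> false)) = tenc (pinit p m0).
Proof.
rewrite /ostep /=; apply: config_eq => //= x; rewrite /venc /=.
have -> : (inord (cellIdx x %% (packK m0).+2) == inord 2 :> 'I_(packK m0).+2) && (cellIdx x %/ (packK m0).+2 == 0)
    = (cellIdx x == 2).
  rewrite -val_eqE /= inordK ?ltn_pmod // inordK; last by rewrite /packK /packD; lia.
  case: (ltnP (cellIdx x) (packK m0).+2) => h; first by rewrite modn_small // divn_small // andbT.
  have -> : (cellIdx x == 2) = false by move: h; rewrite /packK /packD; lia.
  by rewrite -leqn0 leqNgt divn_gt0 // h andbF.
by case: x => [[|[|[|]]]|].
Qed.

Lemma venc_flags t : venc t (cellAt 0) = t (inord 0 : 'I_(packK m0).+2, 0) /\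
  venc t (cellAt 1) = t (inord 1 : 'I_(packK m0).+2, 0).
Proof.
have e0 := @venc_at (packK m0) t 0 0 isT; have e1 := @venc_at (packK m0) t 0 1 isT.
by rewrite mul0n in e0 e1.
Qed.

Lemma clocker_lim z t : cstate z = plim p m0 -> chead z = 0 -> ctape z = t ->
  ~~ (~~ colZ z && colE z) ->
  iter 1 (@ostep clocker) (Config (cmode MLim : ost clocker) 0 (venc t)) = tenc z.
Proof.
move=> es eh et; rewrite /colZ /colE et; have [<- <-] := venc_flags t => /negbTE h.
rewrite iterS (@ostep_id clocker _ _ _ (inl (Rd0 _ (plim p m0))) false) //=; last by rewrite h.
by rewrite /tenc es eh et.
Qed.

Lemma clocker_count (z : config pst ('I_(packK m0).+2 * nat)) i : ~~ colZ z && colE z -> 0 < i -> i <= m0.+1 ->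
  iter i (@ostep clocker) (Config (cmode MLim : ost clocker) 0 (venc (ctape z))) =
  Config (ccount (inord i) : ost clocker) 0 (venc (ctape z)).
Proof.
rewrite /colZ /colE; have [<- <-] := venc_flags (ctape z) => h.
elim: i => // -[|i] IH _ le.
  by rewrite iterS (@ostep_id clocker _ _ _ (ccount (inord 1)) false) //= h.
rewrite iterS IH // 1?ltnW // (@ostep_id clocker _ _ _ (ccount (inord i.+2)) false) //=.
by rewrite inordK // ltnW.
Qed.

End Clocker.

(** The pattern is what [p] itself shows in its first [n.+1] columns at stage omega * b. At an
    earlier limit the same columns would make [p] halt [n.+1] steps later, so [b] is the first match
    after the start. *)
Theorem ittm_to_ottm_clockable (A : WO) : ittm_clockable A -> ottm_clockable A.
Proof.
move=> [p [W [top [c [hc isoA]]]]]; have [B [s [b [n [[r hs nh hm] _ /(_ A isoA) iso]]]]] := halts_blocks hc.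
suff [q [s' h]] : exists (q : ottm) (s' : B -> oconfig q),
    bhalts (oinit q (fun=> false)) (@ostep q) (olim q) (ohalt q) s' b n.
  by exists q, (WOtime b n), (time_top b n); eexists; split; first exact: (blocks_halts h).
case: n hs hm {iso} => [|n] hs hm.
  case: (classic (exists v, wlt v b)) => nb.
    by case: (r b) => _ /(_ nb) [e _ _]; case: (idistinct p) => _; rewrite -hs -e eqxx.
  case: (r b) => h _; move: hs; rewrite /= h; last by move=> v vb; apply: nb; exists v.
  by move=> /= e; case: (idistinct p); rewrite e eqxx.
case: (classic (exists v, wlt v b)) => nb; last first.
  exists (ocounter n); apply: finite_bhalts => [v vb||m lt]; first by apply: nb; exists v.
    by rewrite ocounter_state //; congr Some; apply: val_inj; rewrite /= inordK.
  by rewrite ocounter_state 1?ltnW //; apply: inord_neq_max.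
pose pat j := ctape (s b) (match j %% 3 with 0 => Inp | 1 => Scr | _ => Out end, j %/ 3).
have patE t j : pat (3 * j + tcode t) = ctape (s b) (t, j).
  rewrite /pat mulnC modnMDl divnMDl //.
  by case: t => /=; rewrite addn0.
pose q := clocker p n pat.
have [sp rp] := brun_exists (pinit p n) (tstep (@pdelta p n pat)) (plim p n) B.
exists q; have [s' r'] := brun_exists (oinit q (fun=> false)) (@ostep q) (olim q) B; exists s'.
have hmk u m : marker (iter m (tstep (@pdelta p n pat)) (sp u)).
  by apply: marker_iter; apply: (marker_run rp).
have nomatch u : (exists v, wlt v u) -> nohalt (@istep p) (ihalt p) (s u) -> ~~ (~~ colZ (sp u) && colE (sp u)).
  move=> nu hu; apply/negP => /(pattern_run r rp nu) h; apply: (hu n.+1); rewrite -hs.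
  case: (r u) => _ /(_ nu) [e1 e2 _]; case: (r b) => _ /(_ nb) [e3 e4 _].
  apply: (@istep_local p n.+1); rewrite ?e1 ?e2 ?e3 ?e4 // => t j jn.
  by rewrite h // patE.
have plimE u : (exists v, wlt v u) -> cstate (sp u) = plim p n /\ chead (sp u) = 0.
  by move=> nu; case: (rp u) => _ /(_ nu) [].
pose E u k : oconfig q := @tenc _ _ q inl (iter k (tstep (@pdelta p n pat)) (sp u)).
have ES u k : spath (@ostep q) (between (ohalt q) (ctape (E u k)) (ctape (E u k.+1))) (E u k) (E u k.+1).
  exact: clocker_step.
refine (let: conj h1 h2 := @simulation _ _ _ _ _ _ _ _ _ _ (ohalt q) _ _ (fun b : B => b)
  (fun u v uv => uv) (fun _ _ x _ _ => ex_intro _ x erefl) _ _ rp r' (fun y => venc (ctape y))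
  _ (fun u => nohalt (@istep p) (ihalt p) (s u)) _ _ b nh in _).
- by move=> x; left; eexists => y; rewrite /venc.
- move=> u mu nu; apply: (enc_tracks (E := E u) (t0 := 2)) => //.
  + by case: (rp u) => /(_ mu) e _; case: (r' u) => /(_ mu) -> _; rewrite clocker_boot /E /= e.
  + by case: (r' u) => /(_ mu) -> _; case=> [|[|]].
- move=> u nu hu eu.
  have e0 : iter 1 (@ostep q) (s' u) = E u 0.
    by rewrite eu; apply: clocker_lim; rewrite ?nomatch //; case: (plimE u nu).
  have h0 t : t < 1 -> iter t (@ostep q) (s' u) = s' u by case: t.
  split; first by apply: (enc_tracks (E := E u) (t0 := 1)) => // t /h0 ->; rewrite eu.
  by apply: (enc_tracks_ex (halt' := ohalt q) (E := E u) (t0 := 1)) => // t j /h0 ->; rewrite eu.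
- have mt : ~~ colZ (sp b) && colE (sp b).
    by apply/(pattern_run r rp nb) => t j jn; rewrite patE.
  split=> //.
  + rewrite (h1 nb) clocker_count //=; congr ccount; apply: val_inj; rewrite /= inordK //.
  + move=> [|m] lt; rewrite (h1 nb) //; rewrite clocker_count //=; last exact: ltnW.
    by move=> []/(congr1 val); rewrite /= inordK; lia.
Qed.

(** * Three tapes on five tracks *)

Section Sentinel.
Variable p : ittm.
Local Notation bits := {ffun 'I_5 -> bool}.
Local Notation sconf := (config (ist p) ('I_5 * nat)).

(* Tracks: 0 marks the columns other than 0; 1 marks column 0; 2, 3, 4 are scratch, output, input.
   Column [h] of [p] is column [h.+1]; column 0 only makes the head bounce, and its
   scratch bit tells whether the computation has begun. *)
Definition sdelta (s : ist p) (f : bits) : ist p * bits * option bool :=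
  if f (inord 0) then
    let: (s', (w0, w1, w2), mv) := idelta s (f (inord 4), f (inord 2), f (inord 3)) in
    (s', [ffun i : 'I_5 => match nat_of_ord i with 2 => w1 | 3 => w2 | 4 => w0 | _ => f i end], Some mv)
  else
    (if (s == ilim p) && ~~ f (inord 2) then istart p else s,
     [ffun i : 'I_5 => (i == 2 :> nat) || f i], Some true).

Local Notation sstep := (@tstep 3 _ sdelta).

Definition stape (t : tape3 * nat -> bool) (x : 'I_5 * nat) : bool :=
  let: (i, h) := x in
  match nat_of_ord i, h with
  | 0, _ => h != 0 | 1, _ => h == 0
  | 2, h'.+1 => t (Scr, h') | 2, 0 => true
  | 3, h'.+1 => t (Out, h') | 3, 0 => false
  | _, h'.+1 => t (Inp, h') | _, 0 => false
  end.

Arguments stape : simpl never.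

Definition senc (y : iconfig p) : sconf := Config (cstate y) (chead y).+1 (stape (ctape y)).

Lemma ord5P (P : 'I_5 -> Prop) : P (inord 0) -> P (inord 1) -> P (inord 2) -> P (inord 3) -> P (inord 4) ->
  forall i, P i.
Proof.
move=> p0 p1 p2 p3 p4 i; rewrite -(inord_val i).
by case: (nat_of_ord i) (ltn_ord i) => [|[|[|[|[|]]]]].
Qed.

Lemma stape0 t h : stape t (inord 0, h) = (h != 0). Proof. by rewrite /stape inordK. Qed.
Lemma stape1 t h : stape t (inord 1, h) = (h == 0). Proof. by rewrite /stape inordK. Qed.
Lemma stape2 t h : stape t (inord 2, h) = if h is h'.+1 then t (Scr, h') else true.
Proof. by rewrite /stape inordK. Qed.
Lemma stape3 t h : stape t (inord 3, h) = if h is h'.+1 then t (Out, h') else false.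
Proof. by rewrite /stape inordK. Qed.
Lemma stape4 t h : stape t (inord 4, h) = if h is h'.+1 then t (Inp, h') else false.
Proof. by rewrite /stape inordK. Qed.
Definition stapeE := (stape0, stape1, stape2, stape3, stape4).

Lemma sstep_body y : exists mv, chead (istep y) = (if mv then (chead y).+1 else (chead y).-1) /\
  sstep (senc y) = Config (cstate (istep y)) (if mv then (chead y).+2 else chead y) (stape (ctape (istep y))).
Proof.
case: y => s h t; rewrite /senc /tstep /= /sdelta !ffunE !stapeE /=.
rewrite /istep /=; case: idelta => -[s' [[w0 w1] w2]] mv /=; exists mv; split=> //.
apply: config_eq => //= -[i [|j]] //=; rewrite eqSS.
elim/ord5P: i; rewrite !stapeE ?ffunE ?inordK //; by case: eqP => // ->; rewrite ?stapeE.
Qed.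

Lemma sstep_bounce s (t : 'I_5 * nat -> bool) : t (inord 0, 0) = false -> t (inord 2, 0) ->
  sstep (Config s 0 t) = Config s 1 t.
Proof.
move=> h0 h2; rewrite /tstep /= /sdelta !ffunE h0 h2 andbF; apply: config_eq => //= -[i h] /=.
by case: eqP => // ->; rewrite !ffunE; elim/ord5P: i => //; rewrite inordK // h2.
Qed.

Lemma senc_step y : cstate y <> ihalt p -> cstate (istep y) <> ihalt p ->
  spath sstep (between (ihalt p) (stape (ctape y)) (stape (ctape (istep y)))) (senc y) (senc (istep y)).
Proof.
move=> n1 n2; have [mv [eh es]] := sstep_body y.
have U0 : between (ihalt p) (stape (ctape y)) (stape (ctape (istep y))) (senc y) by split=> //; left.
case: mv eh es => eh es; first by rewrite /senc eh -es; apply: spath1.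
case h0 : (chead y) eh es => [|h] eh es; last by rewrite /senc eh -es; apply: spath1.
apply: spath_cons => //; rewrite es /senc eh -[0.-1.+1]/1.
set t := stape (ctape (istep y)); have <- : sstep (Config (cstate (istep y)) 0 t) = Config (cstate (istep y)) 1 t.
  by apply: sstep_bounce; rewrite /t ?stapeE.
by apply: spath1; split=> //; right.
Qed.

Variable a : real.

(** The simulation is entered at a limit, hence in the limit state, with the scratch bit of column 0
    still off. The first bounce replaces the state by the start state and sets the bit, so that
    [ilim p] is respected from then on. *)
Definition sinit : sconf := Config (ilim p) 0 (fun x => let: (i, h) := x in
  match nat_of_ord i with 0 => h != 0 | 1 => h == 0 | 4 => if h is h'.+1 then a h' else false | _ => false end).

Lemma sinit_step : sstep sinit = senc (iinit p a).
Proof.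
rewrite /tstep /= /sdelta !ffunE !inordK //= eqxx; apply: config_eq => //= -[i h].
by case: h => [|h] /=; elim/ord5P: i; rewrite ?ffunE !stapeE ?inordK.
Qed.

Lemma slim_step (y : iconfig p) : cstate y = ilim p -> chead y = 0 ->
  sstep (Config (ilim p) 0 (stape (ctape y))) = senc y.
Proof. by move=> es eh; rewrite sstep_bounce ?stapeE // /senc es eh. Qed.

Lemma stape_dich x : (exists i, forall y : iconfig p, stape (ctape y) x = ctape y i) \/
  (exists c, forall y : iconfig p, stape (ctape y) x = c).
Proof.
case: x => i [|h]; elim/ord5P: i.
- by right; exists false => y; rewrite stapeE.
- by right; exists true => y; rewrite stapeE.
- by right; exists true => y; rewrite stapeE.
- by right; exists false => y; rewrite stapeE.
- by right; exists false => y; rewrite stapeE.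
- by right; exists true => y; rewrite stapeE.
- by right; exists false => y; rewrite stapeE.
- by left; exists (Scr, h) => y; rewrite stapeE.
- by left; exists (Out, h) => y; rewrite stapeE.
- by left; exists (Inp, h) => y; rewrite stapeE.
Qed.

(** Tracks 0 and 1 of column 0 are the two cells visible at a limit. With column 0 set aside, they
    stay at 0 and 1, the combination by which [udelta] recognises that [p] is to be run. *)
Definition smarked (z : sconf) := forall h, ctape z (inord 0, h) = (h != 0) /\ ctape z (inord 1, h) = (h == 0).

Lemma smarked_step z : smarked z -> smarked (sstep z).
Proof.
case: z => s h t hm h'; rewrite /tstep /= /sdelta !ffunE; case: ifP => _ /=.
  by case: idelta => -[s' [[w0 w1] w2]] mv /=; case: eqP => [->|_]; rewrite ?ffunE ?inordK //; apply: hm.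
by case: eqP => [->|_]; rewrite ?ffunE ?inordK //; apply: hm.
Qed.

Lemma smarked_iter z n : smarked z -> smarked (iter n sstep z).
Proof. by move=> h; elim: n => //= n; apply: smarked_step. Qed.

Lemma smarked_stape s h t : smarked (Config s h (stape t)).
Proof. by move=> h'; rewrite /= !stapeE. Qed.

Lemma smarked_init : smarked sinit.
Proof. by move=> h; rewrite /sinit /= !inordK. Qed.

Lemma sdelta_left z s w : smarked z ->
  sdelta (cstate z) [ffun i => ctape z (i, chead z)] = (s, w, Some false) -> 0 < chead z.
Proof. by move=> hm; rewrite /sdelta ffunE; case: (hm (chead z)) => -> _; case: (chead z). Qed.

Section Run.
Variables (B : WO) (s : B -> iconfig p) (ss : B -> sconf).
Hypothesis run : brun (iinit p a) (@istep p) (ilim p) s.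
Hypothesis runs : brun sinit sstep (ilim p) ss.

Lemma srun_start b : ((exists v, wlt v b) -> ss b = Config (ilim p) 0 (stape (ctape (s b)))) ->
  iter 1 sstep (ss b) = senc (s b).
Proof.
move=> h; case: (classic (exists v, wlt v b)) => nb.
  by rewrite h //; case: (run b) => _ /(_ nb) [e1 e2 _]; apply: slim_step.
have mb v : ~ wlt v b by move=> vb; apply: nb; exists v.
by case: (run b) => /(_ mb) -> _; case: (runs b) => /(_ mb) -> _; apply: sinit_step.
Qed.

Lemma srun_state b : cstate (ss b) = ilim p.
Proof.
case: (classic (exists v, wlt v b)) => nb; first by case: (runs b) => _ /(_ nb) [].
have mb v : ~ wlt v b by move=> vb; apply: nb; exists v.
by case: (runs b) => /(_ mb) -> _.
Qed.

Lemma lim_not_halt : ilim p <> ihalt p.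
Proof. by case: (idistinct p) => _ /eqP. Qed.

Lemma srun_halt0 b t : t < 1 -> cstate (iter t sstep (ss b)) <> ihalt p.
Proof. by case: t => // _; rewrite /= srun_state; apply: lim_not_halt. Qed.

Lemma srun_sim b : (forall u, wlt u b -> nohalt (@istep p) (ihalt p) (s u)) ->
  ((exists v, wlt v b) -> ss b = Config (ilim p) 0 (stape (ctape (s b)))) /\
  (forall u, wlt u b -> nohalt sstep (ihalt p) (ss u)).
Proof.
apply: (@simulation _ _ _ _ _ _ _ _ _ _ (ihalt p) _ _ (fun b : B => b)
  (fun u v uv => uv) (fun _ _ x _ _ => ex_intro _ x erefl) _ _ run runs (fun y => stape (ctape y))
  stape_dich (fun u => nohalt (@istep p) (ihalt p) (s u))) => {}b.
- move=> mb nh; apply: (enc_tracks (E := fun n => senc (iter n (@istep p) (s b))) (t0 := 1)) => //.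
  + by apply: srun_start => -[v /mb].
  + exact: srun_halt0.
  + by move=> n; apply: senc_step; [apply: nh|apply: (nh n.+1)].
- move=> nb nh eb; split.
    apply: (enc_tracks (E := fun n => senc (iter n (@istep p) (s b))) (t0 := 1)) => //.
    + exact: srun_start.
    + exact: srun_halt0.
    + by move=> n; apply: senc_step; [apply: nh|apply: (nh n.+1)].
  apply: (enc_tracks_ex (halt' := ihalt p) (E := fun n => senc (iter n (@istep p) (s b))) (t0 := 1)) => //.
  + exact: srun_start.
  + by move=> n; apply: senc_step; [apply: nh|apply: (nh n.+1)].
  + by case=> // j _; rewrite /= eb.
Qed.

Lemma srun_nohalt b : (forall u, wlt u b -> nohalt (@istep p) (ihalt p) (s u)) ->
  nohalt (@istep p) (ihalt p) (s b) -> nohalt sstep (ihalt p) (ss b).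
Proof.
move=> nh nb; have [h _] := srun_sim nh.
have [] // := @enc_tracks _ _ _ _ (@istep p) sstep (ihalt p)
  (fun y => stape (ctape y)) (fun n => senc (iter n (@istep p) (s b))) (s b) _ 1 (srun_start h).
  exact: srun_halt0.
by move=> n; apply: senc_step; [apply: nb|apply: (nb n.+1)].
Qed.

(** [p] may halt on a left move from its leftmost column, which leaves the head in the sentinel
    column before any bounce. The last step is therefore treated apart, and nothing is said about
    the head. *)
Lemma srun_reach b N : (forall u, wlt u b -> nohalt (@istep p) (ihalt p) (s u)) ->
  (forall n, n <= N -> cstate (iter n (@istep p) (s b)) <> ihalt p) ->
  exists t, [/\ cstate (iter t sstep (ss b)) = cstate (iter N.+1 (@istep p) (s b)),
    ctape (iter t sstep (ss b)) = stape (ctape (iter N.+1 (@istep p) (s b))) &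
    forall t', t' < t -> cstate (iter t' sstep (ss b)) <> ihalt p].
Proof.
move=> nh hN; have [h _] := srun_sim nh.
have [|t [et ht]] := @enc_reach _ _ sstep (ihalt p) (fun n => senc (iter n (@istep p) (s b))) (ss b) 1
  (srun_start h) (@srun_halt0 b) N.
  by move=> n nN; apply: senc_step; [apply: hN; apply: ltnW|apply: (hN n.+1)].
have [mv [_ e]] := sstep_body (iter N (@istep p) (s b)).
exists t.+1; rewrite !iterS et e; split=> // t'.
rewrite ltnS leq_eqVlt => /orP [/eqP ->|/ht //].
by rewrite et; apply: hN.
Qed.

Lemma srun_marked b n : (forall u, wlt u b -> nohalt (@istep p) (ihalt p) (s u)) ->
  smarked (iter n sstep (ss b)).
Proof.
move=> nh; apply: smarked_iter; have [h _] := srun_sim nh.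
case: (classic (exists v, wlt v b)) => nb; first by rewrite h //; apply: smarked_stape.
have mb v : ~ wlt v b by move=> vb; apply: nb; exists v.
by case: (runs b) => /(_ mb) -> _; apply: smarked_init.
Qed.

End Run.
End Sentinel.

(** * Unfolding the input onto five tracks *)

(* [XFlick], [XScan], [XShift] insert one column header; the remaining states write the
   output back: [XLeft] returns to the left end, [XInit] clears column 0, [XFind] looks for
   the next column, [XErase] clears it keeping its output bit, [XBack] carries that bit to
   the cell marked as the next output cell, and [XSkip] passes over the new mark. *)
Inductive xst :=
  | XMode of mode | XFlick | XScan of bool & 'I_5 | XShift of bool & bool & bool & bool
  | XLeft of 'I_5 | XInit of 'I_5 | XErase of 'I_5 & bool | XBack of bool | XSkip | XFind.

Definition xcode : finType := ((mode + 'I_3) + (bool * 'I_5 + bool * bool * bool * bool) +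
  ('I_5 + 'I_5) + ('I_5 * bool + bool))%type.
Definition xst_enc (x : xst) : xcode :=
  match x with
  | XMode m => inl (inl (inl (inl m))) | XFlick => inl (inl (inl (inr (inord 0))))
  | XSkip => inl (inl (inl (inr (inord 1)))) | XFind => inl (inl (inl (inr (inord 2))))
  | XScan f t => inl (inl (inr (inl (f, t)))) | XShift x y z w => inl (inl (inr (inr (x, y, z, w))))
  | XLeft t => inl (inr (inl t)) | XInit t => inl (inr (inr t))
  | XErase t o => inr (inl (t, o)) | XBack o => inr (inr o)
  end.
Definition xst_dec (x : xcode) : xst :=
  match x with
  | inl (inl (inl (inl m))) => XMode m
  | inl (inl (inl (inr i))) => match nat_of_ord i with 0 => XFlick | 1 => XSkip | _ => XFind end
  | inl (inl (inr (inl (f, t)))) => XScan f t | inl (inl (inr (inr (x, y, z, w)))) => XShift x y z w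
  | inl (inr (inl t)) => XLeft t | inl (inr (inr t)) => XInit t
  | inr (inl (t, o)) => XErase t o | inr (inr o) => XBack o
  end.
Lemma xst_encK : cancel xst_enc xst_dec.
Proof. by case=> //=; rewrite inordK. Qed.
HB.instance Definition _ := Finite.copy xst (can_type xst_encK).

Definition itape (g : nat -> bool) (x : option nat) := g (cellIdx x).

Lemma itape_at g c : itape g (cellAt c) = g c. Proof. by rewrite /itape cellAtK. Qed.

Lemma ostep_itape (q : ottm) s c g s' w1 w2 mv g' :
  odelta s (g c, g c.+1) = (s', (w1, w2), mv) -> w1 = g' c -> w2 = g' c.+1 ->
  (forall j, j != c -> j != c.+1 -> g' j = g j) ->
  ostep (Config s c (itape g)) = Config s' (if mv then c.+1 else c.-1) (itape g') :> oconfig q.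
Proof.
move=> e e1 e2 h; rewrite /ostep /= -/(cellAt c.+1) !itape_at e; apply: config_eq => //= x.
have eqc d : (x == cellAt d) = (cellIdx x == d).
  by apply/eqP/eqP => [->|<-]; rewrite ?cellAtK ?cellIdxK.
rewrite -/(cellAt c.+1) !eqc /itape; case: eqP => [-> //|/eqP n1]; case: eqP => [-> //|/eqP n2].
by rewrite h.
Qed.

Section Unfolder.
Variable p : ittm.
Local Notation ust := (trst 3 (ist p) + xst)%type.

(** At a limit, pad on means that the output is written; pad off and cell 0 on, that [p] is to be
    started or continued; both off, that another unfolding pass is due. [XScan] looks for a frontier
    bit on track 2, and [XShift] is a queue of four bits through which the rest of the tape is
    shifted. *)
Definition udelta (x : ust) (b : bool * bool) : ust * (bool * bool) * bool :=
  let: (l, r) := b in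
  let left0 : ust * (bool * bool) * bool :=
    if l then (inr (XLeft (inord 4)), b, false) else (inr (XInit (inord 1)), (true, r), true) in
  match x with
  | inl c => if c == Rd0 3 (ihalt p) then left0 else
             let: (c', w, mv) := trdelta (@sdelta p) c b in (inl c', w, mv)
  | inr (XMode MStart) => (inr (XShift false true false l), (false, r), true)
  | inr (XMode MLim) => if l then (inr (XMode MHalt), b, false)
                        else if r then (inl (Rd0 3 (ilim p)), b, false)
                        else (inr XFlick, (l, true), false)
  | inr (XMode MHalt) => (x, b, false)
  | inr XFlick => (inr (XScan false (inord 1)), (l, false), true)
  | inr (XScan found t) =>
      if (t == 2 :> nat) && ~~ found && l then (inr (XScan true (inord 3)), (false, r), true)
      else (inr (if t == 4 :> nat then if found then XShift true false true false else XScan false (inord 0)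
                 else XScan found (inord t.+1)), b, true)
  | inr (XShift w x y z) => (inr (XShift x y z l), (w, r), true)
  | inr (XLeft t) => if t == 0 :> nat then left0 else (inr (XLeft (inord t.-1)), b, false)
  | inr (XInit t) => (inr (if t == 4 :> nat then XFind else XInit (inord t.+1)),
                      (if t == 1 :> nat then l else false, r), true)
  | inr XFind => if l then (inr (XErase (inord 1) false), (false, r), true) else (inr XFind, b, true)
  | inr (XErase t o) =>
      let o' := if t == 3 :> nat then l else o in
      (inr (if t == 4 :> nat then XBack o' else XErase (inord t.+1) o'), (false, r), t != 4 :> nat)
  | inr (XBack o) => if l then (inr XSkip, (o, true), true) else (inr (XBack o), b, false)
  | inr XSkip => (inr XFind, b, true)
  end.

Definition unfolder : ottm.
Proof.
refine (@Build_ottm ust (inr (XMode MStart)) (inr (XMode MHalt)) (inr (XMode MLim)) _ udelta).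
by split; apply/eqP.
Defined.

Local Notation U x := (inr x : ost unfolder).
Local Notation ustep := (@ostep unfolder).
Local Notation uhalt := (ohalt unfolder).

Variable a : real.
Definition raw c := if c is c'.+1 then a c' else false.

(** The tape at the beginning of block [m]: [m] columns are spread out, the rest follows displaced
    by [4 * m], and track 2 marks the last finished column. Column 0 receives the blank pad, as in
    [sinit]; its track 1, on in [sinit], is still off here and is supplied by the flicker. *)
Definition exptape m c :=
  if c < 5 * m then
    match c %% 5 with 0 => c %/ 5 != 0 | 2 => (c %/ 5).+1 == m | 4 => raw (c %/ 5) | _ => false end
  else raw (c - 4 * m).

Section Shift.
Variables (g : nat -> bool) (c0 : nat) (w : nat -> bool).

(** The bits leaving the queue: its initial content, then the old tape four cells late. *)
Definition stream j := if j < 4 then w j else g (c0 + (j - 4)).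

Definition shifted i j := if (c0 <= j) && (j < c0 + i) then stream (j - c0) else g j.

Lemma shift_iter i :
  iter i ustep (Config (U (XShift (w 0) (w 1) (w 2) (w 3))) c0 (itape g)) =
  Config (U (XShift (stream i) (stream i.+1) (stream i.+2) (stream i.+3))) (c0 + i) (itape (shifted i)).
Proof.
elim: i => [|i IH].
  rewrite addn0 /=; congr Config; apply: functional_extensionality => x; rewrite /itape /shifted addn0.
  by case: leqP => //= h; rewrite ltnNge h.
rewrite iterS IH addnS (@ostep_itape unfolder _ _ _ (U (XShift (stream i.+1) (stream i.+2) (stream i.+3) (stream i.+4)))
   (stream i) (shifted i (c0 + i).+1) true (shifted i.+1)) //=.
- by congr (_, _, _); congr inr; congr XShift; rewrite /shifted ltnn andbF /stream /= addnC; congr g; lia.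
- by rewrite /shifted leq_addr ltn_add2l ltnSn addKn.
- by rewrite /shifted; do 2!case: ifP => //; lia.
- by move=> j /eqP n1 /eqP n2; rewrite /shifted; do 2!case: ifP => //; lia.
Qed.

Lemma shift_late i j : j < c0 + i -> shifted i j = if j < c0 then g j else stream (j - c0).
Proof. by move=> h; rewrite /shifted h andbT leqNgt; case: ltnP. Qed.
End Shift.

Lemma exp_init : oinit unfolder a = Config (U (XMode MStart)) 0 (itape (exptape 0)).
Proof. by apply: config_eq => //= -[n|]; rewrite /itape /exptape. Qed.

Lemma exp_first i : iter i.+1 ustep (oinit unfolder a) =
  iter i.+1 ustep (Config (U (XShift false false true false)) 0 (itape (exptape 0))).
Proof.
by rewrite !iterSr exp_init.
Qed.

Definition header b j := match j with 0 => b | 2 => true | _ => false end.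

Lemma stream_exp m g j : (forall c, 5 * m <= c -> g c = raw (c - 4 * m)) ->
  stream g (5 * m) (header (m != 0)) j = exptape m.+1 (5 * m + j).
Proof.
move=> hg; rewrite /stream /exptape; case: ltnP => h4.
  rewrite (_ : _ < _ = true); last by lia.
  rewrite mulnC modnMDl divnMDl // modn_small ?divn_small; try lia.
  by rewrite addn0 eqxx; case: j h4 => [|[|[|[|]]]].
rewrite hg; last by lia.
case: ltnP => h.
  have -> : j = 4 by lia.
  by rewrite mulnC modnMDl divnMDl //= addn0; congr raw; lia.
by congr raw; lia.
Qed.

(* Pass [m.+1] clears the frontier bit of column [m] before inserting column [m.+1]. *)
Definition cleared m c := (c != 5 * m + 2) && exptape m.+1 c.

Lemma exptape_clear m c : c < 5 * m.+1 -> cleared m c = exptape m.+2 c.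
Proof.
move=> h; rewrite /cleared /exptape h (_ : c < 5 * m.+2); last by lia.
have e := divn_eq c 5; have lt := ltn_pmod c (isT : 0 < 5); move: (c %/ 5) (c %% 5) e lt => h' t e lt.
case: t e lt => [|[|[|[|[|]]]]] // e _; rewrite ?andbF //; try by rewrite (_ : c != _) //; lia.
by rewrite eqSS; lia.
Qed.

Lemma exp_scan m i : i <= 5 * m + 1 ->
  iter i ustep (Config (U (XScan false (inord 1))) 1 (itape (exptape m.+1))) =
  Config (U (XScan false (inord (i.+1 %% 5)))) i.+1 (itape (exptape m.+1)).
Proof.
elim: i => [_|i IH h]; first by [].
rewrite iterS IH ?(ltnW h) // (@ostep_itape unfolder _ _ _ (U (XScan false (inord (i.+2 %% 5))))
  (exptape m.+1 i.+1) (exptape m.+1 i.+2) true (exptape m.+1)) //=.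
have lt := ltn_pmod i.+1 (isT : 0 < 5); rewrite inordK // andbT.
have e := divn_eq i.+1 5.
have -> : (i.+1 %% 5 == 2) && exptape m.+1 i.+1 = false.
  apply/negP => /andP [/eqP e2]; rewrite /exptape e2 (_ : _ < _ = true); last by lia.
  by rewrite eqSS; lia.
have e' : i.+2 %% 5 = (if i.+1 %% 5 == 4 then 0 else (i.+1 %% 5).+1).
  by case: ifP; lia.
by rewrite e'; case: ifP.
Qed.

Lemma exp_find m : let x := Config (U (XScan false (inord 2))) (5 * m + 2) (itape (exptape m.+1)) in
  [/\ iter 1 ustep x = Config (U (XScan true (inord 3))) (5 * m + 3) (itape (cleared m)),
      iter 2 ustep x = Config (U (XScan true (inord 4))) (5 * m + 4) (itape (cleared m)) &
      iter 3 ustep x = Config (U (XShift true false true false)) (5 * m.+1) (itape (cleared m))].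
Proof.
move=> x; have front : exptape m.+1 (5 * m + 2) = true.
  rewrite /exptape (_ : _ < _ = true); last by lia.
  by rewrite mulnC modnMDl divnMDl //= addn0 eqxx.
have e1 : iter 1 ustep x = Config (U (XScan true (inord 3))) (5 * m + 3) (itape (cleared m)).
  rewrite iterS (@ostep_itape unfolder _ _ _ (U (XScan true (inord 3))) false
    (exptape m.+1 (5 * m + 2).+1) true (cleared m)) -?addnS //=.
  - by rewrite inordK //= front.
  - by rewrite /cleared eqxx.
  - by rewrite /cleared; case: eqP => //; lia.
  - by move=> j n1 _; rewrite /cleared n1.
have e2 : iter 2 ustep x = Config (U (XScan true (inord 4))) (5 * m + 4) (itape (cleared m)).
  rewrite iterS e1 (@ostep_itape unfolder _ _ _ (U (XScan true (inord 4))) (cleared m (5 * m + 3))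
    (cleared m (5 * m + 3).+1) true (cleared m)) -?addnS //=.
  by rewrite inordK.
split=> //; rewrite iterS e2 (@ostep_itape unfolder _ _ _ (U (XShift true false true false)) (cleared m (5 * m + 4))
    (cleared m (5 * m + 4).+1) true (cleared m)) //=; last by rewrite inordK.
by congr Config; lia.
Qed.

Definition flicked m c := (c == 1) || exptape m.+1 c.

Lemma exp_flick m : let x := Config (U (XMode MLim)) 0 (itape (exptape m.+1)) in
  iter 1 ustep x = Config (U XFlick) 0 (itape (flicked m)) /\
  iter 2 ustep x = Config (U (XScan false (inord 1))) 1 (itape (exptape m.+1)).
Proof.
move=> x.
have e0 : exptape m.+1 0 = false by rewrite /exptape; case: ltnP => // ?; lia.
have e1 : exptape m.+1 1 = false by rewrite /exptape; case: ltnP => // ?; lia.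
have h1 : iter 1 ustep x = Config (U XFlick) 0 (itape (flicked m)).
  rewrite iterS (@ostep_itape unfolder _ _ _ (U XFlick) (exptape m.+1 0) true false (flicked m)) //=.
    by rewrite e0 e1.
  by move=> j _ /negbTE n; rewrite /flicked n.
split=> //; rewrite iterS h1 (@ostep_itape unfolder _ _ _ (U (XScan false (inord 1))) (flicked m 0)
  false true (exptape m.+1)) //=.
by move=> j _ /negbTE n; rewrite /flicked n.
Qed.

Lemma exp_pass m i : let x := Config (U (XMode MLim)) 0 (itape (exptape m.+1)) in
  cstate (iter i ustep x) <> uhalt /\
  (forall c, c < 5 * m -> c != 1 -> ctape (iter i ustep x) (cellAt c) = exptape m.+1 c).
Proof.
move=> x; have [h1 h2] := exp_flick m; rewrite -/x in h1 h2.
have sc j : j <= 5 * m + 1 -> iter (j + 2) ustep x =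
    Config (U (XScan false (inord (j.+1 %% 5)))) j.+1 (itape (exptape m.+1)).
  by move=> h; rewrite iterD h2 exp_scan.
have [f1 f2 f3] := exp_find m.
have e0 : iter (5 * m + 1 + 2) ustep x = Config (U (XScan false (inord 2))) (5 * m + 2) (itape (exptape m.+1)).
  rewrite sc // -addnS; congr Config; congr inr; congr XScan; congr inord.
  by rewrite mulnC modnMDl.
rewrite -e0 -!iterD in f1 f2 f3.
have cl c : c < 5 * m -> cleared m c = exptape m.+1 c.
  by move=> h; rewrite /cleared (_ : c != _) //; lia.
case: i => [|[|i]]; first by split=> //= c _ _; rewrite itape_at.
  by rewrite h1; split=> //= c _ /negbTE n; rewrite itape_at /flicked n.
rewrite -addn2; case: (leqP i (5 * m + 1)) => [le|gt].
  by rewrite sc //; split=> //= c _ _; rewrite itape_at.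
case: (leqP (3 + (5 * m + 1 + 2)) (i + 2)) => [le|lt].
  rewrite -(subnK le) iterD f3.
  rewrite (@shift_iter (cleared m) (5 * m.+1) (header true)); split=> //= c cm c1.
  rewrite itape_at /shifted (_ : _ <= c = false) /=; last by lia.
  exact: cl.
have {lt} [->|->] : i + 2 = 1 + (5 * m + 1 + 2) \/ i + 2 = 2 + (5 * m + 1 + 2) by lia.
  by rewrite f1; split=> //= c cm _; rewrite itape_at cl.
by rewrite f2; split=> //= c cm _; rewrite itape_at cl.
Qed.

Lemma exp_shift m : exists t, forall i, iter (i + t) ustep (Config (U (XMode MLim)) 0 (itape (exptape m.+1))) =
  iter i ustep (Config (U (XShift true false true false)) (5 * m.+1) (itape (cleared m))).
Proof.
set x := Config _ _ _; have [_ h2] := exp_flick m; have [_ _ f3] := exp_find m.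
exists (3 + (5 * m + 1 + 2)) => i; rewrite -f3 (iterD i) (iterD 3) (iterD (5 * m + 1) 2) h2 exp_scan //.
have -> : (5 * m + 1).+1 = 5 * m + 2 by lia.
by have -> : (5 * m + 2) %% 5 = 2 by rewrite mulnC modnMDl.
Qed.

Variables (B : WO) (s : B -> oconfig unfolder) (b0 : B).
Hypothesis run : brun (oinit unfolder a) ustep (olim unfolder) s.
Hypothesis min0 : forall v, ~ wlt v b0.

Lemma shift_lim x t g c0 w (g' : nat -> bool) c :
  (forall i, 0 < i -> iter (i + t) ustep x = iter i ustep (Config (U (XShift (w 0) (w 1) (w 2) (w 3))) c0 (itape g))) ->
  (forall j, (if j < c0 then g j else stream g c0 w (j - c0)) = g' j) ->
  infi (fun n => ctape (iter n ustep x) c) <-> itape g' c.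
Proof.
move=> hx hg; have late n : cellIdx c + t < n -> ctape (iter n ustep x) c = itape g' c.
  move=> h; rewrite -(subnK (_ : t <= n)); last by lia.
  rewrite hx; last by lia.
  by rewrite shift_iter /= /itape shift_late ?hg //; lia.
split=> [/(_ (cellIdx c + t).+1) [n [h]]|h N]; first by rewrite late.
by exists (maxn N (cellIdx c + t).+1); rewrite leq_maxl late // leq_maxr.
Qed.

Lemma exp_run m b : nth_succ b0 m b ->
  s b = Config (U (XMode (if m is 0 then MStart else MLim))) 0 (itape (exptape m)).
Proof.
elim: m b => [|m IH] b /=.
  by move=> ->; case: (run b0) => /(_ min0) -> _; apply: exp_init.
move=> [v /IH ev iv]; apply: (brun_tape run); first by exists v; case: iv.
move=> c; apply: (iff_trans (limval_imm _ iv)); rewrite ev.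
case: m ev {IH} => [|m] ev.
  apply: (@shift_lim _ 0 (exptape 0) 0 (header false)) => [[|i] // _|j].
    by rewrite addn0 -exp_first exp_init.
  by rewrite subn0 (@stream_exp 0) // => d _; rewrite /exptape.
have [t ht] := exp_shift m.
apply: (@shift_lim _ t (cleared m) (5 * m.+1) (header true)) => [i _|j]; first exact: ht.
case: ltnP => h; first exact: exptape_clear.
rewrite (@stream_exp m.+1) ?subnKC // => d hd; rewrite /cleared /exptape.
rewrite (_ : d != _); last by lia.
by rewrite (_ : _ < _ = false) //; lia.
Qed.

Lemma exp_nohalt m b : nth_succ b0 m b -> nohalt ustep uhalt (s b).
Proof.
move/exp_run => -> i; case: m => [|m]; last by case: (exp_pass m i).
case: i => // i.
by rewrite -exp_init exp_first (@shift_iter (exptape 0) 0 (header false)).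
Qed.

Lemma nth_succ_mono m m' b b' : nth_succ b0 m b -> nth_succ b0 m' b' -> m < m' -> wlt b b'.
Proof.
elim: m' b' => // m' IH b' h /= [v hv [vb' _]]; rewrite ltnS leq_eqVlt => /orP [/eqP e|lt].
  by subst m'; rewrite (nth_succ_uniq h hv).
exact: wlt_trans (IH v h hv lt) vb'.
Qed.

Lemma venc_init c : venc (ctape (sinit p a)) (cellAt c) =
  match c %% 5 with 0 => c %/ 5 != 0 | 1 => c %/ 5 == 0 | 4 => raw (c %/ 5) | _ => false end.
Proof. by rewrite /venc cellAtK /= inordK ?ltn_pmod. Qed.

(** Cell 1 (counting the pad as 0) is on once in every pass, hence on at this limit of passes though
    off at the end of each. Any other cell [c] no longer changes from block [c.+2] on, as the
    frontier has passed it. *)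
Lemma exp_done b : (forall v, wlt v b -> exists m, nth_succ b0 m v) ->
  (forall m, exists2 v, wlt v b & nth_succ b0 m v) ->
  s b = Config (U (XMode MLim)) 0 (venc (ctape (sinit p a))).
Proof.
move=> below all_m; apply: (brun_tape run); first by case: (all_m 0) => v; exists v.
move=> x; have [c ->] : exists c, x = cellAt c by exists (cellIdx x); rewrite cellIdxK.
rewrite venc_init; case: (c =P 1) => [->|/eqP c1].
  split=> //= _ v n vb; case: (below v vb) => m hm; case: (all_m m.+1) => u ub hu.
  exists u, 1; split; first by right; apply: nth_succ_mono hm hu _.
  split=> //; rewrite (exp_run hu); case: (exp_flick m) => -> _.
  by rewrite /= /itape /flicked.
case: (all_m c.+2) => v vb hv; apply: (limval_eventually (n := 0) vb) => u n t ub.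
case: (below u ub) => m hm.
have [m' em] : exists m', m = c.+2 + m'.
  exists (m - c.+2); rewrite subnKC // leqNgt; apply/negP => lt.
  have := nth_succ_mono hm hv lt; case: t => [[<- _]|vu]; first exact: wlt_irr.
  exact: wlt_asym vu.
subst m; rewrite (exp_run hm); case: (exp_pass (c.+1 + m') n) => _ ->//; last by lia.
rewrite /exptape (_ : _ < _ = true); last by lia.
have := divn_eq c 5; case: (c %% 5) => [|[|[|]]] // e; last by lia.
by case: (c %/ 5) e => // e; rewrite e in c1.
Qed.

End Unfolder.

(** * Writing the output back *)

Section Contract.
Variable p : ittm.
Local Notation unf := (unfolder p).
Local Notation U x := (inr x : ost unf).
Local Notation ustep := (@ostep unf).
Local Notation uhalt := (ohalt unf).

Variable t : tape3 * nat -> bool.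
Let out n := t (Out, n).
Let g0 c := stape t (inord (c %% 5), c %/ 5).

Lemma g0_at h i : i < 5 -> g0 (5 * h + i) = stape t (inord i, h).
Proof. by move=> h5; rewrite /g0 mulnC modnMDl divnMDl // modn_small // divn_small // addn0. Qed.

Lemma g0_mark h : g0 (5 * h) = (h != 0).
Proof. by have := @g0_at h 0 isT; rewrite addn0 stapeE. Qed.

(** The tape when [h.-1] output bits are written: the pad is on and cell [h] marks the next place.
    All cells from there to [5 * h] are blank, so the first 1 met going left is the mark, and the
    first 1 going right is the header of column [h]. *)
Definition ctr h c :=
  if c == 0 then true else if c < h then out c.-1 else if c == h then true
  else if c < 5 * h then false else g0 c.

Lemma uid s c g s' mv : odelta s (g c, g c.+1) = (s', (g c, g c.+1), mv) ->
  ostep (Config s c (itape g)) = Config s' (if mv then c.+1 else c.-1) (itape g) :> oconfig unf.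
Proof. by move=> h; rewrite (ostep_itape h (g' := g)). Qed.

Lemma uleft s c g s' w mv g' : odelta s (g c, g c.+1) = (s', (w, g c.+1), mv) -> w = g' c ->
  (forall j, j != c -> g' j = g j) ->
  ostep (Config s c (itape g)) = Config s' (if mv then c.+1 else c.-1) (itape g') :> oconfig unf.
Proof.
move=> h e hg; apply: (ostep_itape h) => //; last by move=> j n _; apply: hg.
by rewrite hg //; lia.
Qed.

Let NH (z : oconfig unf) := cstate z <> uhalt.
Let g1 c := (c == 0) || g0 c.

Lemma left_walk H st : (forall l r, odelta st (l, r) =
    if l then (U (XLeft (inord 4)), (l, r), false) else (U (XInit (inord 1)), (true, r), true)) ->
  st <> uhalt -> spath ustep NH (Config st (5 * H) (itape g0)) (Config (U (XInit (inord 1))) 1 (itape g1)).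
Proof.
elim: H st => [|H IH] st hst nst.
  have <- : ustep (Config st (5 * 0) (itape g0)) = Config (U (XInit (inord 1))) 1 (itape g1).
    rewrite (@uleft _ _ _ (U (XInit (inord 1))) true true g1) //; first by rewrite hst g0_mark.
    by move=> j /negbTE n; rewrite /g1 n.
  exact: spath1.
apply: spath_cons => //.
rewrite (@uid _ _ _ (U (XLeft (inord 4))) false); last by rewrite hst g0_mark.
have e c i : i < 4 -> ustep (Config (U (XLeft (inord i.+1))) c (itape g0)) =
    Config (U (XLeft (inord i))) c.-1 (itape g0).
  move=> i4; rewrite (@uid _ _ _ (U (XLeft (inord i))) false) //=.
  by rewrite inordK.
do 4!(apply: spath_cons => //; rewrite e //).
have -> : (5 * H.+1).-1.-1.-1.-1.-1 = 5 * H by lia.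
apply: IH => // l r /=.
by rewrite inordK.
Qed.

Lemma init_walk : spath ustep NH (Config (U (XInit (inord 1))) 1 (itape g1)) (Config (U XFind) 5 (itape (ctr 1))).
Proof.
(* The mark for the first output cell is already present: it is track 1 of column 0. *)
have m1 : g0 1 = true by have := @g0_at 0 1 isT; rewrite stapeE.
pose gi i c := if (1 < c) && (c < i) then false else g1 c.
have e1 : ustep (Config (U (XInit (inord 1))) 1 (itape g1)) = Config (U (XInit (inord 2))) 2 (itape (gi 2)).
  rewrite (@uleft _ _ _ (U (XInit (inord 2))) (g1 1) true (gi 2)) //=; first by rewrite inordK.
  by move=> j n; rewrite /gi; case: ifP => // ?; exfalso; lia.
have e i : 1 < i -> i < 5 -> ustep (Config (U (XInit (inord i))) i (itape (gi i))) =
    Config (U (if i == 4 then XFind else XInit (inord i.+1))) i.+1 (itape (gi i.+1)).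
  move=> i1 i5; rewrite (@uleft _ _ _ (U (if i == 4 then XFind else XInit (inord i.+1))) false true (gi i.+1)) //=.
  - by rewrite inordK // (_ : (i == 1) = false) //; lia.
  - by rewrite /gi i1 ltnSn.
  - by move=> j n; rewrite /gi; do 2!case: ifP => // ?; exfalso; lia.
apply: spath_cons => //; rewrite e1.
do 2!(apply: spath_cons => //; rewrite e //=).
have <- : ustep (Config (U (XInit (inord 4))) 4 (itape (gi 4))) = Config (U XFind) 5 (itape (ctr 1)).
  rewrite e //=; congr Config; apply: functional_extensionality => x; rewrite /itape; move: (cellIdx x) => c.
  by rewrite /gi /ctr /g1; case: c => [|[|c]].
exact: spath1.
Qed.

Let E h : oconfig unf := Config (U XFind) (5 * h) (itape (ctr h)).

Lemma contract_step h : 0 < h -> spath ustep (between uhalt (itape (ctr h)) (itape (ctr h.+1))) (E h) (E h.+1).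
Proof.
move=> h0; set V := between _ _ _.
pose er j c := if c == 0 then true else if c < h then out c.-1 else if c == h then true
  else if c < 5 * h + j then false else g0 c.
have er0 : ctr h = er 0 by apply: functional_extensionality => c; rewrite /ctr /er addn0.
have Ver s c j : j <= 5 -> V (Config (U s) c (itape (er j))) \/ s = XMode MHalt.
  move=> j5; case: (classic (s = XMode MHalt)) => ns; [by right|left; split; first by case].
  move=> x; rewrite /itape /=; move: (cellIdx x) => {}c; rewrite /er /ctr.
  case: (c =P 0) => [|c0]; first by left.
  case: (ltnP c h) => c1; first by left.
  case: (c =P h) => c2; first by left.
  case: (ltnP c (5 * h)) => c3; first by left; rewrite (_ : c < _) //; lia.
  case: (ltnP c (5 * h + j)) => c4; last by left.
  right; rewrite (_ : c < h.+1 = false); last by lia.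
  have -> : (c == h.+1) = false by lia.
  by have -> : c < 5 * h.+1 by lia.
have Vend s c : s <> XMode MHalt -> V (Config (U s) c (itape (ctr h.+1))).
  by move=> ns; split=> [[]|]; [|right].
have Vok s c j : j <= 5 -> s <> XMode MHalt -> V (Config (U s) c (itape (er j))).
  by move=> j5 ns; case: (Ver s c j j5).
have big j : er j (5 * h + j) = g0 (5 * h + j).
  rewrite /er ltnn; have -> : (5 * h + j == 0) = false by lia.
  have -> : 5 * h + j < h = false by lia.
  by have -> : (5 * h + j == h) = false by lia.
have zero j c : h < c -> c < 5 * h + j -> er j c = false.
  move=> c1 c2; rewrite /er c2; have -> : (c == 0) = false by lia.
  have -> : c < h = false by lia.
  by have -> : (c == h) = false by lia.
have erS j : (forall i, i != 5 * h + j -> er j.+1 i = er j i) /\ false = er j.+1 (5 * h + j).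
  split; last by rewrite zero //; lia.
  by move=> i n; rewrite /er; do 3!case: ifP => //; move=> *; congr (if _ then _ else _); lia.
have s0 : ustep (E h) = Config (U (XErase (inord 1) false)) (5 * h + 1) (itape (er 1)).
  rewrite /E er0 -[X in Config _ X _](addn0 (5 * h)); have [n1 n2] := erS 0.
  rewrite (@uleft _ _ _ (U (XErase (inord 1) false)) false true (er 1)) ?addn1 ?addn0 //.
    by rewrite -[X in er 0 X]addn0 big addn0 g0_mark -lt0n h0.
  - by rewrite -[5 * h]addn0.
  - by move=> j; rewrite -[5 * h]addn0; apply: n1.
have sE j o : 0 < j -> j < 4 -> ustep (Config (U (XErase (inord j) o)) (5 * h + j) (itape (er j))) =
    Config (U (XErase (inord j.+1) (if j == 3 then out h.-1 else o))) (5 * h + j.+1) (itape (er j.+1)).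
  move=> j0 j4; case: (erS j) => n1 n2; rewrite addnS.
  rewrite (@uleft _ _ _ (U (XErase (inord j.+1) (if j == 3 then out h.-1 else o))) false true (er j.+1)) //=.
  rewrite inordK; last by lia.
  rewrite big (_ : j == 4 = false) /=; last by lia.
  case: eqP => // ->; rewrite g0_at // stapeE.
  by case: (h) h0.
have s4 o : ustep (Config (U (XErase (inord 4) o)) (5 * h + 4) (itape (er 4))) =
    Config (U (XBack o)) (5 * h + 3) (itape (er 5)).
  case: (erS 4) => n1 n2.
  rewrite (@uleft _ _ _ (U (XBack o)) false false (er 5)) //=; first by rewrite addnS.
  by rewrite inordK.
have back o k : k <= 4 * h + 3 -> rpath ustep V (Config (U (XBack o)) (5 * h + 3) (itape (er 5)))
    (Config (U (XBack o)) (5 * h + 3 - k) (itape (er 5))).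
  elim: k => [_|k IH lt]; first by rewrite subn0; apply: rpath_refl.
  apply: rpath_trans (IH (ltnW lt)) _.
  have <- : ustep (Config (U (XBack o)) (5 * h + 3 - k) (itape (er 5))) =
      Config (U (XBack o)) (5 * h + 3 - k.+1) (itape (er 5)).
    rewrite (@uid _ _ _ (U (XBack o)) false); first by congr Config; lia.
    by rewrite /= zero //; lia.
  by apply: rpath1; apply: Vok.
have wr : ustep (Config (U (XBack (out h.-1))) h (itape (er 5))) = Config (U XSkip) h.+1 (itape (ctr h.+1)).
  rewrite (@ostep_itape unf _ _ _ (U XSkip) (out h.-1) true true (ctr h.+1)) //=.
  - by rewrite {1}/er eqxx ltnn (_ : h == 0 = false) //; lia.
  - by rewrite /ctr ltnSn (_ : h == 0 = false) //; lia.
  - by rewrite /ctr ltnn eqxx.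
  - move=> j n1 n2; rewrite /ctr /er (negbTE n1) (negbTE n2); case: ifP => // _.
    by rewrite ltnS leq_eqVlt (negbTE n1) /=; case: ifP => // _; congr (if _ then _ else _); lia.
have skip : ustep (Config (U XSkip) h.+1 (itape (ctr h.+1))) = Config (U XFind) h.+2 (itape (ctr h.+1)).
  by rewrite (@uid _ _ _ (U XFind) true).
have find k : h.+2 + k <= 5 * h.+1 -> rpath ustep V (Config (U XFind) h.+2 (itape (ctr h.+1)))
    (Config (U XFind) (h.+2 + k) (itape (ctr h.+1))).
  elim: k => [_|k IH lt]; first by rewrite addn0; apply: rpath_refl.
  apply: rpath_trans (IH _) _; first by lia.
  have <- : ustep (Config (U XFind) (h.+2 + k) (itape (ctr h.+1))) =
      Config (U XFind) (h.+2 + k.+1) (itape (ctr h.+1)).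
    rewrite (@uid _ _ _ (U XFind) true); first by congr Config; lia.
    rewrite /= {1}/ctr; have -> : h.+2 + k < h.+1 = false by lia.
    have -> : (h.+2 + k == h.+1) = false by lia.
    by have -> : h.+2 + k < 5 * h.+1 by lia.
  by apply: rpath1; apply: Vend.
have VE : V (E h) by rewrite /E er0; apply: Vok.
apply: spath_cons => //; rewrite s0.
apply: spath_cons; first exact: Vok.
rewrite sE //=; apply: spath_cons; first exact: Vok.
rewrite sE //=; apply: spath_cons; first exact: Vok.
rewrite sE //=; apply: spath_cons; first exact: Vok.
rewrite s4; apply: (@spath_rpath _ _ _ _ _ (Config (U XSkip) h.+1 (itape (ctr h.+1)))); last first.
  apply: rpath_trans (rpath1 _ (Vend _ _ _)) _ => //; rewrite skip.
  by have := find (4 * h + 3); rewrite /E (_ : h.+2 + (4 * h + 3) = 5 * h.+1); [apply|lia].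
rewrite -wr; have := back (out h.-1) (4 * h + 3) (leqnn _).
rewrite (_ : 5 * h + 3 - (4 * h + 3) = h); last by lia.
case=> [->|pth]; first by apply: spath1; apply: Vok.
by apply: spath_trans pth _; apply: spath1; apply: Vok.
Qed.

(** Each cell has its final value from some [ctr h] on, and the pad stays on. [H] is arbitrary, as
    [p] may halt with its head anywhere. *)
Lemma contract x t0 H : iter t0 ustep x = Config (inl (Rd0 3 (ihalt p)) : ost unf) (H * 5) (venc (stape t)) ->
  (forall t', t' < t0 -> cstate (iter t' ustep x) <> uhalt) ->
  nohalt ustep uhalt x /\ forall c, infi (fun n => ctape (iter n ustep x) c) <-> itape (fun c => if c is c'.+1 then out c' else true) c.
Proof.
move=> e0 h0.
have [k [_ ek hk]] : spath ustep NH (Config (inl (Rd0 3 (ihalt p)) : ost unf) (H * 5) (venc (stape t))) (E 1).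
  apply: spath_trans _ init_walk; rewrite mulnC; apply: left_walk => //= l r.
  by rewrite eqxx.
have R0 : iter (k + t0) ustep x = E 1 by rewrite iterD e0.
have RS n z : z = E n.+1 -> exists z', spath ustep (between uhalt (itape (ctr n.+1)) (itape (ctr n.+2))) z z' /\ z' = E n.+2.
  by move=> ->; exists (E n.+2); split=> //; apply: contract_step.
split.
  apply: (macro_nohalt (R := fun n z => z = E n.+1) (t0 := k + t0) R0 RS) => [n z []//|t' lt].
  case: (ltnP t' t0) => [/h0 //|le]; rewrite -(subnK le) iterD e0; apply: hk; lia.
move=> c; rewrite -(macro_infi (R := fun n z => z = E n.+1) R0 RS (j := c) (f := fun n => itape (ctr n.+1) c)) //.
- have late n : cellIdx c <= n -> itape (ctr n.+1) c = itape (fun c => if c is c'.+1 then out c' else true) c.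
    rewrite /itape /ctr; case: (cellIdx c) => // m le /=.
    by rewrite ltnS le.
  split=> [/(_ (cellIdx c)) [n [le]]|h N]; first by rewrite late.
  by exists (maxn N (cellIdx c)); rewrite leq_maxl late // leq_maxr.
- by move=> n z ->.
- by move=> n z [_]; apply.
Qed.

End Contract.

(** * Unfolding, simulation and writing back in one run *)

Section UnfoldRun.
Variables (p : ittm) (a : real).
Local Notation unf := (unfolder p).
Local Notation U x := (inr x : ost unf).
Local Notation ustep := (@ostep unf).
Local Notation uhalt := (ohalt unf).
Local Notation sstep := (@tstep 3 _ (@sdelta p)).
Variables (B B' : WO) (e : B -> B') (b0 : B').
Hypothesis emono : forall u v, wlt u v -> wlt (e u) (e v).
Hypothesis econv : forall u v x, wlt (e u) x -> wlt x (e v) -> exists w, x = e w.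
Hypothesis min0 : forall v, ~ wlt v b0.
Hypothesis emin : forall b, (forall v, ~ wlt v b) ->
  (forall v, wlt v (e b) -> exists m, nth_succ b0 m v) /\
  (forall m, exists2 v, wlt v (e b) & nth_succ b0 m v).
Variables (s : B -> iconfig p) (su : B' -> oconfig unf).
Hypothesis run : brun (iinit p a) (@istep p) (ilim p) s.
Hypothesis runu : brun (oinit unf a) ustep (olim unf) su.

Let good u := nohalt (@istep p) (ihalt p) (s u) /\ forall v, wlt v u -> nohalt (@istep p) (ihalt p) (s v).

Lemma urun_step z : smarked z -> cstate z <> ihalt p ->
  spath ustep (between uhalt (venc (ctape z)) (venc (ctape (sstep z))))
    (@tenc 3 _ unf inl z) (@tenc 3 _ unf inl (sstep z)).
Proof.
move=> hm nz; apply: (@tenc_step 3 _ (@sdelta p) unf inl (pred1 (ihalt p))).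
- move=> c [l r] hc /=; case: eqP => // ec.
  by case: (hc (ihalt p)); rewrite /= ?eqxx.
- by [].
- by apply/eqP.
- by move=> s' w; apply: sdelta_left.
Qed.

Section Sentinels.
Variable ss : B -> config (ist p) ('I_5 * nat).
Hypothesis runs : brun (sinit p a) sstep (ilim p) ss.

Lemma urun_begin b : (forall u, wlt u b -> nohalt (@istep p) (ihalt p) (s u)) ->
  ((exists v, wlt v b) -> su (e b) = Config (U (XMode MLim)) 0 (venc (ctape (ss b)))) ->
  su (e b) = Config (U (XMode MLim)) 0 (venc (ctape (ss b))) /\
  iter 1 ustep (su (e b)) = @tenc 3 _ unf inl (ss b).
Proof.
move=> nh h.
have eb : su (e b) = Config (U (XMode MLim)) 0 (venc (ctape (ss b))).
  case: (classic (exists v, wlt v b)) => nb; first exact: h.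
  have mb v : ~ wlt v b by move=> vb; apply: nb; exists v.
  case: (runs b) => /(_ mb) -> _; case: (emin mb) => h1 h2.
  exact: (exp_done runu min0 h1 h2).
split=> //; rewrite eb.
have hm := srun_marked run runs 0 nh; rewrite /= in hm.
have hh : chead (ss b) = 0.
  case: (classic (exists v, wlt v b)) => nb; first by case: (runs b) => _ /(_ nb) [].
  have mb v : ~ wlt v b by move=> vb; apply: nb; exists v.
  by case: (runs b) => /(_ mb) -> _.
have e0 := @venc_at 3 (ctape (ss b)) 0 0 isT; have e1 := @venc_at 3 (ctape (ss b)) 0 1 isT.
rewrite mul0n in e0 e1; case: (hm 0) => m0 m1.
rewrite iterS (@ostep_id unf _ _ _ (inl (Rd0 3 (ilim p))) false).
  by rewrite /tenc hh (srun_state runs).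
by rewrite e0 e1 m0 m1.
Qed.

Lemma urun_sim b : (forall u, wlt u b -> nohalt (@istep p) (ihalt p) (s u)) ->
  ((exists v, wlt v b) -> su (e b) = Config (U (XMode MLim)) 0 (venc (ctape (ss b)))) /\
  (forall u, wlt u b -> nohalt ustep uhalt (su (e u))).
Proof.
move=> nh.
have ES u : good u -> forall n, spath ustep (between uhalt (venc (ctape (iter n sstep (ss u))))
    (venc (ctape (iter n.+1 sstep (ss u))))) (@tenc 3 _ unf inl (iter n sstep (ss u)))
    (@tenc 3 _ unf inl (iter n.+1 sstep (ss u))).
  move=> [g1 g2] n; apply: urun_step; first exact: (srun_marked run runs).
  exact: (srun_nohalt run runs g2 g1).
apply: (@simulation _ _ _ _ _ _ _ _ _ _ uhalt _ _ e emono econv _ _ runs runu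
  (fun z => venc (ctape z)) _ good).
- by move=> x; left; eexists => y; rewrite /venc.
- move=> u mu gu; have [eb e1] : _ := @urun_begin u (proj2 gu) (fun h => False_ind _ (let: ex_intro v vb := h in mu v vb)).
  apply: (enc_tracks (E := fun n => @tenc 3 _ unf inl (iter n sstep (ss u))) (t0 := 1)) => //.
    by case=> // _; rewrite /= eb.
  exact: ES.
- move=> u nu gu eu; have [_ e1] : _ := @urun_begin u (proj2 gu) (fun _ => eu); split.
    apply: (enc_tracks (E := fun n => @tenc 3 _ unf inl (iter n sstep (ss u))) (t0 := 1)) => //.
      by case=> // _; rewrite /= eu.
    exact: ES.
  apply: (enc_tracks_ex (halt' := uhalt) (E := fun n => @tenc 3 _ unf inl (iter n sstep (ss u))) (t0 := 1)) => //.
    exact: ES.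
  by case=> // j _; rewrite /= eu.
- by move=> u ub; split; [exact: nh|move=> v vu; apply: nh; apply: wlt_trans ub].
Qed.

Lemma urun_reach b N : (forall u, wlt u b -> nohalt (@istep p) (ihalt p) (s u)) ->
  (forall n, n < N -> cstate (iter n sstep (ss b)) <> ihalt p) ->
  exists t, iter t ustep (su (e b)) = @tenc 3 _ unf inl (iter N sstep (ss b)) /\
    forall t', t' < t -> cstate (iter t' ustep (su (e b))) <> uhalt.
Proof.
move=> nh hN; have [h _] := urun_sim nh; have [eb e1] := urun_begin nh h.
apply: (enc_reach (E := fun n => @tenc 3 _ unf inl (iter n sstep (ss b))) (t0 := 1)) => //.
  by case=> // _; rewrite /= eb.
by move=> n /hN nN; apply: urun_step => //; apply: (srun_marked run runs).
Qed.

Lemma urun_nohalt b : (forall u, wlt u b -> nohalt (@istep p) (ihalt p) (s u)) ->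
  nohalt (@istep p) (ihalt p) (s b) -> nohalt ustep uhalt (su (e b)).
Proof.
move=> nh nb; have [h _] := urun_sim nh; have [eb e1] := urun_begin nh h.
have [] // := @enc_tracks _ _ _ _ sstep ustep uhalt (fun z => venc (ctape z))
  (fun n => @tenc 3 _ unf inl (iter n sstep (ss b))) (ss b) _ 1 e1.
  by case=> // _; rewrite /= eb.
move=> n; apply: urun_step; first exact: (srun_marked run runs).
exact: (srun_nohalt run runs nh nb).
Qed.

(** Writing back fills the rest of the block in which [p] halts, so the answer stands on the tape at
    the next limit. *)
Lemma urun_halts b n b1 : (forall u, wlt u b -> nohalt (@istep p) (ihalt p) (s u)) ->
  (forall m, m < n.+1 -> cstate (iter m (@istep p) (s b)) <> ihalt p) ->
  cstate (iter n.+1 (@istep p) (s b)) = ihalt p -> imm (e b) b1 ->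
  nohalt ustep uhalt (su (e b)) /\
  su b1 = Config (U (XMode MLim)) 0
    (itape (fun c => if c is c'.+1 then ctape (iter n.+1 (@istep p) (s b)) (Out, c') else true)).
Proof.
move=> nh hm hn ib; have [t [t1 t2 t3]] := srun_reach run runs nh hm.
have [t' [e1 e2]] := urun_reach nh t3.
have [] := @contract p (ctape (iter n.+1 (@istep p) (s b))) (su (e b)) t' (chead (iter t sstep (ss b))) _ e2.
  by rewrite e1 /tenc t1 t2 hn.
move=> h1 h2; split=> //; apply: (brun_tape runu); first by exists (e b); case: ib.
by move=> c; apply: (iff_trans (limval_imm _ ib)).
Qed.

End Sentinels.
End UnfoldRun.

(** In the undefined case a halting run of the unfolder is given. Its first omega blocks contain no
    halt; the others form a block order for [p], on which [p] never halts, so neither does the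
    simulation. *)
Theorem ittm_to_ottm_computes (p : ittm) (f : real -> option real) :
  ittm_computes p f -> ottm_computes (unfolder p) f.
Proof.
move=> comp a; move: (comp a); case: (f a) => [b|no].
  move=> [W [top [c [h hout]]]]; have [B [s [b1 [n [[r hs nh hm] en _]]]]] := halts_blocks h.
  case: n hs hm en => [|n] hs hm en.
    case: (classic (exists v, wlt v b1)) => nb.
      by case: (r b1) => _ /(_ nb) [e _ _]; case: (idistinct p) => _; rewrite -hs -e eqxx.
    case: (r b1) => h1 _; move: hs; rewrite /= h1; last by move=> v vb; apply: nb; exists v.
    by move=> /= e; case: (idistinct p); rewrite e eqxx.
  (* Omega unfolding blocks, the blocks of [p], and one more so that there is a limit after writing
     back. *)
  pose B' := WOsum WOnat (WOsum B WOunit); pose e (x : B) : B' := inr (inl x).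
  pose b0 : B' := inl (0 : WOnat).
  have [su ru] := brun_exists (oinit (unfolder p) a) (@ostep (unfolder p)) (olim (unfolder p)) B'.
  have [ss rs] := brun_exists (sinit p a) (@tstep 3 _ (@sdelta p)) (ilim p) B.
  have emono (u v : B) : wlt u v -> wlt (e u) (e v) by [].
  have econv (u v : B) (x : B') : wlt (e u) x -> wlt x (e v) -> exists w, x = e w.
    by case: x => [x|[w|x]] //; exists w.
  have nthE m : nth_succ b0 m (inl (m : WOnat) : B').
    elim: m => //= m IH; exists (inl (m : WOnat)) => //; split; first exact: ltnSn.
    by case=> [x [/= h1 h2]|x [_ []]]; lia.
  have min0 (v : B') : ~ wlt v b0 by case: v => [v|v] /=.
  have emin (x : B) : (forall v, ~ wlt v x) ->
      (forall v, wlt v (e x) -> exists m, nth_succ b0 m v) /\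
      (forall m, exists2 v, wlt v (e x) & nth_succ b0 m v).
    move=> mx; split=> [[m _|[w /mx []|u []]]|m]; first by exists m.
    by exists (inl (m : WOnat)).
  have [b2 ib] := @imm_exists B' (e b1) (ex_intro _ (inr (inr tt) : B') I).
  have [h1 h2] := urun_halts emono econv min0 emin r ru rs nh hm hs ib.
  (* One step after that limit: the limit state sees the pad on and passes to the halt state. *)
  have bh : bhalts (oinit (unfolder p) a) (@ostep (unfolder p)) (olim (unfolder p)) (ohalt (unfolder p)) su b2 1.
    split=> //.
    - by rewrite h2.
    - move=> u ub2; case: (wlt_total u (e b1)) => [ue|[->//|eu]]; last by case: (proj2 ib u).
      case: u ub2 ue => [m|[w|w]] ub2 ue //.
        by apply: (exp_nohalt ru min0 (nthE m)).
      by case: (urun_sim emono econv min0 emin r ru rs nh) => _; apply.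
    - by case=> // _; rewrite h2.
  exists (WOtime b2 1), (time_top b2 1); eexists; split; first exact: (blocks_halts bh).
  rewrite /= h2 -hout -en; apply: functional_extensionality => m.
  by rewrite /ooutput /= /ostep /= /ioutput; case: m.
move=> [W [top [c hc]]]; have [B' [su [b' [n [[ru hs _ _] _ _]]]]] := halts_blocks hc.
have nohalt_p := not_halts_nohalt no.
have [b0 [_ min0']] := @least B' (fun _ => True) (ex_intro _ b' I).
have min0 v : ~ wlt v b0 by move=> /min0'; apply.
pose B := @WOsub B' (fun x => forall m, ~ nth_succ b0 m x); pose e (x : B) := proj1_sig x.
have [s r] := brun_exists (iinit p a) (@istep p) (ilim p) B.
have [ss rs] := brun_exists (sinit p a) (@tstep 3 _ (@sdelta p)) (ilim p) B.
have emono (u v : B) : wlt u v -> wlt (e u) (e v) by [].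
have all_m (x : B) m : exists2 v, wlt v (e x) & nth_succ b0 m v.
  elim: m => [|m [v vx hv]].
    exists b0 => //; case: (wlt_total b0 (e x)) => [//|[h|/min0 //]].
    by case: (proj2_sig x 0) => /=.
  have [v' iv] := @imm_exists B' v (ex_intro _ (e x) vx).
  have hv' : nth_succ b0 m.+1 v' by exists v.
  exists v' => //; case: (wlt_total v' (e x)) => [//|[h|h]].
    by case: (proj2_sig x m.+1); rewrite -/(e x) -h.
  by case: (proj2 iv (e x)).
have dec x : (exists m, nth_succ b0 m x) \/ (exists w, x = e w).
  case: (classic (exists m, nth_succ b0 m x)) => h; [by left|right].
  have h' m : ~ nth_succ b0 m x by move=> hm; apply: h; exists m.
  by exists (exist _ x h').
have econv (u v : B) (x : B') : wlt (e u) x -> wlt x (e v) -> exists w, x = e w.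
  move=> ux _; case: (dec x) => [[m hx]|//].
  have [v' v'u hv'] := all_m u m.
  by rewrite (nth_succ_uniq hx hv') in ux; case: (wlt_asym ux v'u).
have emin (x : B) : (forall v, ~ wlt v x) ->
    (forall v, wlt v (e x) -> exists m, nth_succ b0 m v) /\
    (forall m, exists2 v, wlt v (e x) & nth_succ b0 m v).
  by move=> mx; split=> // v vx; case: (dec v) => // -[w ew]; subst v; case: (mx w).
case: (dec b') => [[m hb]|[b1 eb]]; first exact: (exp_nohalt ru min0 hb hs).
subst b'; apply: (urun_nohalt emono econv min0 emin r ru rs (b := b1) _ _ hs) => [u _|];
  exact: (nohalt_p _ _ r).
Qed.

Theorem mainTheorem18 :
  (forall f : real -> option real,
      (exists p : ittm, ittm_computes p f) <-> (exists q : ottm, ottm_computes q f)) /\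
  (forall A : WO, ittm_clockable A <-> ottm_clockable A).
Proof.
split=> [f|A]; split.
- by move=> [p h]; exists (unfolder p); apply: ittm_to_ottm_computes.
- by move=> [q h]; exists (copier q); apply: ottm_to_ittm_computes.
- exact: ittm_to_ottm_clockable.
- exact: ottm_to_ittm_clockable.
Qed.
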